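(* Let $S$ be a Kulikov surface with Kulikov morphism $F_S:S\to\mathbb{C}^2$ (defined in the context), and let $p$ be a regular function on $S$ which is a primitive element of the field extension $\mathbb{C}(\mathbb{C}^2)\subset\mathbb{C}(S)$ induced by $F_S$. Let $\overline{S}=\mathbb{C}\times S$ and let $F_{\overline{S}}:\overline{S}\to\mathbb{C}^3$ be the morphism such that $F_{\overline{S}}(x_0,x)=(x_0+p(x),F_S(x))$ for any $(x_0,x)\in\mathbb{C}\times S$. Then $F_{\overline{S}}$ is an étale morphism which induces a non-étale morphism $\overline{F_{\overline{S}}}:\{0\}\times S\to Z$, where $Z$ is the Zariski closure in $\mathbb{C}^3$ of the image $F_{\overline{S}}(\{0\}\times S)$.
   Context: **Kulikov surfaces and morphisms.** Let $\mathbb{P}_2=\mathbb{P}_2(\mathbb{C})$ with homogeneous coordinates $X_1,X_2,X_3$, let $P=(1:1:1)$, and for $1\le i\le 3$ let $Q_i = 3X_i^2 - X_1X_2 - X_1X_3 - X_2X_3$ (three conics passing through $P$). Let $\phi : \mathbb{P}_2 - \{P\} \to \mathbb{P}_2$ be the morphism $x \mapsto (Q_1(x):Q_2(x):Q_3(x))$. Let $R$ be the Zariski closure in $\mathbb{P}_2$ of the set of ramification points of $\phi$; it is the cubic with a node at $P$ defined by $\sum_{i\ne j} X_i^2X_j - 6X_1X_2X_3$. Let $Q = a_1Q_1+a_2Q_2+a_3Q_3$ be a generic linear combination with complex coefficients, and let $C$ be the conic defined by $Q$. It passes through $P$ and meets $R$ transversely at each point of their intersection (at the node $P$: transversely to both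 branches of $R$), and $\phi$ maps the complement of $C$ in $\mathbb{P}_2$ into the complement of a line $L$ of $\mathbb{P}_2$ (namely $L : a_1Y_1+a_2Y_2+a_3Y_3=0$ in the target coordinates $Y_1,Y_2,Y_3$). Let $\sigma : \tilde{\mathbb{P}}_2 \to \mathbb{P}_2$ be the blowing-up of $P$, $E=\sigma^{-1}(P)$ the exceptional curve, and $\tilde R$, $\tilde C$ the strict transforms of $R$, $C$ by $\sigma$ (the irreducible curves with $\sigma^{-1}(R)=E\cup\tilde R$ and $\sigma^{-1}(C)=E\cup\tilde C$). The surface $S = \tilde{\mathbb{P}}_2 - (\tilde R\cup\tilde C)$ is called a Kulikov surface. The map $\phi\circ\sigma$ extends to $\tilde{\mathbb{P}}_2$ and induces an unramified morphism $F_S : S \to \mathbb{P}_2 - L \cong \mathbb{C}^2$ of geometric degree $3$, called the Kulikov morphism on $S$. Étale means unramified and flat. *)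

(* Defs.v *)
From HB Require Import structures.
From mathcomp Require Import all_boot all_order all_algebra.
From mathcomp Require Import generic_quotient ring_quotient.
From mathcomp Require Import boolp classical_sets functions filter reals.
From mathcomp Require Import complex.

Set Implicit Arguments.
Unset Strict Implicit.
Unset Printing Implicit Defensive.

Import GRing.Theory.

Local Open Scope classical_set_scope.
Local Open Scope ring_scope.
Local Open Scope quotient_scope.

(* Classical varieties over k, as spaces with k-valued functions.  The Zariski
   topology and the regular functions are generated by a family of local
   coordinates: [loc_coord U f] says that f is one of the coordinates and that it
   is defined on U (its values outside U are irrelevant). *)

Record kspace (k : fieldType) := KSpace {
  pt :> Type;
  loc_coord : set pt -> (pt -> k) -> Prop
}.

Section Spaces.
Variable k : fieldType.
Implicit Types X Y : kspace k.

(* [ratexp x U f]: f is a rational expression over k in the local coordinates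
   all of whose denominators are nonzero at x; U is the set of the points at
   which it is defined, i.e., a basic Zariski open neighbourhood of x. *)
Inductive ratexp X (x : X) : set X -> (X -> k) -> Prop :=
| ratexp_const c : ratexp x setT (fun=> c)
| ratexp_coord U f : loc_coord U f -> U x -> ratexp x U f
| ratexp_add U V f g : ratexp x U f -> ratexp x V g ->
    ratexp x (U `&` V) (fun y => f y + g y)
| ratexp_mul U V f g : ratexp x U f -> ratexp x V g ->
    ratexp x (U `&` V) (fun y => f y * g y)
| ratexp_inv U f : ratexp x U f -> f x != 0 ->
    ratexp x (U `&` [set y | f y != 0]) (fun y => (f y)^-1).

Definition znbhs X (x : X) : set_system X :=
  [set N | exists U f, ratexp x U f /\ U `<=` N].

Definition zopen X (U : set X) : Prop := forall x, U x -> znbhs x U.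

Definition zclosure X (A : set X) : set X :=
  [set x | forall N, znbhs x N -> (N `&` A) !=set0].

(* Its members are the sets that contain a dense open set. *)
Definition zgeneric X : set_system X :=
  [set D | exists U, [/\ zopen U, zclosure U = setT & U `<=` D]].
Arguments zgeneric : clear implicits.

Definition regular_at X (x : X) (f : X -> k) : Prop :=
  exists U g, ratexp x U g /\ {in U, f =1 g}.

Definition is_regular X (f : X -> k) : Prop := forall x, regular_at x f.

Definition is_morphism X Y (f : X -> Y) : Prop := forall x,
  (forall N, znbhs (f x) N -> znbhs x (f @^-1` N)) /\
  (forall g, regular_at (f x) g -> regular_at x (g \o f)).

Lemma ratexp_in X (x : X) U f : ratexp x U f -> U x.
Proof. by elim. Qed.

Lemma ratexp_near X (x y : X) U f : ratexp x U f -> U y -> ratexp y U f.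
Proof.
move=> h; elim: h y => {U f}.
- by move=> c y _; constructor.
- by move=> U f cf _ y Uy; apply: ratexp_coord.
- by move=> U V f g _ IHf _ IHg y [Uy Vy]; apply: ratexp_add; auto.
- by move=> U V f g _ IHf _ IHg y [Uy Vy]; apply: ratexp_mul; auto.
- by move=> U f _ IHf _ y [Uy fy]; apply: ratexp_inv; auto.
Qed.

Lemma znbhs_filter X (x : X) : Filter (znbhs x).
Proof.
split.
- by exists setT, (fun=> 0); split=> //; constructor.
- move=> M N [U [f [hf UM]]] [V [g [hg VN]]].
  exists (U `&` V), (fun y => f y + g y); split; first exact: ratexp_add.
  by move=> y [/UM My /VN Ny].
- by move=> M N MN [U [f [hf UM]]]; exists U, f; split=> // y /UM /MN.
Qed.

Lemma zgeneric_filter X : Filter (zgeneric X).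
Proof.
split.
- exists setT; split=> //.
    by move=> x _; exists setT, (fun=> 0); split=> //; constructor.
  apply/seteqP; split=> // x _ N [U [f [hf UN]]]; exists x; split=> //.
  exact/UN/(ratexp_in hf).
- move=> D E [U [oU dU UD]] [V [oV dV VE]]; exists (U `&` V); split.
  + move=> x [/oU nU /oV nV].
    exact: (@filterI _ _ (znbhs_filter x)).
  + apply/seteqP; split=> // x _ N [W [f [hf WN]]].
    have nW y : W y -> znbhs y W.
      by move=> Wy; exists W, f; split=> //; exact: (ratexp_near hf Wy).
    have [y [Wy Uy]] : (W `&` U) !=set0.
      have : zclosure U x by rewrite dU.
      by apply; apply/nW/(ratexp_in hf).
    have [z [[Wz Uz] Vz]] : ((W `&` U) `&` V) !=set0.
      have : zclosure V y by rewrite dV.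
      by apply; apply: (@filterI _ _ (znbhs_filter y)); [apply: nW|apply: oU].
    by exists z; split=> //; apply: WN.
  + by move=> x [/UD Dx /VE Ex].
- by move=> D E DE [U [oU dU UD]]; exists U; split=> // x /UD /DE.
Qed.

Lemma regular_at_cst X (x : X) c : regular_at x (fun=> c).
Proof. by exists setT, (fun=> c); split=> //; constructor. Qed.

Lemma regular_at_add X (x : X) (f g : X -> k) :
  regular_at x f -> regular_at x g -> regular_at x (f + g).
Proof.
move=> [U [f' [hf ff']]] [V [g' [hg gg']]].
exists (U `&` V), (fun y => f' y + g' y); split; first exact: ratexp_add.
move=> y /set_mem [Uy Vy].
by rewrite -(ff' y (mem_set Uy)) -(gg' y (mem_set Vy)).
Qed.

Lemma regular_at_mul X (x : X) (f g : X -> k) :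
  regular_at x f -> regular_at x g -> regular_at x (f * g).
Proof.
move=> [U [f' [hf ff']]] [V [g' [hg gg']]].
exists (U `&` V), (fun y => f' y * g' y); split; first exact: ratexp_mul.
move=> y /set_mem [Uy Vy].
by rewrite -(ff' y (mem_set Uy)) -(gg' y (mem_set Vy)).
Qed.

Lemma regular_at_opp X (x : X) (f : X -> k) :
  regular_at x f -> regular_at x (- f).
Proof.
move=> /(regular_at_mul (regular_at_cst x (-1))).
by congr regular_at; apply/funext => y; apply: mulN1r.
Qed.

End Spaces.

(* [germs FF] is the ring of the functions that are regular on some member of the
   filter F, modulo those that vanish on some member of F. *)

Section Germs.
Variables (k : fieldType) (X : kspace k) (F : set_system X) (FF : Filter F).

Definition near_regular : pred (X -> k) :=
  fun f => `[< \forall x \near F, regular_at x f >].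

Lemma near_regular_subring : subring_closed near_regular.
Proof.
split.
- by apply/asboolP; apply: filterE => x; apply: regular_at_cst.
- move=> f g /asboolP hf /asboolP hg; apply/asboolP.
  apply: filterS2 hf hg => x hf hg.
  exact/regular_at_add/regular_at_opp.
- move=> f g /asboolP hf /asboolP hg; apply/asboolP.
  by apply: filterS2 hf hg => x hf hg; apply: regular_at_mul.
Qed.

Record nearfun :=
  NearFun { nearfun_val :> X -> k; _ : nearfun_val \in near_regular }.

HB.instance Definition _ := [isSub for nearfun_val].
HB.instance Definition _ := [Choice of nearfun by <:].
HB.instance Definition _ := GRing.SubChoice_isSubComPzRing.Build
  (X -> k) near_regular nearfun near_regular_subring.

Definition near_zero : pred nearfun :=
  fun f => `[< \forall x \near F, f x = 0 >].

Lemma near_zero_zmod : zmod_closed near_zero.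
Proof.
split.
- by apply/asboolP; apply: filterE.
- move=> f g /asboolP hf /asboolP hg; apply/asboolP.
  apply: filterS2 hf hg => x fx gx.
  have -> : (f - g) x = f x - g x by [].
  by rewrite fx gx subrr.
Qed.

HB.instance Definition _ :=
  GRing.isZmodClosed.Build _ near_zero near_zero_zmod.

Lemma near_zeroM f g : g \in near_zero -> f * g \in near_zero.
Proof.
move=> /asboolP hg; apply/asboolP; apply: filterS hg => x gx.
have -> : (f * g) x = f x * g x by [].
by rewrite gx mulr0.
Qed.

Definition germs := Quotient.quot (GRing.ZmodClosed.clone nearfun near_zero _).
HB.instance Definition _ := GRing.Zmodule.on germs.
HB.instance Definition _ := EqQuotient.on germs.

Definition germs_one : germs := \pi_germs 1.
Definition germs_mul (u v : germs) : germs := \pi_germs (repr u * repr v).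

Lemma pi_germs_mul (f g : nearfun) :
  germs_mul (\pi f) (\pi g) = \pi_germs (f * g).
Proof.
rewrite /germs_mul; apply/eqP.
rewrite -Quotient.idealrBE.
set f' := repr _; set g' := repr _.
have hf : f' - f \in near_zero by rewrite Quotient.idealrBE reprK.
have hg : g' - g \in near_zero by rewrite Quotient.idealrBE reprK.
have -> : f' * g' - f * g = f' * (g' - g) + g * (f' - f).
  by rewrite !mulrBr [g * f']mulrC [g * f]mulrC addrA subrK.
by apply: rpredD; apply: near_zeroM.
Qed.

Lemma germs_mulA : associative germs_mul.
Proof.
move=> u v w; rewrite -[u]reprK -[v]reprK -[w]reprK.
move: (repr u) (repr v) (repr w) => f g h.
by rewrite (pi_germs_mul f g) (pi_germs_mul g h) 2!pi_germs_mul mulrA.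
Qed.

Lemma germs_mulC : commutative germs_mul.
Proof.
move=> u v; rewrite -[u]reprK -[v]reprK.
move: (repr u) (repr v) => f g.
by rewrite (pi_germs_mul f g) (pi_germs_mul g f) mulrC.
Qed.

Lemma germs_mul1 : left_id germs_one germs_mul.
Proof. by move=> u; rewrite -[u]reprK [LHS]pi_germs_mul mul1r. Qed.

Lemma germs_mulDl : left_distributive germs_mul +%R.
Proof.
move=> u v w; rewrite -[u]reprK -[v]reprK -[w]reprK.
move: (repr u) (repr v) (repr w) => f g h.
have piD (f1 f2 : nearfun) : \pi_germs f1 + \pi_germs f2 = \pi_germs (f1 + f2).
  by rewrite [RHS]Quotient.pi_add.
by rewrite piD (pi_germs_mul f h) (pi_germs_mul g h) piD pi_germs_mul mulrDl.
Qed.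

HB.instance Definition _ := GRing.Zmodule_isComPzRing.Build germs
  germs_mulA germs_mulC germs_mul1 germs_mulDl.

(* [germ f] is 0 when f is not regular near F. *)
Definition germ (f : X -> k) : germs := \pi_germs (insubd (0 : nearfun) f).
Definition germ_fun (u : germs) : X -> k := repr u.

Lemma germ_funK (f : X -> k) :
  F [set x | regular_at x f] -> F [set x | germ_fun (germ f) x = f x].
Proof.
move=> hf; have hn : f \in near_regular by apply/asboolP.
rewrite /germ_fun /germ; set g := insubd _ _.
have gE : g = f :> (_ -> _) by rewrite /g insubdK.
have : repr (\pi_germs g) - g \in near_zero.
  by rewrite Quotient.idealrBE reprK.
move=> /asboolP; apply: filterS => x /= h.
by apply/eqP; rewrite -subr_eq0 -gE; apply/eqP.
Qed.

End Germs.

(* [ratfun X] is the function field when X is irreducible. *)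
Definition stalk (k : fieldType) (X : kspace k) (x : X) : comPzRingType :=
  germs (znbhs_filter x).
Definition ratfun (k : fieldType) (X : kspace k) : comPzRingType :=
  germs (zgeneric_filter X).

Section Flatness.
Variables (A B : comPzRingType) (phi : A -> B).

Definition balanced (M : lmodType A) (G : zmodType) (beta : M -> B -> G) :=
  [/\ forall m n b, beta (m + n) b = beta m b + beta n b,
      forall m b c, beta m (b + c) = beta m b + beta m c
    & forall a m b, beta (a *: m) b = beta m (phi a * b)].

(* [tensor_zero t]: the sum of the m (x) b, for (m, b) in t, vanishes in
   the tensor product of M and B over A, characterised by its universal
   property. *)
Definition tensor_zero (M : lmodType A) (t : seq (M * B)) : Prop :=
  forall (G : zmodType) (beta : M -> B -> G), balanced beta ->
    \sum_(mb <- t) beta mb.1 mb.2 = 0.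

(* Tensoring with B preserves injectivity. *)
Definition flat : Prop :=
  forall (M N : lmodType A) (f : {linear M -> N}), injective f ->
  forall t : seq (M * B),
    tensor_zero [seq (f mb.1, mb.2) | mb <- t] -> tensor_zero t.

End Flatness.

Section Etale.
Variables (k : fieldType) (X Y : kspace k) (f : X -> Y).

Definition stalk_map (x : X) (u : stalk (f x)) : stalk x :=
  germ (znbhs_filter x) (germ_fun u \o f).

Definition max_ideal (Z : kspace k) (z : Z) : set (stalk z) :=
  [set u | germ_fun u z = 0].

Definition flat_at (x : X) : Prop := flat (@stalk_map x).

(* The maximal ideal of the local ring at f x generates that of the local ring
   at x.  All points are k-rational, so the residue field extension is trivial
   as soon as k is algebraically closed. *)
Definition unramified_at (x : X) : Prop :=
  forall v : stalk x, max_ideal v <->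
    exists s : seq (stalk (f x) * stalk x),
      (forall uw, uw \in s -> max_ideal uw.1) /\
      v = \sum_(uw <- s) stalk_map uw.1 * uw.2.

Definition etale : Prop :=
  is_morphism f /\ forall x, flat_at x /\ unramified_at x.

(* Meaningful when the inverse images of dense open sets by f contain dense
   open sets, e.g., when f is a dominant morphism of irreducible varieties. *)
Definition ratfun_map (u : ratfun Y) : ratfun X :=
  germ (zgeneric_filter X) (germ_fun u \o f).

(* The only subfield of k(X) that contains the image of k(Y) and p is k(X). *)
Definition primitive_element (p : X -> k) : Prop :=
  forall E : {pred ratfun X},
    subring_closed E ->
    (forall u v, u \in E -> u * v = 1 -> v \in E) ->
    (forall u, ratfun_map u \in E) ->
    germ (zgeneric_filter X) p \in E ->
  forall u, u \in E.

End Etale.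

Section Constructions.
Variable k : fieldType.

Definition affine_line : kspace k :=
  @KSpace k k (fun U f => U = setT /\ f = id).

Definition affine_space (n : nat) : kspace k :=
  @KSpace k 'rV[k]_n (fun U f => U = setT /\ exists i, f = fun x => x 0 i).

(* The points of P^n are the lines of k^(n+1); [hc x] is a choice of homogeneous
   coordinates of x. *)
Definition proj_pt (n : nat) := {W : {vspace 'rV[k]_n.+1} | \dim W == 1%N}.
Definition hc n (x : proj_pt n) : 'rV[k]_n.+1 := vpick (val x).

Definition proj_space (n : nat) : kspace k :=
  @KSpace k (proj_pt n) (fun U f => exists i j,
    U = [set x | hc x 0 j != 0] /\ f = fun x => hc x 0 i / hc x 0 j).

(* With the reduced structure when A is closed *)
Definition sub_space (X : kspace k) (A : set X) : kspace k :=
  @KSpace k {x : X | A x} (fun U f => exists V g,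
    [/\ loc_coord V g, U = (fun x => V (sval x)) & f = (fun x => g (sval x))]).

Definition prod_space (X Y : kspace k) : kspace k :=
  @KSpace k (X * Y)%type (fun U f =>
    (exists V g, [/\ @loc_coord k X V g, U = fst @^-1` V & f = g \o fst]) \/
    (exists V g, [/\ @loc_coord k Y V g, U = snd @^-1` V & f = g \o snd])).

End Constructions.

(* The homogeneous coordinates X_1, X_2, X_3 have indices 0, 1, 2. *)

Section Forms.
Variable A : comNzRingType.
Implicit Types x a : 'rV[A]_3.

Definition Qform (i : 'I_3) x : A :=
  3 * x 0 i ^+ 2 - x 0 0 * x 0 1 - x 0 0 * x 0 2 - x 0 1 * x 0 2.

Definition conic a x : A := \sum_i a 0 i * Qform i x.

(* -36 times this form is the Jacobian determinant of Q_1, Q_2, Q_3. *)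
Definition cubic x : A :=
  \sum_i \sum_(j | i != j) x 0 i ^+ 2 * x 0 j - 6 * x 0 0 * x 0 1 * x 0 2.

Definition netQ x : 'rV[A]_3 := \row_i Qform i x.

End Forms.

Section Kulikov.
Variable k : fieldType.
Implicit Type a : 'rV[k]_3.

Definition P111 : {vspace 'rV[k]_3} := <[const_mx 1]>%VS.

(* The point x + 't v on the line through x with direction v, with
   coordinates in k['t]. *)
Definition ray (x v : 'rV[k]_3) : 'rV[{poly k}]_3 :=
  map_mx polyC x + 'X *: map_mx polyC v.

(* A direction v is tangent to C at x if the form of C along the ray has no
   term in 't; it is tangent to (a branch of) R at x if the term of degree
   mult_x(R) in 't vanishes, where mult_x(R) is 2 at the node P and 1
   elsewhere.  C and R are transverse at x when they have no common tangent
   line; this entails that C is smooth at x. *)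
Definition transverse_at a (x : proj_space k 2) : Prop :=
  forall v : 'rV[k]_3,
    (conic (map_mx polyC a) (ray (hc x) v))`_1 = 0 ->
    (cubic (ray (hc x) v))`_(if val x == P111 then 2%N else 1%N) = 0 ->
  v \in val x.

Definition kulikov_generic a : Prop :=
  forall x : proj_space k 2, conic a (hc x) = 0 -> cubic (hc x) = 0 ->
    transverse_at a x.

(* The blowing-up of P = (1 : 1 : 1): the pairs (x, y) such that
   y = (x_1 - x_3 : x_2 - x_3) when x != P. *)
Definition blowup : kspace k :=
  @sub_space k (prod_space (proj_space k 2) (proj_space k 1)) [set z |
    (hc z.1 0 0 - hc z.1 0 2) * hc z.2 0 1 =
    (hc z.1 0 1 - hc z.1 0 2) * hc z.2 0 0].

Definition sigma (z : blowup) : proj_space k 2 := (sval z).1.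

Definition strict_transform (G : 'rV[k]_3 -> k) : set blowup :=
  zclosure [set z | val (sigma z) != P111 /\ G (hc (sigma z)) = 0].

Definition kulikov_surface a : kspace k :=
  @sub_space k blowup
    (~` (strict_transform (@cubic k) `|` strict_transform (conic a))).

(* Phi is the extension of phi \o sigma to S; M is a linear change of
   coordinates of the target P^2 whose first new coordinate is the equation
   a_1 Y_1 + a_2 Y_2 + a_3 Y_3 of L; it identifies the complement of L with
   k^2. *)
Definition kulikov_morphism a (F : kulikov_surface a -> affine_space k 2) :
    Prop :=
  exists Phi : kulikov_surface a -> proj_space k 2,
  [/\ is_morphism Phi,
      forall z, val (sigma (sval z)) != P111 ->
        val (Phi z) = <[netQ (hc (sigma (sval z)))]>%VS
    & exists M : 'M[k]_(1 + 2),
      [/\ M \in unitmx, usubmx M = a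
        & forall z, let w : 'rV[k]_(1 + 2) := hc (Phi z) *m M^T in
            w 0 0 != 0 /\ F z = (w 0 0)^-1 *: rsubmx w]].

Definition suspension (X : kspace k) (p : X -> k) (F : X -> affine_space k 2)
    (z : prod_space (affine_line k) X) : affine_space k 3 :=
  row_mx (const_mx (z.1 + p z.2)) (F z.2) : 'rV[k]_(1 + 2).

End Kulikov.

(* Main.v *)
From HB Require Import structures.
Require Import Defs.
From mathcomp Require Import all_boot all_order all_algebra.
From mathcomp Require Import generic_quotient ring_quotient.
From mathcomp Require Import boolp classical_sets functions filter reals.
From mathcomp Require Import complex ring zify.

(** In suitable coordinates the points of S are simple roots of binary cubics. The
    cyclic permutation of the coordinates of P^2 preserves the net of conics; in its
    eigencoordinates, a point of S over y in k^2 amounts to a simple root (s : e) of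
    the cubic
      c0 (s^3 - e^3) + 3 c1 s e^2 - 3 c2 s^2 e,
    where (c0, c1, c2) are coordinates of the point y of the plane P^2 - L. Here
    (s : e) is the direction of the line through P that contains the point of S; the
    cubic comes from the elimination of the position on this line, and its root is
    simple because the point is off the strict transform of R. This description
    of S is the record cubic_cover, established by kulikov_cubic_cover.

    The suspension is etale because it is standard etale (susp_etale): the affine
    coordinate t of the root satisfies an equation of degree 3 over k^3, of which it
    is a simple root, and it generates the local rings of k x S over those of k^3.
    Flatness holds because the local ring upstairs is a localization of a free
    module (flat_localization). That 1, t, t^2 are linearly independent is checked
    over the lines of k^3, above which S is a rational curve with parameter t
    (coef_zero).

    Suppose that the restriction to {0} x S -> Z is etale too. As p is primitive, t is
    a fraction al / be of functions of (p, F); flat local homomorphisms reflect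
    divisibility (flat_not_dvd), so t descends to a function on Z near any point
    of the image. Hence p separates the points of each fibre of F
    (etale_separates), and the difference of the values of p at two roots is a
    regular function without zeros on the space of the triples of distinct roots of a
    cubic of the net that lies off L.

    This is impossible (fibre_separation_false). A triple belongs to the net when
    s1 s2 s3 = e1 e2 e3, so up to scaling it is (z : s), (1 : s z), (s^2 : 1).
    In the parameters s and z the triples are good off the curves s = 0, z = 1,
    z = -1, normal_gap = 0 and normal_line = 0, so the difference is a product of
    powers of these equations (normal_diff_formula). The exponents are determined up
    to one integer j by the identification of the triples with parameters (s, z),
    (-s, -z) and (s, 1/z), the last with the first two roots exchanged, and by two
    curves of good triples that escape from these parameters (exponents): the
    difference is c V^j, where V is the square root of the discriminant divided by
    the square of the equation of L. Since V is invariant under cyclic permutations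
    of the roots, so is the difference of the values of p at two consecutive roots;
    but the three differences add up to 0.

    The genericity of the conic serves to ensure that normal_line does not degenerate
    on any curve s = constant, 0 and infinity included: the excluded conics are singular
    at a point of R (generic_net). *)

Set Implicit Arguments.
Unset Strict Implicit.
Unset Printing Implicit Defensive.

Import GRing.Theory Num.Theory.

Local Open Scope classical_set_scope.
Local Open Scope ring_scope.
Local Open Scope quotient_scope.

(** * Regular functions and neighbourhoods *)

Section RegularFunctions.
Variable k : fieldType.
Implicit Types X Y Z : kspace k.

Lemma znbhs_self X (x : X) N : znbhs x N -> N x.
Proof. by move=> [U [f [hf UN]]]; apply/UN/(ratexp_in hf). Qed.

Lemma ratexp_znbhs X (x : X) U f : ratexp x U f -> znbhs x U.
Proof. by move=> hf; exists U, f; split. Qed.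

Lemma znbhsS X (x : X) M N : znbhs x M -> M `<=` N -> znbhs x N.
Proof. by move=> [U [f [hf UM]]] MN; exists U, f; split=> // y /UM/MN. Qed.

Lemma znbhsI X (x : X) M N : znbhs x M -> znbhs x N -> znbhs x (M `&` N).
Proof. exact: (@filterI _ _ (znbhs_filter x)). Qed.

Lemma znbhsT X (x : X) : znbhs x setT.
Proof. exact: (@filterT _ _ (znbhs_filter x)). Qed.

Lemma znbhs_near X (x : X) N : znbhs x N -> znbhs x [set y | znbhs y N].
Proof.
move=> [U [f [hf UN]]]; apply: znbhsS (ratexp_znbhs hf) _ => y Uy.
by apply: znbhsS UN; apply/ratexp_znbhs/(ratexp_near hf).
Qed.

Lemma ratexp_regular X (x : X) U f : ratexp x U f -> regular_at x f.
Proof. by move=> hf; exists U, f; split. Qed.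

Lemma regular_near X (x : X) f :
  regular_at x f -> znbhs x [set y | regular_at y f].
Proof.
move=> [U [g [hg fg]]]; apply: znbhsS (ratexp_znbhs hg) _ => y Uy.
by exists U, g; split=> //; apply: ratexp_near hg Uy.
Qed.

(** The summand 0 times a local coordinate shrinks the domain of a rational
    expression to a prescribed neighbourhood. *)
Lemma eq_regular X (x : X) f g :
  znbhs x [set y | f y = g y] -> regular_at x f -> regular_at x g.
Proof.
move=> [V [h [hh Vfg]]] [U [f' [hf ff']]].
exists (U `&` (setT `&` V)), (fun y => f' y + 0 * h y); split.
  by apply: ratexp_add => //; apply: ratexp_mul => //; constructor.
by move=> y /set_mem[Uy [_ /Vfg <-]]; rewrite mul0r addr0 ff' // inE.
Qed.

Lemma regular_coord X (x : X) U f :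
  loc_coord U f -> U x -> regular_at x f.
Proof. by move=> cf Ux; apply/ratexp_regular/ratexp_coord/Ux. Qed.

Lemma regular_inv X (x : X) f :
  regular_at x f -> f x != 0 -> regular_at x (fun y => (f y)^-1).
Proof.
move=> [U [g [hg fg]]] fx; have Ux := ratexp_in hg.
exists (U `&` [set y | g y != 0]), (fun y => (g y)^-1); split.
  by apply: ratexp_inv => //; rewrite -fg ?inE.
by move=> y /set_mem[Uy _]; rewrite fg ?inE.
Qed.

Lemma regular_neq0 X (x : X) f :
  regular_at x f -> f x != 0 -> znbhs x [set y | f y != 0].
Proof.
move=> [U [g [hg fg]]] fx; have Ux := ratexp_in hg.
have gx : g x != 0 by rewrite -fg ?inE.
apply: znbhsS (ratexp_znbhs (ratexp_inv hg gx)) _ => y [Uy gy] /=.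
by rewrite fg ?inE.
Qed.

Lemma regular_add X (x : X) f g : regular_at x f -> regular_at x g ->
  regular_at x (fun y => f y + g y).
Proof. exact: regular_at_add. Qed.

Lemma regular_mul X (x : X) f g : regular_at x f -> regular_at x g ->
  regular_at x (fun y => f y * g y).
Proof. exact: regular_at_mul. Qed.

Lemma regular_opp X (x : X) f :
  regular_at x f -> regular_at x (fun y => - f y).
Proof. exact: regular_at_opp. Qed.

Lemma regular_sub X (x : X) f g : regular_at x f -> regular_at x g ->
  regular_at x (fun y => f y - g y).
Proof. by move=> hf hg; apply/regular_add/regular_opp. Qed.

Lemma regular_exp X (x : X) f n :
  regular_at x f -> regular_at x (fun y => f y ^+ n).
Proof.
move=> hf; elim: n => [|n IHn].
  have -> : (fun y => f y ^+ 0) = fun=> 1 by apply/funext=> y; rewrite expr0.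
  exact: regular_at_cst.
have -> : (fun y => f y ^+ n.+1) = fun y => f y * f y ^+ n.
  by apply/funext=> y; rewrite exprS.
exact: regular_mul.
Qed.

Lemma regular_div X (x : X) f g : regular_at x f -> regular_at x g ->
  g x != 0 -> regular_at x (fun y => f y / g y).
Proof. by move=> hf hg gx; apply/regular_mul/regular_inv. Qed.

Lemma regular_sum X (x : X) (I : Type) (s : seq I) (F : I -> X -> k) :
  (forall i, regular_at x (F i)) -> regular_at x (fun y => \sum_(i <- s) F i y).
Proof.
move=> hF; elim: s => [|i s IHs].
  have -> : (fun y => \sum_(i <- [::]) F i y) = fun=> 0.
    by apply/funext=> y; rewrite big_nil.
  exact: regular_at_cst.
have -> : (fun y => \sum_(j <- i :: s) F j y) =
    fun y => F i y + \sum_(j <- s) F j y.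
  by apply/funext=> y; rewrite big_cons.
exact: regular_add.
Qed.

(** When the local coordinates are defined everywhere, rational expressions are
    fractions of elements of any ring of functions containing the coordinates. *)
Lemma ratexp_frac X (P : (X -> k) -> Prop) (x : X) U f :
    (forall c, P (fun=> c)) ->
    (forall f g, P f -> P g -> P (fun y => f y + g y)) ->
    (forall f g, P f -> P g -> P (fun y => f y * g y)) ->
    (forall U f, loc_coord U f -> U = setT /\ P f) ->
  ratexp x U f -> exists N D, [/\ P N, P D, D x != 0 &
    forall y, D y != 0 -> U y /\ f y = N y / D y].
Proof.
move=> Pc Pa Pm Pl; elim=> {U f}.
- move=> c; exists (fun=> c), (fun=> 1).
  by split=> //; rewrite ?oner_neq0 // => y _; rewrite divr1.
- move=> U f /Pl[-> Pf] _; exists f, (fun=> 1).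
  by split=> //; rewrite ?oner_neq0 // => y _; rewrite divr1.
- move=> U V f g _ [N [D [PN PD Dx hf]]] _ [M [E [PM PE Ex hg]]].
  exists (fun y => N y * E y + M y * D y), (fun y => D y * E y).
  split; [by auto|by auto|by rewrite mulf_neq0|move=> y].
  rewrite mulf_eq0 negb_or => /andP[Dy Ey].
  have [Uy ->] := hf y Dy; have [Vy ->] := hg y Ey.
  by split=> //; rewrite addf_div.
- move=> U V f g _ [N [D [PN PD Dx hf]]] _ [M [E [PM PE Ex hg]]].
  exists (fun y => N y * M y), (fun y => D y * E y).
  split; [by auto|by auto|by rewrite mulf_neq0|move=> y].
  rewrite mulf_eq0 negb_or => /andP[Dy Ey].
  have [Uy ->] := hf y Dy; have [Vy ->] := hg y Ey.
  by split=> //; rewrite mulf_div.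
- move=> U f _ [N [D [PN PD Dx hf]]] fx.
  exists (fun y => D y * D y), (fun y => N y * D y); split=> [||| y].
  + by auto.
  + by auto.
  + have [_ fxE] := hf x Dx; move: fx; rewrite fxE mulf_eq0 negb_or.
    by case/andP=> Nx _; rewrite mulf_neq0.
  + rewrite mulf_eq0 negb_or => /andP[Ny Dy].
    have [Uy fy] := hf y Dy; rewrite fy /=; split.
      by split=> //=; rewrite fy mulf_neq0 ?invr_neq0.
    by rewrite invf_div -mulf_div divff // mulr1.
Qed.

(** ** Morphisms at a point *)

Definition morph_at X Y (g : X -> Y) (x : X) : Prop :=
  (forall N, znbhs (g x) N -> znbhs x (g @^-1` N)) /\
  (forall f, regular_at (g x) f -> regular_at x (f \o g)).

(** Rational expressions are built from local coordinates, so these suffice. *)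
Lemma morph_at_coord X Y (g : X -> Y) (x : X) :
    (forall U f, loc_coord U f -> U (g x) ->
      znbhs x (g @^-1` U) /\ regular_at x (f \o g)) ->
  morph_at g x.
Proof.
move=> hg.
have rat U f : ratexp (g x) U f ->
    znbhs x (g @^-1` U) /\ regular_at x (f \o g).
  elim=> {U f}.
  - by move=> c; split; [apply: znbhsT|apply: regular_at_cst].
  - exact: hg.
  - move=> U V f h _ [nU rf] _ [nV rh].
    by split; [apply: znbhsI|apply: regular_add].
  - move=> U V f h _ [nU rf] _ [nV rh].
    by split; [apply: znbhsI|apply: regular_mul].
  - move=> U f _ [nU rf] fx; split; last exact: regular_inv.
    by apply: znbhsI => //; apply: regular_neq0 rf fx.
split.
- move=> N [U [f [/rat[nU _] UN]]].
  by apply: znbhsS nU _ => y /UN.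
- move=> f [U [h [/rat[nU rh] fh]]]; apply: eq_regular rh.
  by apply: znbhsS nU _ => y Uy /=; rewrite fh ?inE.
Qed.

Lemma morph_at_morphism X Y (g : X -> Y) :
  is_morphism g <-> forall x, morph_at g x.
Proof. by []. Qed.

Lemma morph_at_comp X Y Z (g : X -> Y) (h : Y -> Z) x :
  morph_at g x -> morph_at h (g x) -> morph_at (h \o g) x.
Proof.
move=> [g1 g2] [h1 h2]; split; first by move=> N /h1/g1.
by move=> f /h2/g2.
Qed.

Lemma eq_morph_at X Y (g h : X -> Y) x :
  znbhs x [set y | g y = h y] -> morph_at g x -> morph_at h x.
Proof.
move=> gh [g1 g2]; have ghx := znbhs_self gh; rewrite /= in ghx.
split.
- move=> N; rewrite -ghx => /g1 nN.
  by apply: znbhsS (znbhsI nN gh) _ => y [Ny /= <-].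
- move=> f; rewrite -ghx => /g2; apply: eq_regular.
  by apply: znbhsS gh _ => y /= ->.
Qed.

Lemma morph_at_sub X Y (B : set Y) (g : X -> sub_space B) x :
  morph_at (fun y => sval (g y) : Y) x -> morph_at g x.
Proof.
move=> [g1 g2]; apply: morph_at_coord => U f [V [h [lh -> ->]]] /= Vx.
split; first exact: (g1 _ (ratexp_znbhs (ratexp_coord lh Vx))).
exact: (g2 _ (regular_coord lh Vx)).
Qed.

Lemma morph_at_sval X (A : set X) (x : sub_space A) :
  morph_at (fun y : sub_space A => sval y : X) x.
Proof.
apply: morph_at_coord => U f lf Ux.
have l : @loc_coord _ (sub_space A) (fun y => U (sval y)) (fun y => f (sval y)).
  by exists U, f.
split; first exact: (ratexp_znbhs (ratexp_coord l Ux)).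
exact: (regular_coord l Ux).
Qed.

Lemma morph_at_fst X Y (z : prod_space X Y) :
  morph_at (fun y : prod_space X Y => y.1 : X) z.
Proof.
apply: morph_at_coord => U f lf Ux.
have l : @loc_coord _ (prod_space X Y) (fst @^-1` U) (f \o fst).
  by left; exists U, f.
split; first exact: (ratexp_znbhs (ratexp_coord l Ux)).
exact: (regular_coord l Ux).
Qed.

Lemma morph_at_snd X Y (z : prod_space X Y) :
  morph_at (fun y : prod_space X Y => y.2 : Y) z.
Proof.
apply: morph_at_coord => U f lf Ux.
have l : @loc_coord _ (prod_space X Y) (snd @^-1` U) (f \o snd).
  by right; exists U, f.
split; first exact: (ratexp_znbhs (ratexp_coord l Ux)).
exact: (regular_coord l Ux).
Qed.

Lemma morph_at_pair Z X Y (g : Z -> X) (h : Z -> Y) z :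
  morph_at g z -> morph_at h z ->
  morph_at (fun y => (g y, h y) : prod_space X Y) z.
Proof.
move=> [g1 g2] [h1 h2]; apply: morph_at_coord => U f.
case=> -[V [u [lu -> ->]]] Vz.
  split; first exact: (g1 _ (ratexp_znbhs (ratexp_coord lu Vz))).
  exact: (g2 _ (regular_coord lu Vz)).
split; first exact: (h1 _ (ratexp_znbhs (ratexp_coord lu Vz))).
  exact: (h2 _ (regular_coord lu Vz)).
Qed.

Lemma morph_at_affine X n (g : X -> affine_space k n) x :
  (forall i, regular_at x (fun y => g y 0 i)) -> morph_at g x.
Proof.
move=> hg; apply: morph_at_coord => U f [-> [i ->]] _.
by split; [exact: znbhsT|exact: hg].
Qed.

Lemma regular_affine n (x : affine_space k n) i :
  regular_at x (fun y : affine_space k n => y 0 i).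
Proof. by apply: (@regular_coord (affine_space k n) x setT) => //; split=> //;
  exists i. Qed.

Lemma morph_at_line X (g : X -> affine_line k) x :
  regular_at x (g : X -> k) -> morph_at g x.
Proof.
move=> hg; apply: morph_at_coord => U f [-> ->] _.
by split; [exact: znbhsT|exact: hg].
Qed.

Lemma regular_line (x : affine_line k) : regular_at x (id : affine_line k -> k).
Proof. by apply: (@regular_coord (affine_line k) x setT). Qed.

Lemma regular_horner X (x : X) f (p : {poly k}) :
  regular_at x f -> regular_at x (fun y => p.[f y]).
Proof.
move=> hf; have -> : (fun y => p.[f y]) =
    fun y => \sum_(i < size p) p`_i * f y ^+ i.
  by apply/funext=> y; rewrite horner_coef.
by apply: regular_sum => i; apply/regular_mul/regular_exp/hf/regular_at_cst.
Qed.

(** ** Functions on the affine line *)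

Lemma regular_line_frac (x : affine_line k) f : regular_at x f ->
  exists N D : {poly k}, D.[x] != 0 /\
    forall y, D.[y] != 0 -> f y = N.[y] / D.[y].
Proof.
move=> [U [g [hg fg]]].
pose P (f : affine_line k -> k) := exists N : {poly k}, f = horner N.
have [] := @ratexp_frac (affine_line k) P _ _ _ _ _ _ _ hg.
- by move=> c; exists c%:P; apply/funext=> y; rewrite hornerC.
- by move=> _ _ [N ->] [M ->]; exists (N + M); apply/funext=> y; rewrite hornerD.
- by move=> _ _ [N ->] [M ->]; exists (N * M); apply/funext=> y; rewrite hornerM.
- by move=> _ _ [-> ->]; split=> //; exists 'X; apply/funext=> y; rewrite hornerX.
move=> N' [D' [[N ->] [D ->] Dx h]]; exists N, D; split=> // y /h[Uy <-].
by rewrite fg ?inE.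
Qed.

Lemma znbhs_line (x : affine_line k) N :
  znbhs x N <-> exists2 D : {poly k}, D.[x] != 0 & forall y, D.[y] != 0 -> N y.
Proof.
split=> [[U [f [hf UN]]]|[D Dx DN]].
  pose P (f : affine_line k -> k) := exists N : {poly k}, f = horner N.
  have [] := @ratexp_frac (affine_line k) P _ _ _ _ _ _ _ hf.
  - by move=> c; exists c%:P; apply/funext=> y; rewrite hornerC.
  - by move=> _ _ [M ->] [M' ->]; exists (M + M'); apply/funext=> y; rewrite hornerD.
  - by move=> _ _ [M ->] [M' ->]; exists (M * M'); apply/funext=> y; rewrite hornerM.
  - by move=> _ _ [-> ->]; split=> //; exists 'X; apply/funext=> y; rewrite hornerX.
  by move=> N' [D' [_ [D ->] Dx h]]; exists D => // y /h[/UN].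
apply: (@znbhsS (affine_line k) x [set y | D.[y] != 0] N _ DN).
apply: (@regular_neq0 (affine_line k) x (horner D)) => //.
exact/regular_horner/regular_line.
Qed.

End RegularFunctions.

(** * Germs *)

Section Germs.
Variables (k : fieldType) (X : kspace k) (F : set_system X) (FF : Filter F).
Implicit Types (f g : X -> k) (u v : germs FF).

Lemma pi_germs_eq (f g : nearfun F) :
  F [set x | f x = g x] <-> \pi_(germs FF) f = \pi_(germs FF) g.
Proof.
split=> [h|/eqP].
  apply/eqP; rewrite -Quotient.idealrBE; apply/asboolP.
  by apply: filterS h => x fg; have -> : (f - g) x = f x - g x by []; rewrite fg subrr.
rewrite -Quotient.idealrBE => /asboolP; apply: filterS => x.
by have -> : (f - g) x = f x - g x by []; move/eqP; rewrite subr_eq0 => /eqP.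
Qed.

Lemma pi_germ (f : nearfun F) : \pi_(germs FF) f = germ FF f.
Proof. by rewrite /germ valKd. Qed.

Lemma germ_fun_regular u : F [set x | regular_at x (germ_fun u)].
Proof. by rewrite /germ_fun; case: (repr u) => f /= /asboolP. Qed.

Lemma germ_nearfun f : F [set x | regular_at x f] ->
  exists g : nearfun F, (g = f :> (X -> k)) /\ germ FF f = \pi_(germs FF) g.
Proof.
move=> hf; have hn : f \in near_regular F by apply/asboolP.
by exists (insubd 0 f); rewrite insubdK //.
Qed.

Lemma germ_eq f g :
    F [set x | regular_at x f] -> F [set x | regular_at x g] ->
  F [set x | f x = g x] <-> germ FF f = germ FF g.
Proof.
move=> /germ_nearfun[f' [<- ->]] /germ_nearfun[g' [<- ->]].
exact: pi_germs_eq.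
Qed.

Lemma germ_germ_fun u : germ FF (germ_fun u) = u.
Proof. by rewrite /germ_fun -pi_germ reprK. Qed.

Lemma pi_germsD (f g : nearfun F) :
  \pi_(germs FF) f + \pi_(germs FF) g = \pi_(germs FF) (f + g).
Proof. by rewrite [RHS]Quotient.pi_add. Qed.

Lemma germD f g :
    F [set x | regular_at x f] -> F [set x | regular_at x g] ->
  germ FF f + germ FF g = germ FF (fun x => f x + g x).
Proof.
move=> /germ_nearfun[f' [<- ->]] /germ_nearfun[g' [<- ->]].
by rewrite pi_germsD pi_germ.
Qed.

Lemma germM f g :
    F [set x | regular_at x f] -> F [set x | regular_at x g] ->
  germ FF f * germ FF g = germ FF (fun x => f x * g x).
Proof.
move=> /germ_nearfun[f' [<- ->]] /germ_nearfun[g' [<- ->]].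
by rewrite [LHS]pi_germs_mul pi_germ.
Qed.

Lemma germ0 : germ FF (fun=> 0) = 0.
Proof.
have -> : (0 : germs FF) = \pi_(germs FF) 0.
  by apply: (addrI (\pi_(germs FF) 0)); rewrite addr0 pi_germsD addr0.
by rewrite pi_germ.
Qed.

Lemma germ1 : germ FF (fun=> 1) = 1.
Proof. by have -> : (1 : germs FF) = \pi_(germs FF) 1 by []; rewrite pi_germ. Qed.

Lemma germ_fun0 : F [set x | germ_fun (0 : germs FF) x = 0].
Proof.
rewrite -germ0; apply: germ_funK.
by apply: filterE => x; apply: regular_at_cst.
Qed.

Lemma germ_fun1 : F [set x | germ_fun (1 : germs FF) x = 1].
Proof.
rewrite -germ1; apply: germ_funK.
by apply: filterE => x; apply: regular_at_cst.
Qed.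

Lemma germ_funD u v :
  F [set x | germ_fun (u + v) x = germ_fun u x + germ_fun v x].
Proof.
rewrite -{1}(germ_germ_fun u) -{1}(germ_germ_fun v) germD;
  [|exact: germ_fun_regular..].
apply: germ_funK; apply: filterS2 (germ_fun_regular u) (germ_fun_regular v).
by move=> x hu hv; apply: regular_add.
Qed.

Lemma germ_funM u v :
  F [set x | germ_fun (u * v) x = germ_fun u x * germ_fun v x].
Proof.
rewrite -{1}(germ_germ_fun u) -{1}(germ_germ_fun v) germM;
  [|exact: germ_fun_regular..].
apply: germ_funK; apply: filterS2 (germ_fun_regular u) (germ_fun_regular v).
by move=> x hu hv; apply: regular_mul.
Qed.

Lemma germN f : F [set x | regular_at x f] ->
  - germ FF f = germ FF (fun x => - f x).
Proof.
move=> hf.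
have hNf : F [set x | regular_at x (fun x => - f x)].
  by apply: filterS hf => x; apply: regular_opp.
apply/eqP; rewrite eq_sym -addr_eq0 germD //; apply/eqP.
rewrite -germ0; apply: (germ_eq _ _).1.
- by apply: filterS2 hf hNf => x ? ?; apply: regular_add.
- by apply: filterE => x; apply: regular_at_cst.
- by apply: filterE => x; rewrite /= addNr.
Qed.

Lemma germ_funN u : F [set x | germ_fun (- u) x = - germ_fun u x].
Proof.
rewrite -{1}(germ_germ_fun u) germN; last exact: germ_fun_regular.
apply: germ_funK; apply: filterS (germ_fun_regular u).
by move=> x; apply: regular_opp.
Qed.

End Germs.

(** ** Local rings *)

Section Stalks.
Variable k : fieldType.
Implicit Types X Y : kspace k.

Definition stalk_germ X (x : X) (f : X -> k) : stalk x := germ (znbhs_filter x) f.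

Lemma stalk_germ_eq X (x : X) f g : regular_at x f ->
  znbhs x [set y | f y = g y] -> stalk_germ x f = stalk_germ x g.
Proof.
move=> hf fg; have hg := eq_regular fg hf.
exact: (germ_eq (znbhs_filter x) (regular_near hf) (regular_near hg)).1.
Qed.

Lemma stalk_germ_inj X (x : X) f g : regular_at x f -> regular_at x g ->
  stalk_germ x f = stalk_germ x g -> znbhs x [set y | f y = g y].
Proof. move=> hf hg.
exact: (germ_eq (znbhs_filter x) (regular_near hf) (regular_near hg)).2. Qed.

Lemma stalk_germK X (x : X) f : regular_at x f ->
  znbhs x [set y | germ_fun (stalk_germ x f) y = f y].
Proof. by move=> /regular_near/germ_funK. Qed.

Lemma regular_germ_fun X (x : X) (u : stalk x) : regular_at x (germ_fun u).
Proof. exact: (znbhs_self (germ_fun_regular u)). Qed.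

Lemma stalk_germ_fun X (x : X) (u : stalk x) : stalk_germ x (germ_fun u) = u.
Proof. exact: germ_germ_fun. Qed.

Lemma stalk_germD X (x : X) f g : regular_at x f -> regular_at x g ->
  stalk_germ x f + stalk_germ x g = stalk_germ x (fun y => f y + g y).
Proof. by move=> hf hg; apply: germD; apply: regular_near. Qed.

Lemma stalk_germM X (x : X) f g : regular_at x f -> regular_at x g ->
  stalk_germ x f * stalk_germ x g = stalk_germ x (fun y => f y * g y).
Proof. by move=> hf hg; apply: germM; apply: regular_near. Qed.

Lemma stalk_germ0 X (x : X) : stalk_germ x (fun=> 0) = 0.
Proof. exact: germ0. Qed.

Lemma stalk_germ1 X (x : X) : stalk_germ x (fun=> 1) = 1.
Proof. exact: germ1. Qed.

Definition stalk_ev X (x : X) (u : stalk x) : k := germ_fun u x.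

Lemma stalk_ev_germ X (x : X) f : regular_at x f ->
  stalk_ev (stalk_germ x f) = f x.
Proof. by move=> /stalk_germK/znbhs_self. Qed.

Lemma stalk_evD X (x : X) (u v : stalk x) :
  stalk_ev (u + v) = stalk_ev u + stalk_ev v.
Proof. exact: (znbhs_self (germ_funD u v)). Qed.

Lemma stalk_evM X (x : X) (u v : stalk x) :
  stalk_ev (u * v) = stalk_ev u * stalk_ev v.
Proof. exact: (znbhs_self (germ_funM u v)). Qed.

Lemma stalk_evN X (x : X) (u : stalk x) : stalk_ev (- u) = - stalk_ev u.
Proof. exact: (znbhs_self (germ_funN u)). Qed.

Lemma stalk_ev0 X (x : X) : stalk_ev (0 : stalk x) = 0.
Proof. exact: (znbhs_self (@germ_fun0 _ _ _ (znbhs_filter x))). Qed.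

Lemma stalk_ev1 X (x : X) : stalk_ev (1 : stalk x) = 1.
Proof. exact: (znbhs_self (@germ_fun1 _ _ _ (znbhs_filter x))). Qed.

Lemma stalk_local X (x : X) (u : stalk x) :
  stalk_ev u != 0 -> exists v, u * v = 1.
Proof.
move=> ux; exists (stalk_germ x (fun y => (germ_fun u y)^-1)).
have hu := regular_germ_fun u.
rewrite -{1}(stalk_germ_fun u) stalk_germM //; last exact: regular_inv.
rewrite -stalk_germ1; apply: stalk_germ_eq.
  exact/regular_mul/regular_inv.
by apply: znbhsS (regular_neq0 hu ux) _ => y /= hy; rewrite divff.
Qed.

Variables (X Y : kspace k) (f : X -> Y) (x : X).
Hypothesis fx : morph_at f x.

Lemma stalk_map_germ g : regular_at (f x) g ->
  stalk_map (stalk_germ (f x) g) = stalk_germ x (g \o f).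
Proof.
move=> hg; apply: stalk_germ_eq; first exact/fx.2/regular_germ_fun.
by apply: znbhsS (fx.1 _ (stalk_germK hg)) _.
Qed.

Lemma stalk_mapD (u v : stalk (f x)) :
  stalk_map (u + v) = stalk_map u + stalk_map v.
Proof.
rewrite -(stalk_germ_fun u) -(stalk_germ_fun v).
have hu := regular_germ_fun u; have hv := regular_germ_fun v.
rewrite stalk_germD // !stalk_map_germ //; last exact: regular_add.
by rewrite stalk_germD //; apply: fx.2.
Qed.

Lemma stalk_mapM (u v : stalk (f x)) :
  stalk_map (u * v) = stalk_map u * stalk_map v.
Proof.
rewrite -(stalk_germ_fun u) -(stalk_germ_fun v).
have hu := regular_germ_fun u; have hv := regular_germ_fun v.
rewrite stalk_germM // !stalk_map_germ //; last exact: regular_mul.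
by rewrite stalk_germM //; apply: fx.2.
Qed.

Lemma stalk_map1 : stalk_map (1 : stalk (f x)) = 1.
Proof.
rewrite -(stalk_germ1 (f x)) stalk_map_germ; last exact: regular_at_cst.
exact: stalk_germ1.
Qed.

Lemma stalk_ev_map (u : stalk (f x)) : stalk_ev (stalk_map u) = stalk_ev u.
Proof.
rewrite -(stalk_germ_fun u); have hu := regular_germ_fun u.
by rewrite stalk_map_germ // !stalk_ev_germ //; apply: fx.2.
Qed.

End Stalks.

(** * Flatness *)

(** ** Localizations of free modules are flat *)

Section FlatLocalization.
Variables (A B : comPzRingType) (phi : A -> B).
Hypotheses (phiD : forall a b, phi (a + b) = phi a + phi b)
           (phiM : forall a b, phi (a * b) = phi a * phi b).
Variables (n : nat) (e : 'I_n -> B) (S : set B).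

Definition in_span (b : B) : Prop :=
  exists c : 'I_n -> A, b = \sum_i phi (c i) * e i.

Hypotheses (e_free : forall c : 'I_n -> A,
              \sum_i phi (c i) * e i = 0 -> forall i, c i = 0)
           (S1 : S 1) (SM : forall s t, S s -> S t -> S (s * t))
           (S_unit : forall s, S s -> exists t, s * t = 1)
           (S_span : forall s b, S s -> in_span b -> in_span (s * b))
           (S_denom : forall b, exists2 s, S s & in_span (s * b)).

Lemma phi0 : phi 0 = 0.
Proof. by apply: (addrI (phi 0)); rewrite -phiD !addr0. Qed.

Lemma phiN a : phi (- a) = - phi a.
Proof. by apply/eqP; rewrite -addr_eq0 -phiD addNr phi0. Qed.

Definition coords (b : B) : 'I_n -> A :=
  if pselect (in_span b) is left h then projT1 (cid h) else fun=> 0.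

Lemma coordsE b : in_span b -> b = \sum_i phi (coords b i) * e i.
Proof. by rewrite /coords; case: pselect => // h _; case: cid. Qed.

Lemma coords_unique b (c : 'I_n -> A) :
  b = \sum_i phi (c i) * e i -> forall i, coords b i = c i.
Proof.
move=> bE i; have /coordsE hb : in_span b by exists c.
apply/eqP; rewrite -subr_eq0; apply/eqP.
apply: (e_free (c := fun i => coords b i - c i)).
under eq_bigr => j _ do rewrite phiD phiN mulrBl.
by rewrite sumrB -hb -bE subrr.
Qed.

Lemma in_spanD b c : in_span b -> in_span c -> in_span (b + c).
Proof.
move=> [x ->] [y ->]; exists (fun i => x i + y i).
by rewrite -big_split; apply: eq_bigr => i _; rewrite phiD mulrDl.
Qed.

Lemma in_spanZ a b : in_span b -> in_span (phi a * b).
Proof.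
move=> [x ->]; exists (fun i => a * x i).
by rewrite big_distrr; apply: eq_bigr => i _; rewrite /= phiM mulrA.
Qed.

Lemma coordsD b c i :
  in_span b -> in_span c -> coords (b + c) i = coords b i + coords c i.
Proof.
move=> hb hc; apply: (coords_unique (c := fun i => coords b i + coords c i)).
rewrite {1}(coordsE hb) {1}(coordsE hc).
by rewrite -big_split; apply: eq_bigr => j _; rewrite /= phiD mulrDl.
Qed.

Lemma coordsZ a b i : in_span b -> coords (phi a * b) i = a * coords b i.
Proof.
move=> hb; apply: (coords_unique (c := fun i => a * coords b i)).
rewrite {1}(coordsE hb) big_distrr.
by apply: eq_bigr => j _; rewrite /= phiM mulrA.
Qed.

Section Colimit.
Variable N : lmodType A.

(** The tensor product of N and B is the colimit of copies of N ^ n indexed by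
    the denominators s: a family of vectors indexed by B stands for its values at
    the multiples of a large denominator. *)
Definition eventually0 : pred (B -> {ffun 'I_n -> N}) :=
  fun h => `[< exists2 s, S s & forall r, S r -> h (r * s) = 0 >].

Lemma eventually0_zmod : zmod_closed eventually0.
Proof.
split; first by apply/asboolP; exists 1.
move=> g h /asboolP[s Ss gs] /asboolP[t St ht]; apply/asboolP.
exists (s * t); first exact: SM.
move=> r Sr; have -> : (g - h) (r * (s * t)) = g (r * (s * t)) - h (r * (s * t)).
  by [].
by rewrite {1}(mulrC s) !mulrA gs ?ht ?subr0 //; apply: SM.
Qed.

HB.instance Definition _ := GRing.isZmodClosed.Build _ eventually0 eventually0_zmod.

Definition colimit :=
  Quotient.quot (GRing.ZmodClosed.clone (B -> {ffun 'I_n -> N}) eventually0 _).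
HB.instance Definition _ := GRing.Zmodule.on colimit.
HB.instance Definition _ := EqQuotient.on colimit.

Definition to_colimit (m : N) (b : B) : colimit :=
  \pi_colimit (fun s => [ffun i => coords (s * b) i *: m]).

Lemma pi_colimit_eq g h :
    (exists2 s, S s & forall r, S r -> g (r * s) = h (r * s)) ->
  \pi_colimit g = \pi_colimit h.
Proof.
move=> [s Ss gh]; apply/eqP; rewrite -Quotient.idealrBE.
apply/asboolP; exists s => // r /gh ghr.
by have -> : (g - h) (r * s) = g (r * s) - h (r * s) by []; rewrite ghr subrr.
Qed.

Lemma pi_colimitD g h : \pi_colimit g + \pi_colimit h = \pi_colimit (g + h).
Proof. by rewrite [RHS]Quotient.pi_add. Qed.

Lemma to_colimit_balanced : balanced phi to_colimit.
Proof.
have addE (g h : B -> {ffun 'I_n -> N}) x : (g + h) x = g x + h x by [].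
split=> [m m' b|m b c|a m b]; rewrite /to_colimit ?pi_colimitD;
  apply: pi_colimit_eq.
- exists 1 => // r _; rewrite addE; apply/ffunP => i.
  by rewrite !ffunE scalerDr.
- have [s Ss hs] := S_denom b; have [t St ht] := S_denom c.
  exists (s * t); first exact: SM.
  move=> r Sr; rewrite addE; apply/ffunP => i; rewrite !ffunE mulrDr coordsD.
  + by rewrite scalerDl.
  + rewrite (mulrC s) mulrA -[_ * s * b]mulrA; apply: S_span => //; exact: SM.
  + rewrite mulrA -[_ * t * c]mulrA; apply: S_span => //; exact: SM.
- have [s Ss hs] := S_denom b; exists s => // r Sr; apply/ffunP => i.
  rewrite !ffunE mulrCA coordsZ; first by rewrite scalerA mulrC.
  by rewrite -mulrA; apply: S_span.
Qed.

Lemma tensor_zero_coords (t : seq (N * B)) : tensor_zero phi t ->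
  exists2 s, S s & forall r, S r -> forall i,
    \sum_(mb <- t) coords (r * s * mb.2) i *: mb.1 = 0.
Proof.
move=> /(_ _ _ to_colimit_balanced).
pose h mb : B -> {ffun 'I_n -> N} := fun s => [ffun i => coords (s * mb.2) i *: mb.1].
have -> : \sum_(mb <- t) to_colimit mb.1 mb.2 = \pi_colimit (\sum_(mb <- t) h mb).
  elim: t => [|mb t IHt].
    rewrite !big_nil; apply: (addrI (\pi_colimit 0)).
    by rewrite addr0 pi_colimitD addr0.
  by rewrite !big_cons IHt pi_colimitD.
have -> : 0 = \pi_colimit 0.
  by apply: (addrI (\pi_colimit 0)); rewrite addr0 pi_colimitD addr0.
move/eqP; rewrite -Quotient.idealrBE subr0 => /asboolP[s Ss hs].
exists s => // r /hs hrs i.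
transitivity ((\sum_(mb <- t) h mb) (r * s) i); last by rewrite hrs ffunE.
elim: t {hs hrs} => [|mb t IHt]; first by rewrite !big_nil ffunE.
rewrite !big_cons IHt.
by rewrite -[RHS]/((h mb (r * s) + (\sum_(mb <- t) h mb) (r * s)) i) !ffunE.
Qed.

End Colimit.

(** A vanishing tensor already vanishes in the free module spanned by the e i / s
    for some denominator s, where tensoring preserves injectivity. *)
Theorem flat_localization : flat phi.
Proof.
move=> M N f f_inj t /tensor_zero_coords[s Ss hs].
have [s' Ss' hs'] : exists2 s', S s' &
    forall mb, List.In mb t -> in_span (s' * mb.2).
  elim: t {hs} => [|mb t [r Sr IHt]]; first by exists 1.
  have [r' Sr' hr'] := S_denom mb.2; exists (r * r'); first exact: SM.
  move=> mb' [<-|/IHt h]; first by rewrite -mulrA; apply: S_span.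
  by rewrite (mulrC r) -mulrA; apply: S_span.
have {}hs i : \sum_(mb <- t) coords (s' * s * mb.2) i *: mb.1 = 0.
  apply: f_inj; rewrite linear0 linear_sum /= -[RHS](hs s' Ss' i) big_map.
  by apply: eq_bigr => mb _; rewrite linearZ.
have {hs'} span_t mb : List.In mb t -> in_span (s' * s * mb.2).
  by move=> /hs' h; rewrite (mulrC s') -mulrA; apply: S_span.
have [u su] : exists u, s' * s * u = 1 by apply: S_unit; apply: SM.
move=> G beta [betaDl betaDr betaZ].
have beta0r m : beta m 0 = 0.
  by apply: (addrI (beta m 0)); rewrite -betaDr !addr0.
have beta0l b : beta 0 b = 0.
  by apply: (addrI (beta 0 b)); rewrite -betaDl !addr0.
have beta_sumr m (F : 'I_n -> B) : beta m (\sum_i F i) = \sum_i beta m (F i).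
  by elim/big_rec2: _ => // i y1 y2 _ <-; rewrite betaDr.
have -> : \sum_(mb <- t) beta mb.1 mb.2 =
    \sum_(mb <- t) \sum_i beta (coords (s' * s * mb.2) i *: mb.1) (e i * u).
  elim: t {hs} span_t => [|mb t IHt] span_t; first by rewrite !big_nil.
  rewrite !big_cons IHt; last by move=> mb' h; apply: span_t; right.
  have hmb := span_t mb (or_introl erefl); congr (_ + _).
  transitivity (beta mb.1 (\sum_i phi (coords (s' * s * mb.2) i) * e i * u)).
    by congr beta; rewrite -mulr_suml -coordsE // mulrAC su mul1r.
  by rewrite beta_sumr; apply: eq_bigr => i _; rewrite -mulrA betaZ.
rewrite exchange_big big1 // => i _.
have -> : \sum_(mb <- t) beta (coords (s' * s * mb.2) i *: mb.1) (e i * u) =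
    beta (\sum_(mb <- t) coords (s' * s * mb.2) i *: mb.1) (e i * u).
  elim: t {span_t hs} => [|mb t IHt]; first by rewrite !big_nil beta0l.
  by rewrite !big_cons betaDl IHt.
by rewrite hs beta0l.
Qed.

End FlatLocalization.

(** ** Flat local homomorphisms reflect divisibility *)

Section FlatDivision.
Variables (k : fieldType) (A B : comPzRingType) (phi : A -> B).
Variables (evA : A -> k) (evB : B -> k).
Hypotheses (evAD : forall a b, evA (a + b) = evA a + evA b)
           (evAM : forall a b, evA (a * b) = evA a * evA b)
           (evA1 : evA 1 = 1)
           (evA_unit : forall a, evA a != 0 -> exists b, a * b = 1)
           (evBD : forall a b, evB (a + b) = evB a + evB b)
           (evBM : forall a b, evB (a * b) = evB a * evB b)
           (evB1 : evB 1 = 1)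
           (ev_phi : forall a, evB (phi a) = evA a).
Hypothesis phi_flat : flat phi.
Variables (al be : A).

Definition ideal2 : pred A^o :=
  fun x => `[< exists u v, x = u * al + v * be >].

Lemma ideal2_submod : submod_closed ideal2.
Proof.
split; first by apply/asboolP; exists 0, 0; rewrite !mul0r addr0.
move=> a x y /asboolP[u [v ->]] /asboolP[u' [v' ->]]; apply/asboolP.
by exists (a * u + u'), (a * v + v'); rewrite /GRing.scale /=; ring.
Qed.

HB.instance Definition _ := GRing.isSubmodClosed.Build A A^o ideal2 ideal2_submod.

Record ideal2_mod := Ideal2 { ideal2_val :> A^o; _ : ideal2_val \in ideal2 }.
HB.instance Definition _ := [isSub for ideal2_val].
HB.instance Definition _ := [Choice of ideal2_mod by <:].
HB.instance Definition _ := [SubChoice_isSubLmodule of ideal2_mod by <:].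

Lemma ideal2_in u v : u * al + v * be \in ideal2.
Proof. by apply/asboolP; exists u, v. Qed.

Let ev_coeff (x : ideal2_mod) : k :=
  evA (projT1 (cid (asboolP _ (valP x)))).

Hypothesis not_dvd : forall c, al != be * c.

Let ev_coeffE (x : ideal2_mod) u v :
  (val x : A) = u * al + v * be -> ev_coeff x = evA u.
Proof.
rewrite /ev_coeff; case: cid => u' [v' /= -> eq_uv].
have evN a : evA (- a) = - evA a.
  have ev0 : evA 0 = 0 by apply: (addrI (evA 0)); rewrite -evAD !addr0.
  by apply/eqP; rewrite -addr_eq0 -evAD addNr ev0.
apply/eqP; rewrite -subr_eq0 -evN -evAD; apply: contraT => /evA_unit[c uc].
have /eqP[] := not_dvd ((v - v') * c).
rewrite -[LHS]mul1r -uc [LHS]mulrAC mulrBl.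
have -> : u' * al - u * al = (v - v') * be.
  by apply/eqP; rewrite mulrBl subr_eq addrAC eq_sym subr_eq eq_sym eq_uv addrC.
by rewrite mulrAC mulrC.
Qed.

(** If phi al = phi be * b, the tensor of al and 1 minus that of be and b vanishes
    over A, hence over the ideal (al, be) by flatness. But as be does not divide
    al, the coefficient of al in an element of this ideal has a well defined
    residue; its product with the residue in B is a balanced map that takes the
    value 1 on that tensor. *)
Lemma flat_not_dvd b : phi al != phi be * b.
Proof.
apply/eqP => eq_b.
have phi_al : al \in ideal2.
  by have := ideal2_in 1 0; rewrite mul1r mul0r addr0.
have phi_be : be \in ideal2.
  by have := ideal2_in 0 1; rewrite mul1r mul0r add0r.
pose t : seq (ideal2_mod * B) := [:: (Ideal2 phi_al, 1); (Ideal2 phi_be, - b)].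
have bal : balanced phi (fun (m : ideal2_mod) c => ev_coeff m * evB c).
  split=> [m m' c|m c d|a m c].
  - have /asboolP[u [v hm]] := valP m; have /asboolP[u' [v' hm']] := valP m'.
    rewrite (ev_coeffE hm) (ev_coeffE hm') (@ev_coeffE _ (u + u') (v + v')).
      by rewrite evAD mulrDl.
    by rewrite /= hm hm'; ring.
  - by rewrite evBD mulrDr.
  - have /asboolP[u [v hm]] := valP m.
    rewrite (ev_coeffE hm) (@ev_coeffE _ (a * u) (a * v)).
      by rewrite evAM evBM ev_phi mulrCA mulrA.
    by rewrite linearZ /= hm /GRing.scale /=; ring.
have t0 : tensor_zero phi [seq ((val mb.1 : A^o), mb.2) | mb <- t].
  move=> G ga [gaDl gaDr gaZ]; rewrite /= !big_cons big_nil addr0 /=.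
  have ga0 m : ga m 0 = 0 by apply: (addrI (ga m 0)); rewrite -gaDr !addr0.
  have scale1 (a : A) : (a : A^o) = a *: (1 : A^o) by rewrite /GRing.scale /= mulr1.
  by rewrite [al]scale1 [be]scale1 !gaZ -gaDr mulrN mulr1 eq_b subrr ga0.
have /(_ _ _ bal) := @phi_flat _ _ (\val : {linear ideal2_mod -> A^o}) val_inj t t0.
rewrite !big_cons big_nil addr0 /= (@ev_coeffE _ 1 0) ?mul1r ?mul0r ?addr0 //.
rewrite (@ev_coeffE _ 0 1) ?mul1r ?mul0r ?add0r //.
have ev0 : evA 0 = 0 by apply: (addrI (evA 0)); rewrite -evAD !addr0.
by rewrite evA1 evB1 ev0 mul0r addr0 mul1r => /eqP; rewrite oner_eq0.
Qed.

End FlatDivision.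

(** * Standard etale morphisms *)

Section StandardEtale.
Variables (k : fieldType) (X Y : kspace k) (f : X -> Y) (x : X).
Hypothesis fx : morph_at f x.
Variables (n : nat) (t : X -> k) (g : 'I_n -> Y -> k).
Hypotheses (t_regular : regular_at x t)
           (g_regular : forall i, regular_at (f x) (g i))
           (t_root : znbhs x [set y | t y ^+ n = \sum_(i < n) g i (f y) * t y ^+ i]).

Local Notation A := (stalk (f x)).
Local Notation B := (stalk x).
Local Notation phi := (@stalk_map k X Y f x).

Let e (i : 'I_n) : B := stalk_germ x t ^+ i.

Local Notation span := (in_span phi e).

Let spanD (b c : B) : span b -> span c -> span (b + c).
Proof. exact: (in_spanD (stalk_mapD fx)). Qed.

Let spanZ (a : A) (b : B) : span b -> span (phi a * b).
Proof. exact: (in_spanZ (stalk_mapM fx)). Qed.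

Let phi_zero : phi 0 = 0.
Proof. exact: (phi0 (stalk_mapD fx)). Qed.

Let span0 : span 0.
Proof. by exists (fun=> 0); rewrite big1 // => i _; rewrite phi_zero mul0r. Qed.

Let span_sum (I : Type) (s : seq I) (F : I -> B) :
  (forall i, span (F i)) -> span (\sum_(i <- s) F i).
Proof.
move=> hF; elim: s => [|i s IHs]; first by rewrite big_nil.
by rewrite big_cons; apply: spanD.
Qed.

Let stalk_germX h m : regular_at x h ->
  stalk_germ x h ^+ m = stalk_germ x (fun y => h y ^+ m).
Proof.
move=> hh; elim: m => [|m IHm].
  rewrite expr0 -stalk_germ1; apply: stalk_germ_eq; first exact: regular_at_cst.
  by apply: znbhsS (znbhsT x) _ => y _; rewrite /= expr0.
rewrite exprS IHm stalk_germM //; last exact: regular_exp.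
apply: stalk_germ_eq; first exact/regular_mul/regular_exp.
by apply: znbhsS (znbhsT x) _ => y _; rewrite /= exprS.
Qed.

Let stalk_germ_sum (I : Type) (s : seq I) (F : I -> X -> k) :
    (forall i, regular_at x (F i)) ->
  \sum_(i <- s) stalk_germ x (F i) = stalk_germ x (fun y => \sum_(i <- s) F i y).
Proof.
move=> hF; elim: s => [|i s IHs].
  rewrite big_nil -stalk_germ0; apply: stalk_germ_eq; first exact: regular_at_cst.
  by apply: znbhsS (znbhsT x) _ => y _; rewrite /= big_nil.
rewrite big_cons IHs stalk_germD //; last exact: regular_sum.
apply: stalk_germ_eq; first exact/regular_add/regular_sum.
by apply: znbhsS (znbhsT x) _ => y _; rewrite /= big_cons.
Qed.

Let comp_regular h : regular_at (f x) h -> regular_at x (h \o f).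
Proof. exact: fx.2. Qed.

Let germ_root : stalk_germ x t ^+ n = \sum_i phi (stalk_germ (f x) (g i)) * e i.
Proof.
under eq_bigr => i _.
  rewrite (stalk_map_germ fx) // /e stalk_germX // stalk_germM;
    [|exact: comp_regular|exact: regular_exp].
  over.
rewrite stalk_germ_sum; last first.
  by move=> i; apply: regular_mul; [apply: comp_regular|apply: regular_exp].
by rewrite stalk_germX //; apply: stalk_germ_eq => //; apply: regular_exp.
Qed.

Let span_t m : span (stalk_germ x t ^+ m).
Proof.
elim/ltn_ind: m => m IHm; case: (ltnP m n) => [lt_mn|le_nm].
  exists (fun i => if i == Ordinal lt_mn then 1 else 0).
  rewrite (bigD1 (Ordinal lt_mn)) //= eqxx (stalk_map1 fx) mul1r big1 ?addr0 //.
  by move=> i /negPf->; rewrite phi_zero mul0r.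
rewrite -(subnKC le_nm) exprD germ_root big_distrl; apply: span_sum => i /=.
rewrite -mulrA /e -exprD; apply: spanZ; apply: IHm.
by rewrite -{2}(subnKC le_nm) ltn_add2r.
Qed.

Let spanM (b c : B) : span b -> span c -> span (b * c).
Proof.
move=> [u ->] [v ->]; rewrite big_distrl; apply: span_sum => i /=.
rewrite big_distrr; apply: span_sum => j /=.
by rewrite mulrACA -stalk_mapM // /e -exprD; apply: spanZ.
Qed.

Let denom (s : B) : Prop := span s /\ stalk_ev s != 0.

Let span1 : span 1.
Proof. by have := span_t 0. Qed.

Let denom1 : denom 1.
Proof. by split; rewrite ?stalk_ev1 ?oner_neq0. Qed.

Let denomM s s' : denom s -> denom s' -> denom (s * s').
Proof.
by move=> [hs s0] [hs' s0']; split; rewrite ?stalk_evM ?mulf_neq0 //; apply: spanM.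
Qed.

(** The functions whose germ at x is a fraction of polynomials in t with
    coefficients in the local ring at f x. *)
Definition fraction (h : X -> k) : Prop :=
  regular_at x h /\ exists2 s, denom s & span (s * stalk_germ x h).

Lemma fraction_comp h : regular_at (f x) h -> fraction (h \o f).
Proof.
move=> hh; split; first exact: comp_regular.
exists 1; rewrite // mul1r -stalk_map_germ // -[X in span X]mulr1.
exact: spanZ.
Qed.

Lemma fraction_t : fraction t.
Proof. by split=> //; exists 1; rewrite // mul1r; have := span_t 1. Qed.

Lemma fraction_cst c : fraction (fun=> c).
Proof. exact: (fraction_comp (regular_at_cst (f x) c)). Qed.

Lemma fraction_add h h' : fraction h -> fraction h' ->
  fraction (fun y => h y + h' y).
Proof.
move=> [rh [s ds hs]] [rh' [s' ds' hs']]; split; first exact: regular_add.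
exists (s * s'); first exact: denomM.
rewrite -stalk_germD // mulrDr; apply: spanD.
  by rewrite (mulrC s) -mulrA; apply: spanM => //; case: ds'.
by rewrite -mulrA; apply: spanM => //; case: ds.
Qed.

Lemma fraction_mul h h' : fraction h -> fraction h' ->
  fraction (fun y => h y * h' y).
Proof.
move=> [rh [s ds hs]] [rh' [s' ds' hs']]; split; first exact: regular_mul.
exists (s * s'); first exact: denomM.
by rewrite -stalk_germM // mulrACA; apply: spanM.
Qed.

Lemma fraction_inv h : fraction h -> h x != 0 -> fraction (fun y => (h y)^-1).
Proof.
move=> [rh [s [hs s0] hs']] hx; split; first exact: regular_inv.
exists (s * stalk_germ x h).
  by split=> //; rewrite stalk_evM stalk_ev_germ // mulf_neq0.
rewrite -mulrA stalk_germM //; last exact: regular_inv.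
suff -> : stalk_germ x (fun y => h y * (h y)^-1) = 1 by rewrite mulr1.
rewrite -stalk_germ1; apply: stalk_germ_eq; first exact/regular_mul/regular_inv.
by apply: znbhsS (regular_neq0 rh hx) _ => y /= hy; rewrite divff.
Qed.

Lemma eq_fraction h h' : znbhs x [set y | h y = h' y] -> fraction h -> fraction h'.
Proof.
move=> hh' [rh hs]; split; first exact: eq_regular rh.
by rewrite -(stalk_germ_eq rh hh').
Qed.

(** Fractions are stable under the operations that build rational expressions, so
    it suffices to consider local coordinates. *)
Lemma fraction_pull (W : kspace k) (q : X -> W) : morph_at q x ->
    (forall U h, loc_coord U h -> U (q x) -> fraction (h \o q)) ->
  forall h, regular_at (q x) h -> fraction (h \o q).
Proof.
move=> qx hq h [U [h' [hh' hE]]].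
apply: (@eq_fraction (h' \o q)).
  by apply: znbhsS (qx.1 _ (ratexp_znbhs hh')) _ => y Uy /=; rewrite hE ?inE.
elim: hh' => {U h h' hE}.
- by move=> c; apply: fraction_cst.
- by move=> U h lh Uq; apply: hq lh Uq.
- by move=> U V h h' _ IHh _ IHh'; apply: fraction_add.
- by move=> U V h h' _ IHh _ IHh'; apply: fraction_mul.
- by move=> U h _ IHh hx; apply: fraction_inv.
Qed.

Hypothesis t_free : forall c : 'I_n -> Y -> k,
  (forall i, regular_at (f x) (c i)) ->
  znbhs x [set y | \sum_(i < n) c i (f y) * t y ^+ i = 0] ->
  forall i, znbhs (f x) [set y | c i y = 0].
Hypothesis t_gen : forall U h, loc_coord U h -> U x -> fraction h.

Let germ_fraction (b : B) : exists2 s, denom s & span (s * b).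
Proof.
have hb : morph_at (id : X -> X) x by split.
have [_] := fraction_pull hb t_gen (regular_germ_fun b).
by rewrite [stalk_germ _ _]stalk_germ_fun.
Qed.

(** The local ring at x is a localization of the module spanned by the powers of
    t over the local ring at f x, which is free because t satisfies no equation of
    degree less than n. *)
Lemma standard_flat : flat_at f x.
Proof.
apply: (@flat_localization _ _ phi (stalk_mapD fx) (stalk_mapM fx) n e denom) => //.
- move=> c hc i.
  have : stalk_germ x (fun y => \sum_i germ_fun (c i) (f y) * t y ^+ i) =
         stalk_germ x (fun=> 0).
    rewrite stalk_germ0 -stalk_germ_sum; last first.
      move=> j; apply: regular_mul; last exact: regular_exp.
      exact/comp_regular/regular_germ_fun.
    rewrite -[RHS]hc; apply: eq_bigr => j _.
    have rj := comp_regular (regular_germ_fun (c j)).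
    rewrite -{2}(stalk_germ_fun (c j)) stalk_map_germ //; last first.
      exact: regular_germ_fun.
    by rewrite /e stalk_germX // stalk_germM //; apply: regular_exp.
  move=> /stalk_germ_inj h0.
  rewrite -(stalk_germ_fun (c i)) -stalk_germ0.
  apply: stalk_germ_eq; first exact: regular_germ_fun.
  apply: (t_free (c := fun j => germ_fun (c j))); first by move=> j;
    apply: regular_germ_fun.
  apply: h0; last exact: regular_at_cst.
  apply: regular_sum => j; apply: regular_mul; last exact: regular_exp.
  exact/comp_regular/regular_germ_fun.
- by move=> s [_ /stalk_local].
- by move=> s b [hs _]; apply: spanM.
Qed.

Let p : {poly k} := 'X^n - \sum_(i < n) g i (f x) *: 'X^i.

Hypothesis t_simple : p^`().[t x] != 0.

Let extended_ideal (v : B) : Prop := exists s : seq (A * B),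
  (forall uw, uw \in s -> max_ideal uw.1) /\
  v = \sum_(uw <- s) phi uw.1 * uw.2.

Let extended_ideal_gen (u : A) w : stalk_ev u = 0 -> extended_ideal (phi u * w).
Proof.
move=> u0; exists [:: (u, w)]; split; last by rewrite big_seq1.
by move=> uw; rewrite inE => /eqP->.
Qed.

Let extended_ideal0 : extended_ideal 0.
Proof. by exists [::]; rewrite big_nil. Qed.

Let extended_idealD v w :
  extended_ideal v -> extended_ideal w -> extended_ideal (v + w).
Proof.
move=> [s [hs ->]] [s' [hs' ->]]; exists (s ++ s'); split; last by rewrite big_cat.
by move=> uw; rewrite mem_cat => /orP[/hs|/hs'].
Qed.

Let extended_idealM v w : extended_ideal v -> extended_ideal (w * v).
Proof.
move=> [s [hs ->]]; exists [seq (uw.1, w * uw.2) | uw <- s]; split.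
  by move=> _ /mapP[uw /hs huw ->].
by rewrite big_map big_distrr; apply: eq_bigr => uw _; rewrite /= mulrCA.
Qed.

Let extended_ideal_sum (I : Type) (s : seq I) (F : I -> B) :
  (forall i, extended_ideal (F i)) -> extended_ideal (\sum_(i <- s) F i).
Proof.
move=> hF; elim: s => [|i s IHs]; first by rewrite big_nil.
by rewrite big_cons; apply: extended_idealD.
Qed.

Let p_root : p.[t x] = 0.
Proof.
rewrite /p hornerD hornerN hornerXn (znbhs_self t_root) horner_sum.
by under [X in _ - X]eq_bigr => i _ do rewrite hornerZ hornerXn; rewrite subrr.
Qed.

(** As t is a simple root of p modulo the maximal ideal, the cofactor of t - t(x)
    in p(t) is a unit; and p(t) lies in the extended ideal because t satisfies
    an equation whose coefficients are congruent to those of p. *)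
Let extended_ideal_t : extended_ideal (stalk_germ x (fun y => t y - t x)).
Proof.
have /factor_theorem[q pE] : root p (t x) by apply/rootP.
have qx : q.[t x] != 0.
  move: t_simple; rewrite pE derivM hornerD !hornerM derivXsubC hornerC mulr1.
  by rewrite hornerXsubC subrr mulr0 add0r.
have rq := regular_horner q t_regular.
have -> : stalk_germ x (fun y => t y - t x) =
    stalk_germ x (fun y => (q.[t y])^-1) * stalk_germ x (fun y => p.[t y]).
  rewrite stalk_germM; [|exact: regular_inv|exact: regular_horner].
  apply: stalk_germ_eq; first exact/regular_sub/regular_at_cst.
  apply: znbhsS (regular_neq0 rq qx) _ => y /= hy.
  by rewrite pE hornerM hornerXsubC mulKf.
apply: extended_idealM.
have rgi i : regular_at (f x) (fun y => g i y - g i (f x)).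
  exact/regular_sub/regular_at_cst.
have -> : stalk_germ x (fun y => p.[t y]) =
    \sum_i phi (stalk_germ (f x) (fun y => g i y - g i (f x))) * e i.
  under eq_bigr => i _.
    rewrite (stalk_map_germ fx) // /e stalk_germX // stalk_germM;
      [|exact: comp_regular (rgi i)|exact: regular_exp].
    over.
  rewrite stalk_germ_sum; last first.
    by move=> i; apply: regular_mul; [apply: comp_regular (rgi i)|apply: regular_exp].
  apply: stalk_germ_eq; first exact: regular_horner.
  apply: znbhsS t_root _ => y /= ty.
  rewrite /p hornerD hornerN hornerXn ty horner_sum -sumrB.
  by apply: eq_bigr => i _; rewrite hornerZ hornerXn mulrBl.
apply: extended_ideal_sum => i; apply: extended_ideal_gen.
by rewrite stalk_ev_germ // subrr.
Qed.

(** Modulo the extended ideal, the numerator of a germ that vanishes at x is a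
    polynomial in t with constant coefficients, so a multiple of t - t(x). *)
Lemma standard_unramified : unramified_at f x.
Proof.
move=> v; split=> [v0|[s [hs ->]]]; last first.
  change (stalk_ev (\sum_(uw <- s) phi uw.1 * uw.2) = 0).
  elim: s hs => [|uw s IHs] hs; first by rewrite big_nil stalk_ev0.
  rewrite big_cons stalk_evD IHs; last by move=> uw' h; apply: hs; rewrite inE h orbT.
  rewrite stalk_evM stalk_ev_map //.
  have -> : stalk_ev uw.1 = 0 by apply: hs; rewrite inE eqxx.
  by rewrite mul0r addr0.
have [s [_ s0] [c sv]] := germ_fraction v.
have [s' ss'] := stalk_local s0.
have -> : v = s' * (s * v) by rewrite mulrA (mulrC s') ss' mul1r.
apply: extended_idealM; have sv0 : stalk_ev (s * v) = 0.
  by rewrite stalk_evM [stalk_ev v]v0 mulr0.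
pose cst a := stalk_germ (f x) (fun=> a).
pose q : {poly k} := \sum_i stalk_ev (c i) *: 'X^i.
have ev_cst a : stalk_ev (cst a) = a by rewrite stalk_ev_germ //; apply: regular_at_cst.
have qE : stalk_germ x (fun y => q.[t y]) = \sum_i phi (cst (stalk_ev (c i))) * e i.
  under eq_bigr => i _.
    rewrite (stalk_map_germ fx); last exact: regular_at_cst.
    rewrite /e stalk_germX // stalk_germM;
      [|exact: regular_at_cst|exact: regular_exp].
    over.
  rewrite stalk_germ_sum; last first.
    by move=> i; apply: regular_mul; [apply: regular_at_cst|apply: regular_exp].
  apply: stalk_germ_eq; first exact: regular_horner.
  apply: znbhsS (znbhsT x) _ => y _ /=; rewrite /q horner_sum.
  by apply: eq_bigr => i _; rewrite hornerZ hornerXn.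
have -> : s * v = \sum_i phi (c i - cst (stalk_ev (c i))) * e i +
                  stalk_germ x (fun y => q.[t y]).
  rewrite sv qE -big_split; apply: eq_bigr => i _ /=.
  by rewrite -mulrDl -stalk_mapD // subrK.
have diff_in : extended_ideal (\sum_i phi (c i - cst (stalk_ev (c i))) * e i).
  apply: extended_ideal_sum => i; apply: extended_ideal_gen.
  by rewrite stalk_evD stalk_evN ev_cst subrr.
apply: extended_idealD => //.
have /factor_theorem[q' ->] : root q (t x).
  apply/rootP; rewrite -sv0 sv -(stalk_ev_germ (regular_horner q t_regular)) qE.
  have ev_sum (F : 'I_n -> B) : stalk_ev (\sum_i F i) = \sum_i stalk_ev (F i).
    by elim/big_rec2: _ => [|i y1 y2 _ <-]; rewrite ?stalk_ev0 ?stalk_evD.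
  rewrite !ev_sum; apply: eq_bigr => i _; rewrite !stalk_evM.
  by rewrite (stalk_ev_map fx (c i)) (stalk_ev_map fx (cst _)) ev_cst.
have -> : stalk_germ x (fun y => (q' * ('X - (t x)%:P)).[t y]) =
    stalk_germ x (fun y => q'.[t y]) * stalk_germ x (fun y => t y - t x).
  rewrite stalk_germM; [|exact: regular_horner|exact/regular_sub/regular_at_cst].
  apply: stalk_germ_eq; first exact: regular_horner.
  by apply: znbhsS (znbhsT x) _ => y _ /=; rewrite hornerM hornerXsubC.
exact: extended_idealM.
Qed.

End StandardEtale.

(** * Projective spaces *)

Section Projective.
Variable k : fieldType.

Lemma hc_neq0 n (x : proj_pt k n) : hc x != 0.
Proof. by rewrite /hc vpick0 -dimv_eq0 (eqP (valP x)). Qed.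

Lemma hc_span n (x : proj_pt k n) : val x = <[hc x]>%VS.
Proof.
apply/esym/eqP; rewrite -dimv_leqif_eq; last by rewrite -memvE memv_pick.
by rewrite (eqP (valP x)) dim_vline hc_neq0.
Qed.

Lemma hc_inj n (x y : proj_pt k n) c : hc x = c *: hc y -> x = y.
Proof.
move=> xy; apply/val_inj; rewrite (hc_span x) (hc_span y) xy.
have c0 : c != 0 by apply: contra_eq_neq xy => ->; rewrite scale0r hc_neq0.
apply/eqP; rewrite eqEsubv -!memvE memvZ ?memv_line //=.
by rewrite -[X in X \in _](scalerK c0) memvZ ?memv_line.
Qed.

Lemma line_dim n (v : 'rV[k]_n.+1) : v != 0 -> \dim <[v]> == 1%N.
Proof. by move=> v0; rewrite dim_vline v0. Qed.

Lemma hc_line n (x : proj_pt k n) (v : 'rV[k]_n.+1) :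
  val x = <[v]>%VS -> exists2 c, c != 0 & hc x = c *: v.
Proof.
move=> xv; have : hc x \in <[v]>%VS by rewrite -xv memv_pick.
move=> /vlineP[c xE]; exists c => //.
by apply: contra_eq_neq xE => ->; rewrite scale0r hc_neq0.
Qed.

Lemma hc_exists n (v : 'rV[k]_n.+1) : v != 0 ->
  exists x : proj_pt k n, exists2 c, c != 0 & hc x = c *: v.
Proof. by move=> v0;
  exists (exist (fun W : {vspace 'rV[k]_n.+1} => \dim W == 1%N) _ (line_dim v0));
  apply: hc_line. Qed.

Lemma hc_coord_neq0 n (x : proj_pt k n) : exists j, hc x 0 j != 0.
Proof. by have /rV0Pn := hc_neq0 x. Qed.

Lemma regular_hc n (x : proj_space k n) i j : hc x 0 j != 0 ->
  regular_at x (fun y : proj_space k n => hc y 0 i / hc y 0 j).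
Proof.
move=> xj; apply: (@regular_coord _ (proj_space k n) x [set y | hc y 0 j != 0]) => //.
by exists i, j.
Qed.

Lemma znbhs_hc n (x : proj_space k n) j : hc x 0 j != 0 ->
  znbhs x [set y : proj_space k n | hc y 0 j != 0].
Proof.
move=> xj; apply: ratexp_znbhs.
apply: (@ratexp_coord _ (proj_space k n) x _ (fun y => hc y 0 j / hc y 0 j)) => //.
by exists j, j.
Qed.

Lemma morph_at_proj (X : kspace k) n (g : X -> proj_space k n) x
    (v : X -> 'rV[k]_n.+1) :
    (forall i, regular_at x (fun y => v y 0 i)) ->
    znbhs x [set y | exists2 c, c != 0 & hc (g y) = c *: v y] ->
  morph_at g x.
Proof.
move=> rv gv; apply: morph_at_coord => _ _ [i [j [-> ->]]] /= xj.
have vj : v x 0 j != 0.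
  have [c c0 xE] := znbhs_self gv.
  by apply: contraNneq xj => vj; rewrite xE mxE vj mulr0.
have nvj := regular_neq0 (rv j) vj.
split.
  apply: znbhsS (znbhsI gv nvj) _ => y [[c c0 /= ->] /= vyj].
  by rewrite mxE mulf_neq0.
apply: eq_regular (regular_div (rv i) (rv j) vj).
apply: znbhsS gv _ => y [c c0 /= ->].
by rewrite !mxE -mulf_div divff // mul1r.
Qed.

End Projective.

(** ** Functions chosen pointwise *)

Lemma sval_inj (T : Type) (P : T -> Prop) : injective (@sval T P).
Proof. by move=> [x hx] [y hy] /= xy; apply: eq_exist. Qed.

Lemma choose_map (X Z : Type) (z0 : Z) (P : X -> Z -> Prop) :
  exists g : X -> Z, forall x, (exists z, P x z) -> P x (g x).
Proof.
exists (fun x => if pselect (exists z, P x z) is left h then projT1 (cid h) else z0).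
by move=> x hx; case: pselect => // h; case: cid.
Qed.

Lemma znbhs_zclosure (k : fieldType) (X : kspace k) (A : set X) x :
  ~ zclosure A x -> znbhs x (~` zclosure A).
Proof.
move=> /existsNP[N /not_implyP[nN NA]].
apply: znbhsS (znbhs_near nN) _ => y /= ny /(_ _ ny).
exact: NA.
Qed.

Lemma poly_fun_eq0 (k : numFieldType) (p : {poly k}) :
  (forall y, p.[y] = 0) -> p = 0.
Proof.
move=> p0; apply/eqP; apply: contraT => nz.
have := max_poly_roots nz (rs := [seq i%:R | i <- iota 0 (size p)]).
rewrite size_map size_iota ltnn => -> //.
  by apply/allP => y _; apply/rootP.
by rewrite map_inj_uniq ?iota_uniq // => i j /eqP; rewrite eqr_nat => /eqP.
Qed.

Lemma poly_avoid (k : numFieldType) (p : {poly k}) :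
  p != 0 -> exists y, p.[y] != 0.
Proof.
move=> nz; apply/not_existsP => h; case/eqP: nz; apply: poly_fun_eq0 => y.
by apply/eqP/negP => /negP/h.
Qed.

Lemma regular_line_eq0 (k : numFieldType) (x : affine_line k)
    (h : affine_line k -> k) (E : {poly k}) :
    regular_at x h -> E != 0 -> (forall y, E.[y] != 0 -> h y = 0) ->
  h x = 0.
Proof.
move=> /regular_line_frac[N [D [Dx hD]]] E0 h0; rewrite hD //.
have D0 : D != 0 by apply: contraNneq Dx => ->; rewrite horner0.
suff /eqP : N * (D * E) = 0.
  by rewrite !mulf_eq0 (negPf D0) (negPf E0) !orbF => /eqP->; rewrite horner0 mul0r.
apply: poly_fun_eq0 => y; rewrite !hornerM.
have [->|Ey] := eqVneq E.[y] 0; first by rewrite !mulr0.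
have [->|Dy] := eqVneq D.[y] 0; first by rewrite mul0r !mulr0.
by move/eqP: (h0 y Ey); rewrite hD // mulf_eq0 invr_eq0 (negPf Dy) orbF =>
  /eqP->; rewrite mul0r.
Qed.

(** * The blown up plane in Fourier coordinates *)

Lemma sum3E (V : nmodType) (F : 'I_3 -> V) : \sum_i F i = F 0 + F 1 + F 2.
Proof.
rewrite !big_ord_recl big_ord0 addr0 addrA.
by congr (F _ + F _ + F _); apply/val_inj.
Qed.

Lemma row3P (T : Type) (v v' : 'rV[T]_3) :
  v 0 0 = v' 0 0 -> v 0 1 = v' 0 1 -> v 0 2 = v' 0 2 -> v = v'.
Proof.
move=> h0 h1 h2; apply/rowP => i.
case: i => [[|[|[|//]]]] hi.
- by rewrite (_ : Ordinal hi = 0) //; apply/val_inj.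
- by rewrite (_ : Ordinal hi = 1) //; apply/val_inj.
- by rewrite (_ : Ordinal hi = 2) //; apply/val_inj.
Qed.

Lemma row2P (T : Type) (v v' : 'rV[T]_2) :
  v 0 0 = v' 0 0 -> v 0 1 = v' 0 1 -> v = v'.
Proof.
move=> h0 h1; apply/rowP => i.
case: i => [[|[|//]]] hi.
- by rewrite (_ : Ordinal hi = 0) //; apply/val_inj.
- by rewrite (_ : Ordinal hi = 1) //; apply/val_inj.
Qed.

Lemma scale_rowE (R : pzRingType) n (c : R) (v : 'rV[R]_n) i :
  (c *: v) 0 i = c * v 0 i.
Proof. by rewrite mxE. Qed.

Section Blowup.
Variables (k : numClosedFieldType) (w : k).
Hypothesis w2 : w ^+ 2 = - w - 1.

(** The cyclic permutation of the coordinates preserves the net and the cubic, so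
    both are sparse in its eigencoordinates x0, x1, x2, for which P = (1 : 0 : 0):
    the net is (3 x1 x2, 2 x0 x1 + x2^2, 2 x0 x2 + x1^2) and the cubic is
    2 x0 x1 x2 - x1^3 - x2^3, up to constants. *)
Definition four0 (x : 'rV[k]_3) : k := x 0 0 + x 0 1 + x 0 2.
Definition four1 (x : 'rV[k]_3) : k := x 0 0 + w ^+ 2 * x 0 1 + w * x 0 2.
Definition four2 (x : 'rV[k]_3) : k := x 0 0 + w * x 0 1 + w ^+ 2 * x 0 2.

Definition unfour (a b c : k) : 'rV[k]_3 :=
  \row_(i < 3) (a + w ^+ i * b + w ^+ (2 * i %% 3) * c).

Lemma unfour0 a b c : unfour a b c 0 0 = a + b + c.
Proof. by rewrite mxE /= !expr0 !mul1r. Qed.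
Lemma unfour1 a b c : unfour a b c 0 1 = a + w * b + w ^+ 2 * c.
Proof. by rewrite mxE. Qed.
Lemma unfour2 a b c : unfour a b c 0 2 = a + w ^+ 2 * b + w * c.
Proof. by rewrite mxE. Qed.
Definition unfourE := (unfour0, unfour1, unfour2).

Lemma four0K a b c : four0 (unfour a b c) = 3 * a.
Proof. by rewrite /four0 !unfourE; ring: w2. Qed.
Lemma four1K a b c : four1 (unfour a b c) = 3 * b.
Proof. by rewrite /four1 !unfourE; ring: w2. Qed.
Lemma four2K a b c : four2 (unfour a b c) = 3 * c.
Proof. by rewrite /four2 !unfourE; ring: w2. Qed.
Definition fourK := (four0K, four1K, four2K).

Lemma unfourK x : unfour (four0 x) (four1 x) (four2 x) = 3 *: x.
Proof.
by apply: row3P; rewrite !unfourE mxE /four0 /four1 /four2; ring: w2.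
Qed.

Lemma unfourZ c x y z : c *: unfour x y z = unfour (c * x) (c * y) (c * z).
Proof. by apply: row3P; rewrite [LHS]mxE !unfourE; ring. Qed.

Lemma unfourD x y z x' y' z' :
  unfour x y z + unfour x' y' z' = unfour (x + x') (y + y') (z + z').
Proof. by apply: row3P; rewrite [LHS]mxE !unfourE; ring. Qed.

Lemma fourZ c x :
  (four0 (c *: x) = c * four0 x) * (four1 (c *: x) = c * four1 x)
  * (four2 (c *: x) = c * four2 x).
Proof. by rewrite /four0 /four1 /four2 !mxE; split; [split|]; ring. Qed.

Lemma unfour_eq0 a b c : (unfour a b c == 0) = [&& a == 0, b == 0 & c == 0].
Proof.
have n3 : 3 != 0 :> k by rewrite pnatr_eq0.
apply/eqP/and3P => [h0|[/eqP-> /eqP-> /eqP->]]; last first.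
  by apply: row3P; rewrite !unfourE mxE; ring.
split; apply/eqP; apply: (mulfI n3); rewrite mulr0.
- by rewrite -(four0K a b c) h0 /four0 !mxE; ring.
- by rewrite -(four1K a b c) h0 /four1 !mxE; ring.
- by rewrite -(four2K a b c) h0 /four2 !mxE; ring.
Qed.

Lemma netQ_E (x : 'rV[k]_3) (j : 'I_3) :
  netQ x 0 j = 3 * x 0 j ^+ 2 - x 0 0 * x 0 1 - x 0 0 * x 0 2 - x 0 1 * x 0 2.
Proof. by rewrite mxE. Qed.

Lemma netQ_four a b c : netQ (unfour a b c) =
  unfour (9 * b * c) (3 * (2 * a * b + c ^+ 2)) (3 * (2 * a * c + b ^+ 2)).
Proof. by apply: row3P; rewrite !netQ_E !unfourE; ring: w2. Qed.

Lemma cubicE (x : 'rV[k]_3) :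
  cubic x = x 0 0 ^+ 2 * x 0 1 + x 0 0 ^+ 2 * x 0 2 + x 0 1 ^+ 2 * x 0 0
    + x 0 1 ^+ 2 * x 0 2 + x 0 2 ^+ 2 * x 0 0 + x 0 2 ^+ 2 * x 0 1
    - 6 * x 0 0 * x 0 1 * x 0 2.
Proof.
have [n01 [n02 n12]] : ((0 : 'I_3) == 1) = false /\ ((0 : 'I_3) == 2) = false /\
  ((1 : 'I_3) == 2) = false by [].
rewrite /cubic sum3E !(big_mkcond (fun j => _ != j)) !sum3E !eqxx.
by rewrite ![_ == (0 : 'I_3)]eq_sym ![(2 : 'I_3) == 1]eq_sym n01 n02 n12 /=; ring.
Qed.

Lemma cubic_four a b c :
  cubic (unfour a b c) = 9 * (2 * a * b * c - b ^+ 3 - c ^+ 3).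
Proof. by rewrite cubicE !unfourE; ring: w2. Qed.

(** The point of P^1 that the blowing-up attaches to the line through P on which
    (x1 : x2) = (s : e); slope1 and slope2 recover s and e. *)
Definition direction (s e : k) : 'rV[k]_2 :=
  \row_(i < 2) (if i == 0 :> nat then w ^+ 2 * e - w * s else s - e).

Lemma direction0 s e : direction s e 0 0 = w ^+ 2 * e - w * s.
Proof. by rewrite mxE. Qed.
Lemma direction1 s e : direction s e 0 1 = s - e.
Proof. by rewrite mxE. Qed.
Definition directionE := (direction0, direction1).

Definition slope1 (y : 'rV[k]_2) := y 0 0 + w ^+ 2 * y 0 1.
Definition slope2 (y : 'rV[k]_2) := y 0 0 + w * y 0 1.

Lemma directionK y :
  direction (slope1 y) (slope2 y) = (w ^+ 2 - w) *: y.
Proof.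
by apply: row2P; rewrite !directionE !mxE /slope1 /slope2; ring: w2.
Qed.

Lemma slope1K s e : slope1 (direction s e) = (w ^+ 2 - w) * s.
Proof. by rewrite /slope1 !directionE; ring: w2. Qed.
Lemma slope2K s e : slope2 (direction s e) = (w ^+ 2 - w) * e.
Proof. by rewrite /slope2 !directionE; ring: w2. Qed.

Lemma ww_neq0 : w ^+ 2 - w != 0.
Proof.
apply/eqP => ww; have : (w ^+ 2 - w) ^+ 2 = -3 by ring: w2.
by rewrite ww expr2 mul0r => /esym/eqP; rewrite oppr_eq0 pnatr_eq0.
Qed.

Lemma direction_eq0 s e : (direction s e == 0) = (s == 0) && (e == 0).
Proof.
apply/eqP/andP => [h0|[/eqP-> /eqP->]]; last first.
  by apply: row2P; rewrite !directionE mxE; ring.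
split; apply/eqP; apply: (mulfI ww_neq0); rewrite mulr0.
- by rewrite -(slope1K s e) h0 /slope1 !mxE; ring.
- by rewrite -(slope2K s e) h0 /slope2 !mxE; ring.
Qed.

(** The point of the blown up plane that lies on the strict transform of the line
    through P with direction (s : e), at the point u P + r (s, e) of that line;
    the exceptional curve is r = 0. The quadruples of a given point form an orbit of
    the torus of the pairs (al, be), which acts by
    (u, r, s, e) -> (al u, al r / be, be s, be e). *)
Definition blow_coords (z : blowup k) (u r s e : k) : Prop :=
  (exists2 c, c != 0 & hc (sval z).1 = c *: unfour u (r * s) (r * e)) /\
  (exists2 c, c != 0 & hc (sval z).2 = c *: direction s e).

Lemma blow_coords_dir z u r s e :
  blow_coords z u r s e -> (s != 0) || (e != 0).
Proof.
move=> [_ [c c0 zE]]; rewrite -negb_and -direction_eq0.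
by apply: contra_neq (hc_neq0 (sval z).2) => h0; rewrite zE h0 scaler0.
Qed.

Lemma blow_coords_point z u r s e :
  blow_coords z u r s e -> (u != 0) || (r != 0).
Proof.
move=> [[c c0 zE] _]; rewrite -negb_and.
apply: contra_neqN (hc_neq0 (sval z).1) => /andP[/eqP u0 /eqP r0].
by rewrite zE u0 r0 !mul0r; apply/eqP; rewrite scaler_eq0 unfour_eq0 !eqxx orbT.
Qed.

Lemma blow_coords_exists u r s e :
    (u != 0) || (r != 0) -> (s != 0) || (e != 0) ->
  exists z, blow_coords z u r s e.
Proof.
move=> ur se.
have x0 : unfour u (r * s) (r * e) != 0.
  rewrite unfour_eq0 !mulf_eq0; case/orP: ur => [/negPf->//|/negPf->/=].
  by rewrite -negb_and in se; rewrite (negPf se) andbF.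
have y0 : direction s e != 0 by rewrite direction_eq0 negb_and.
have [x [c c0 xE]] := hc_exists x0; have [y [d d0 yE]] := hc_exists y0.
have inc : (hc x 0 0 - hc x 0 2) * hc y 0 1 = (hc x 0 1 - hc x 0 2) * hc y 0 0.
  by rewrite xE yE !scale_rowE !unfourE !directionE; ring: w2.
by exists (exist _ (x, y) inc); split; [exists c|exists d].
Qed.

Lemma blow_coords_inj z z' u r s e :
  blow_coords z u r s e -> blow_coords z' u r s e -> z = z'.
Proof.
move=> [[c c0 zE] [d d0 zE']] [[c' c0' z'E] [d' d0' z'E']].
case: z z' zE zE' z'E z'E' => [[x y] xy] [[x' y'] xy'] /= xE yE xE' yE'.
have xx' : x = x'.
  by apply: (@hc_inj _ _ _ _ (c / c')); rewrite xE xE' scalerA divfK.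
have yy' : y = y'.
  by apply: (@hc_inj _ _ _ _ (d / d')); rewrite yE yE' scalerA divfK.
by apply: eq_exist; rewrite xx' yy'.
Qed.

Lemma blow_incidence (z : blowup k) :
  four1 (hc (sval z).1) * slope2 (hc (sval z).2) =
  four2 (hc (sval z).1) * slope1 (hc (sval z).2).
Proof.
case: z => [[x y] /= inc]; rewrite /four1 /four2 /slope1 /slope2.
suff -> : forall x0 x1 x2 y0 y1 : k, (x0 - x2) * y1 = (x1 - x2) * y0 ->
  (x0 + w ^+ 2 * x1 + w * x2) * (y0 + w * y1) =
  (x0 + w * x1 + w ^+ 2 * x2) * (y0 + w ^+ 2 * y1) by [].
move=> x0 x1 x2 y0 y1 h.
apply/eqP; rewrite -subr_eq0; apply/eqP.
transitivity ((w - w ^+ 2) * ((x0 - x2) * y1 - (x1 - x2) * y0)); first by ring: w2.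
by rewrite h subrr mulr0.
Qed.

(** Local coordinates around a point, as regular functions *)
Lemma blow_section (z0 : blowup k) : exists u r s e : blowup k -> k,
  [/\ regular_at z0 u, regular_at z0 r, regular_at z0 s, regular_at z0 e
    & znbhs z0 [set z | blow_coords z (u z) (r z) (s z) (e z)]].
Proof.
have [j xj] := hc_coord_neq0 (sval z0).1; have [l yl] := hc_coord_neq0 (sval z0).2.
pose px (z : blowup k) : proj_space k 2 := (sval z).1.
pose py (z : blowup k) : proj_space k 1 := (sval z).2.
have mx : morph_at px z0.
  exact: morph_at_comp (morph_at_sval z0) (morph_at_fst _).
have my : morph_at py z0.
  exact: morph_at_comp (morph_at_sval z0) (morph_at_snd _).
pose X i (z : blowup k) := hc (px z) 0 i / hc (px z) 0 j.
pose Y i (z : blowup k) := hc (py z) 0 i / hc (py z) 0 l.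
have rX i : regular_at z0 (X i) by exact: (mx.2 _ (regular_hc i xj)).
have rY i : regular_at z0 (Y i) by exact: (my.2 _ (regular_hc i yl)).
pose vX z : 'rV_3 := (hc (px z) 0 j)^-1 *: hc (px z).
pose vY z : 'rV_2 := (hc (py z) 0 l)^-1 *: hc (py z).
have vXE i z : vX z 0 i = X i z by rewrite /vX /X mxE mulrC.
have vYE i z : vY z 0 i = Y i z by rewrite /vY /Y mxE mulrC.
pose u z := four0 (vX z).
pose s z := slope1 (vY z); pose e z := slope2 (vY z).
have cst c : regular_at z0 (fun=> c) by exact: regular_at_cst.
have rX1 : regular_at z0 (fun z => four1 (vX z)).
  have -> : (fun z => four1 (vX z)) = fun z => X 0 z + w ^+ 2 * X 1 z + w * X 2 z.
    by apply/funext => z; rewrite /four1 !vXE.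
  by do ?apply: regular_add => //; apply: regular_mul.
have rX2 : regular_at z0 (fun z => four2 (vX z)).
  have -> : (fun z => four2 (vX z)) = fun z => X 0 z + w * X 1 z + w ^+ 2 * X 2 z.
    by apply/funext => z; rewrite /four2 !vXE.
  by do ?apply: regular_add => //; apply: regular_mul.
have ru : regular_at z0 u.
  have -> : u = fun z => X 0 z + X 1 z + X 2 z.
    by apply/funext => z; rewrite /u /four0 !vXE.
  by do ?apply: regular_add.
have rs : regular_at z0 s.
  have -> : s = fun z => Y 0 z + w ^+ 2 * Y 1 z.
    by apply/funext => z; rewrite /s /slope1 !vYE.
  by apply: regular_add => //; apply: regular_mul.
have re : regular_at z0 e.
  have -> : e = fun z => Y 0 z + w * Y 1 z.
    by apply/funext => z; rewrite /e /slope2 !vYE.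
  by apply: regular_add => //; apply: regular_mul.
have nx : znbhs z0 [set z | hc (px z) 0 j != 0] by exact: (mx.1 _ (znbhs_hc xj)).
have ny : znbhs z0 [set z | hc (py z) 0 l != 0] by exact: (my.1 _ (znbhs_hc yl)).
have main r : regular_at z0 r ->
    znbhs z0 [set z | four1 (vX z) = r z * s z /\ four2 (vX z) = r z * e z] ->
    exists u r s e : blowup k -> k,
      [/\ regular_at z0 u, regular_at z0 r, regular_at z0 s, regular_at z0 e
        & znbhs z0 [set z | blow_coords z (u z) (r z) (s z) (e z)]].
  move=> rr nr; exists u, r, s, e; split=> //.
  apply: znbhsS (znbhsI nr (znbhsI nx ny)) _ => z [[h1 h2] [xz yz]].
  split.
    exists (hc (px z) 0 j / 3); first by rewrite mulf_neq0 // invr_eq0 pnatr_eq0.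
    rewrite -h1 -h2 unfourK /vX !scalerA.
    by rewrite divfK ?pnatr_eq0 // mulfV // scale1r.
  exists (hc (py z) 0 l / (w ^+ 2 - w)).
    by rewrite mulf_neq0 // invr_eq0 ww_neq0.
  rewrite directionK /vY !scalerA.
  by rewrite divfK ?ww_neq0 // mulfV // scale1r.
have inc z : four1 (vX z) * e z = four2 (vX z) * s z.
  have := blow_incidence z; rewrite /e /s /vX /vY !fourZ.
  have hs c y : slope1 (c *: y) = c * slope1 y by rewrite /slope1 !mxE; ring.
  have he c y : slope2 (c *: y) = c * slope2 y by rewrite /slope2 !mxE; ring.
  by rewrite hs he => h; rewrite mulrACA h mulrACA.
have [s0|s0] := eqVneq (s z0) 0; last first.
  apply: (main (fun z => four1 (vX z) / s z)); first exact: regular_div.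
  apply: znbhsS (regular_neq0 rs s0) _ => z /= sz; rewrite divfK //; split=> //.
  by rewrite mulrAC inc mulfK.
have e0 : e z0 != 0.
  apply/eqP => e0; have := hc_neq0 (py z0); apply/negP/negPn.
  have := directionK (vY z0); rewrite -/(s z0) -/(e z0) s0 e0.
  have /eqP -> : direction 0 0 == 0 by rewrite direction_eq0 !eqxx.
  move/esym/eqP; rewrite scaler_eq0 (negPf ww_neq0) /vY scaler_eq0 invr_eq0.
  by rewrite (negPf yl).
apply: (main (fun z => four2 (vX z) / e z)); first exact: regular_div.
apply: znbhsS (regular_neq0 re e0) _ => z /= ez; rewrite divfK //; split=> //.
by rewrite mulrAC -inc mulfK.
Qed.

Lemma morph_at_blowup (X : kspace k) (g : X -> blowup k) (u r s e : X -> k) x :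
    regular_at x u -> regular_at x r -> regular_at x s -> regular_at x e ->
    znbhs x [set y | blow_coords (g y) (u y) (r y) (s y) (e y)] ->
  morph_at g x.
Proof.
move=> ru rr rs re ng; apply: morph_at_sub.
have cst c : regular_at x (fun=> c) by exact: regular_at_cst.
have m1 : morph_at (fun y => (sval (g y)).1 : proj_space k 2) x.
  apply: (morph_at_proj (v := fun y => unfour (u y) (r y * s y) (r y * e y))).
    move=> i; under eq_fun do rewrite mxE.
    by do ?apply: regular_add => //; apply: regular_mul => //; apply: regular_mul.
  by apply: znbhsS ng _ => y [].
have m2 : morph_at (fun y => (sval (g y)).2 : proj_space k 1) x.
  apply: (morph_at_proj (v := fun y => direction (s y) (e y))).
    move=> i; under eq_fun do rewrite mxE; case: (i == 0 :> nat).
      by apply: regular_sub; apply: regular_mul.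
    exact: regular_sub.
  by apply: znbhsS ng _ => y [].
apply: eq_morph_at (morph_at_pair m1 m2).
by apply: znbhsS (znbhsT x) _ => y _ /=; case: (sval (g y)).
Qed.

End Blowup.

(** * The Kulikov surface *)

Section KulikovSurface.
Variables (k : numClosedFieldType) (w : k).
Hypothesis w2 : w ^+ 2 = - w - 1.

Local Notation unfour := (unfour w).
Local Notation direction := (direction w).
Local Notation blow_coords := (blow_coords w).
Let n2 : 2 != 0 :> k. Proof. by rewrite pnatr_eq0. Qed.
Let n3 : 3 != 0 :> k. Proof. by rewrite pnatr_eq0. Qed.
Let n9 : 9 != 0 :> k. Proof. by rewrite pnatr_eq0. Qed.

(** Fourier coordinates of the extension of phi o sigma to the blown up plane *)
Definition ext0 (u r s e : k) := 3 * r * s * e.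
Definition ext1 (u r s e : k) := 2 * u * s + r * e ^+ 2.
Definition ext2 (u r s e : k) := 2 * u * e + r * s ^+ 2.
Definition ext (u r s e : k) : 'rV[k]_3 :=
  unfour (ext0 u r s e) (ext1 u r s e) (ext2 u r s e).

(** Equation of the strict transform of R *)
Definition ramif (u r s e : k) := r * (s ^+ 3 + e ^+ 3) - 2 * u * s * e.

Definition line_form (a Y : 'rV[k]_3) := \sum_i a 0 i * Y 0 i.

Lemma ext_unfour u r s e :
  ext u r s e = unfour (ext0 u r s e) (ext1 u r s e) (ext2 u r s e).
Proof. by []. Qed.

Lemma netQ_blow u r s e : netQ (unfour u (r * s) (r * e)) = (3 * r) *: ext u r s e.
Proof.
rewrite netQ_four // /ext unfourZ /ext0 /ext1 /ext2.
by congr (unfour _ _ _); ring.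
Qed.

Lemma cubic_blow u r s e :
  cubic (unfour u (r * s) (r * e)) = - 9 * r ^+ 2 * ramif u r s e.
Proof. by rewrite cubic_four // /ramif; ring. Qed.

Lemma cubicZ c (x : 'rV[k]_3) : cubic (c *: x) = c ^+ 3 * cubic x.
Proof. by rewrite !cubicE !mxE; ring. Qed.

Lemma netQZ c (x : 'rV[k]_3) : netQ (c *: x) = c ^+ 2 *: netQ x.
Proof. by apply/rowP => i; rewrite !mxE /Qform !mxE; ring. Qed.

Lemma conicE a (x : 'rV[k]_3) : conic a x = line_form a (netQ x).
Proof. by apply: eq_bigr => i _; rewrite mxE. Qed.

Lemma line_formZ a c Y : line_form a (c *: Y) = c * line_form a Y.
Proof. by rewrite /line_form big_distrr; apply: eq_bigr => i _; rewrite mxE mulrCA. Qed.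

Lemma line_formD a Y Z : line_form a (Y + Z) = line_form a Y + line_form a Z.
Proof. by rewrite /line_form -big_split; apply: eq_bigr => i _; rewrite mxE mulrDr. Qed.

Lemma line_form_unfour a c0 c1 c2 : line_form a (unfour c0 c1 c2) =
  line_form a (unfour 1 0 0) * c0 + line_form a (unfour 0 1 0) * c1
  + line_form a (unfour 0 0 1) * c2.
Proof.
rewrite ![_ * c0]mulrC ![_ * c1]mulrC ![_ * c2]mulrC -!line_formZ -!line_formD.
by rewrite !unfourZ !unfourD; congr (line_form a (unfour _ _ _)); ring.
Qed.

Lemma blow_coords_scale z u r s e u' r' s' e' :
    blow_coords z u r s e -> blow_coords z u' r' s' e' ->
  exists al be, [/\ al != 0, be != 0, u' = al * u & r' * be = al * r] /\
    s' = be * s /\ e' = be * e.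
Proof.
move=> hz hz'; have se := blow_coords_dir w2 hz; move: hz hz'.
move=> [[c c0 xE] [d d0 yE]] [[c' c0' xE'] [d' d0' yE']].
have Ex : unfour u' (r' * s') (r' * e') = (c / c') *: unfour u (r * s) (r * e).
  by rewrite [c / _]mulrC -scalerA -xE xE' scalerA mulVf ?scale1r.
have Ey : direction s' e' = (d / d') *: direction s e.
  by rewrite [d / _]mulrC -scalerA -yE yE' scalerA mulVf ?scale1r.
have hs c1 (y : 'rV[k]_2) : slope1 w (c1 *: y) =
  c1 * slope1 w y by rewrite /slope1 !mxE; ring.
have he c1 (y : 'rV[k]_2) : slope2 w (c1 *: y) =
  c1 * slope2 w y by rewrite /slope2 !mxE; ring.
have sE : s' = d / d' * s.
  by apply: (mulfI (ww_neq0 w2)); rewrite -(slope1K w2 _ e') Ey hs slope1K //; ring.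
have eE : e' = d / d' * e.
  by apply: (mulfI (ww_neq0 w2)); rewrite -(slope2K w2 s') Ey he slope2K //; ring.
have uE : u' = c / c' * u.
  by apply: (mulfI n3);
    rewrite -(four0K w2 _ (r' * s') (r' * e')) Ex (fourZ w) four0K //; ring.
have rsE : r' * s' = c / c' * (r * s).
  by apply: (mulfI n3); rewrite -(four1K w2 u' _ (r' * e')) Ex (fourZ w) four1K //; ring.
have reE : r' * e' = c / c' * (r * e).
  by apply: (mulfI n3); rewrite -(four2K w2 u' (r' * s')) Ex (fourZ w) four2K //; ring.
exists (c / c'), (d / d'); split=> //; split=> //; rewrite ?mulf_neq0 ?invr_eq0 //.
case/orP: se => h0; apply: (mulIf h0).
  by rewrite -[LHS]mulrA -sE rsE mulrA.
by rewrite -[LHS]mulrA -eE reE mulrA.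
Qed.

Lemma scale_blow_coords z u r s e al be : al != 0 -> be != 0 ->
  blow_coords z u r s e -> blow_coords z (al * u) (al * r / be) (be * s) (be * e).
Proof.
move=> al0 be0 [[c c0 xE] [d d0 yE]]; split.
  exists (c / al); first by rewrite mulf_neq0 ?invr_eq0.
  rewrite xE !unfourZ; congr (unfour _ _ _); first by rewrite mulrA divfK.
    by field; rewrite al0 be0.
  by field; rewrite al0 be0.
exists (d / be); first by rewrite mulf_neq0 ?invr_eq0.
by rewrite yE; apply: row2P; rewrite [LHS]mxE [RHS]mxE !directionE; field.
Qed.

Lemma ramif_scale u r s e u' r' al be : u' = al * u -> r' * be = al * r ->
  ramif u' r' (be * s) (be * e) = al * be ^+ 2 * ramif u r s e.
Proof.
move=> -> hr; rewrite /ramif.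
transitivity ((r' * be) * be ^+ 2 * (s ^+ 3 + e ^+ 3) - al * be ^+ 2 * (2 * u * s * e)).
  by ring.
by rewrite hr; ring.
Qed.

Lemma ext_scale u r s e u' r' al be : u' = al * u -> r' * be = al * r ->
  ext u' r' (be * s) (be * e) = (al * be) *: ext u r s e.
Proof.
move=> -> hr; rewrite /ext unfourZ /ext0 /ext1 /ext2; congr (unfour _ _ _).
- by transitivity (3 * (r' * be) * be * s * e); [ring|rewrite hr; ring].
- transitivity (2 * al * be * u * s + (r' * be) * be * e ^+ 2); first by ring.
  by rewrite hr; ring.
- transitivity (2 * al * be * u * e + (r' * be) * be * s ^+ 2); first by ring.
  by rewrite hr; ring.
Qed.

Lemma blow_P111 z u r s e : blow_coords z u r s e ->
  (val (sigma z) == P111 k) = (r == 0).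
Proof.
move=> hz; have se := blow_coords_dir w2 hz; have [[c c0 xE] _] := hz.
have P1 : const_mx 1 = unfour 1 0 0.
  by apply: row3P; rewrite unfourE mxE; ring.
apply/eqP/eqP => [hP|r0].
  have [d d0] := hc_line hP; rewrite xE P1 !unfourZ !mulr0.
  move=> /[dup] /(congr1 (four1 w)); rewrite four1K // four1K // !mulr0 => /eqP.
  rewrite !mulf_eq0 (negPf n3) (negPf c0) /= => /orP[/eqP//|s0].
  move=> /(congr1 (four2 w)); rewrite four2K // four2K // !mulr0 => /eqP.
  rewrite !mulf_eq0 (negPf n3) (negPf c0) /= => /orP[/eqP//|e0].
  by rewrite s0 e0 in se.
rewrite hc_span [hc _]xE r0 !mul0r /P111 P1.
have u0 : u != 0 by have := blow_coords_point w2 hz; rewrite r0 eqxx orbF.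
have -> : unfour u 0 0 = u *: unfour 1 0 0 by rewrite unfourZ mulr1 mulr0.
rewrite scalerA; apply/eqP; rewrite eqEsubv -!memvE.
have cu : c * u != 0 by rewrite mulf_neq0.
rewrite memvZ ?memv_line //=.
by rewrite -[X in X \in _](scalerK cu) memvZ ?memv_line.
Qed.

(** A form q that vanishes on the inverse image of the curve G = 0 off the
    exceptional curve also vanishes on its closure, since its zeros are locally
    the zeros of a regular function. *)
Lemma strict_transform_form (G : 'rV[k]_3 -> k) (q : k -> k -> k -> k -> k) z u r s e :
    (forall c u r s e, G (c *: unfour u (r * s) (r * e)) = 0 ->
      c != 0 -> r != 0 -> q u r s e = 0) ->
    (forall z u r s e, regular_at z u -> regular_at z r -> regular_at z s ->
      regular_at z e -> regular_at z (fun x : blowup k => q (u x) (r x) (s x) (e x))) ->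
    (forall u r s e u' r' al be, al != 0 -> be != 0 ->
      u' = al * u -> r' * be = al * r ->
      q u r s e != 0 -> q u' r' (be * s) (be * e) != 0) ->
    blow_coords z u r s e -> q u r s e != 0 -> ~ strict_transform G z.
Proof.
move=> qG qreg qscale hz qz hst.
have [u' [r' [s' [e' [ru rr rs re nz]]]]] := blow_section w2 z.
have [al [be [[al0 be0 uE rE] [sE eE]]]] := blow_coords_scale hz (znbhs_self nz).
have q'z : q (u' z) (r' z) (s' z) (e' z) != 0.
  by rewrite sE eE; apply: (qscale _ _ _ _ _ _ _ _ al0 be0 uE rE qz).
have := hst _ (znbhsI (regular_neq0 (qreg _ _ _ _ _ ru rr rs re) q'z) nz).
case=> x [[/= qx hx] [xP Gx]]; case/eqP: qx.
have [[c c0 xE] _] := hx.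
move: xP; rewrite (blow_P111 hx) => rx.
by apply: (qG c) => //; rewrite -xE.
Qed.

(** Conversely the two points of the exceptional curve where the form vanishes are
    limits of points of R, along the rational parametrizations
    (x^3 + 1 : 2 x^2 : 2 x) and (x^3 + 1 : 2 x : 2 x^2) of the nodal cubic. *)
Lemma strict_cubic z u r s e : blow_coords z u r s e ->
  strict_transform (@cubic k) z <-> ramif u r s e = 0.
Proof.
move=> hz; split=> [hst|R0].
  apply/eqP; apply: contraPT hst => R0.
  apply: (strict_transform_form _ _ _ hz R0) => {z u r s e hz R0}.
  - move=> c u r s e; rewrite cubicZ cubic_blow mulrA => h c0 r0.
    have cr : c ^+ 3 * (- 9 * r ^+ 2) != 0.
      by rewrite !mulf_neq0 ?expf_neq0 ?oppr_eq0.
    by apply: (mulfI cr); rewrite h mulr0.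
  - move=> z u r s e ru rr rs re; apply: regular_sub.
      by apply: regular_mul => //; apply: regular_add; apply: regular_exp.
    by do ?apply: regular_mul => //; apply: regular_at_cst.
  - move=> u r s e u' r' al be al0 be0 uE rE R0.
    by rewrite (ramif_scale _ _ uE rE) !mulf_neq0 ?expf_neq0.
have [r0|r0] := eqVneq r 0; last first.
  move=> N nN; exists z; split; first exact: znbhs_self nN.
  have [[c c0 xE] _] := hz.
  split; first by rewrite (blow_P111 hz).
  by rewrite /sigma xE cubicZ cubic_blow R0 !mulr0.
have u0 : u != 0 by have := blow_coords_point w2 hz; rewrite r0 eqxx orbF.
have curve (s' e' : {poly k}) :
    blow_coords z 1 0 s'.[0] e'.[0] ->
    (forall x, (s'.[x] != 0) || (e'.[x] != 0)) ->
    (forall x, ramif (x ^+ 3 + 1) (2 * x) s'.[x] e'.[x] = 0) ->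
    strict_transform (@cubic k) z.
  move=> hz0 hse hR N nN.
  pose P (x : affine_line k) y := blow_coords y (x ^+ 3 + 1) (2 * x) s'.[x] e'.[x].
  have [g hg] := choose_map z P.
  have {}hg x : P x (g x).
    apply: hg; apply: blow_coords_exists => //.
    have [->|x0] := eqVneq x 0; first by rewrite expr0n add0r oner_neq0.
    by rewrite mulf_neq0 ?orbT.
  have g0 : g 0 = z.
    apply: (blow_coords_inj (hg 0)); rewrite /P expr0n add0r mulr0; exact: hz0.
  have mg : morph_at g 0.
    have rid := @regular_line k 0.
    apply: (morph_at_blowup (w := w) (u := fun x : affine_line k => x ^+ 3 + 1)
      (r := fun x => 2 * x) (s := fun x => s'.[x]) (e := fun x => e'.[x])).
    - by apply: regular_add; [apply: regular_exp|apply: regular_at_cst].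
    - by apply: regular_mul => //; apply: regular_at_cst.
    - exact: regular_horner.
    - exact: regular_horner.
    - by apply: znbhsS (znbhsT _) _ => x _; apply: hg.
  have nN0 : znbhs (g 0) N by rewrite g0.
  have [D D0 hD] := (znbhs_line _ _).1 (mg.1 N nN0).
  have [x] : exists x, ('X * D).[x] != 0.
    apply: poly_avoid; rewrite mulf_neq0 ?polyX_eq0 //.
    by apply: contraNneq D0 => ->; rewrite horner0.
  rewrite hornerM hornerX mulf_eq0 negb_or => /andP[x0 Dx].
  exists (g x); split; first exact: hD.
  split; first by rewrite (blow_P111 (hg x)) mulf_neq0.
  by have [[c c0 xE] _] := hg x; rewrite /sigma xE cubicZ cubic_blow hR !mulr0.
have : s * e = 0.
  move: R0; rewrite /ramif r0 mul0r add0r => /eqP.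
  by rewrite oppr_eq0 -mulrA !mulf_eq0 (negPf n2) (negPf u0) /= -mulf_eq0 => /eqP.
have ui0 : u^-1 != 0 by rewrite invr_eq0.
have hz1 be : be != 0 -> blow_coords z 1 0 (be * s) (be * e).
  move=> be0; have := scale_blow_coords ui0 be0 hz.
  by rewrite mulVf // r0 mulr0 mul0r.
have se := blow_coords_dir w2 hz.
move/eqP; rewrite mulf_eq0 => /orP[]/eqP h0; move: se; rewrite h0 eqxx ?orbF /= => h1.
  apply: (curve 'X 1).
  - have := hz1 e^-1; rewrite invr_eq0 => /(_ h1).
    by rewrite h0 mulr0 mulVf // hornerX hornerC.
  - by move=> x; rewrite hornerC oner_neq0 orbT.
  - by move=> x; rewrite hornerX hornerC /ramif; ring.
apply: (curve 1 'X).
- have := hz1 s^-1; rewrite invr_eq0 => /(_ h1).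
  by rewrite h0 mulr0 mulVf // hornerX hornerC.
- by move=> x; rewrite hornerC oner_neq0.
- by move=> x; rewrite hornerX hornerC /ramif; ring.
Qed.

End KulikovSurface.

(** ** The Kulikov morphism *)

Section KulikovMorphism.
Variables (k : numClosedFieldType) (w : k).
Hypothesis w2 : w ^+ 2 = - w - 1.

Local Notation unfour := (unfour w).
Local Notation blow_coords := (blow_coords w).
Local Notation ext := (ext w).
Let n2 : 2 != 0 :> k. Proof. by rewrite pnatr_eq0. Qed.
Let n3 : 3 != 0 :> k. Proof. by rewrite pnatr_eq0. Qed.

Variable a : 'rV[k]_3.
Local Notation S := (kulikov_surface a).

Lemma surface_coords (z : S) : exists u r s e, blow_coords (sval z) u r s e.
Proof.
have [u [r [s [e [_ _ _ _ nz]]]]] := blow_section w2 (sval z).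
by exists (u (sval z)), (r (sval z)), (s (sval z)), (e (sval z)); apply: znbhs_self nz.
Qed.

Lemma surface_ramif (z : S) u r s e :
  blow_coords (sval z) u r s e -> ramif u r s e != 0.
Proof.
move=> hz; apply/eqP => /(strict_cubic w2 hz) h.
by case: z {hz} h => z hz /= h; apply: hz; left.
Qed.

Lemma surface_exists (z : blowup k) u r s e : blow_coords z u r s e ->
    ramif u r s e != 0 -> line_form a (ext u r s e) != 0 ->
  exists z' : S, sval z' = z.
Proof.
move=> hz R0 L0.
suff hS : (~` (strict_transform (@cubic k) `|` strict_transform (conic a))) z.
  by exists (exist _ z hS).
case=> [/(strict_cubic w2 hz)/eqP|]; first by rewrite (negPf R0).
apply: (@strict_transform_form _ _ w2 (conic a)
  (fun u r s e => line_form a (ext u r s e)) z u r s e) => // {z u r s e hz R0 L0}.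
- move=> c u r s e; rewrite conicE netQZ netQ_blow // !line_formZ mulrA => h c0 r0.
  have cr : c ^+ 2 * (3 * r) != 0 by rewrite !mulf_neq0 ?expf_neq0.
  by apply: (mulfI cr); rewrite h mulr0.
- move=> z u r s e ru rr rs re.
  apply: regular_sum => i; apply: regular_mul; first exact: regular_at_cst.
  under eq_fun do rewrite /ext mxE /ext0 /ext1 /ext2.
  by do ?[apply: regular_add|apply: regular_mul|apply: regular_exp
         |exact: regular_at_cst].
- move=> u r s e u' r' al be al0 be0 uE rE L0.
  by rewrite (ext_scale _ _ _ uE rE) line_formZ !mulf_neq0.
Qed.

Variable Phi : S -> proj_space k 2.
Hypotheses (Phi_mor : is_morphism Phi)
           (Phi_netQ : forall z : S, val (sigma (sval z)) != P111 k ->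
              val (Phi z) = <[netQ (hc (sigma (sval z)))]>%VS).

(** On the exceptional curve the formula follows by continuity along a fibre of
    the blown up plane over P^1. *)
Lemma Phi_coords (z : S) u r s e : blow_coords (sval z) u r s e ->
  exists2 c, c != 0 & hc (Phi z) = c *: ext u r s e.
Proof.
have off_E (y : S) u' r' s' e' : blow_coords (sval y) u' r' s' e' -> r' != 0 ->
    exists2 c, c != 0 & hc (Phi y) = c *: ext u' r' s' e'.
  move=> hy r0; have [[d d0 yE] _] := hy.
  have := @Phi_netQ y; rewrite (blow_P111 w2 hy) => /(_ r0).
  rewrite /sigma yE netQZ netQ_blow // scalerA => /hc_line[c c0 ->].
  by rewrite scalerA; exists (c * (d ^+ 2 * (3 * r'))); rewrite // !mulf_neq0 ?expf_neq0.
move=> hz; have [r0|] := eqVneq r 0; last exact: off_E.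
have u0 : u != 0 by have := blow_coords_point w2 hz; rewrite r0 eqxx orbF.
have se := blow_coords_dir w2 hz.
pose P (x : affine_line k) y := blow_coords y u x s e.
have [g hg] := choose_map (sval z) P.
have {}hg x : P x (g x) by apply: hg; apply: blow_coords_exists; rewrite ?u0.
have g0 : g 0 = sval z by apply: (blow_coords_inj (hg 0)); rewrite -r0.
have rid := @regular_line k 0.
have mg : morph_at g 0.
  apply: (morph_at_blowup (w := w) (u := fun=> u) (r := fun x : affine_line k => x)
    (s := fun=> s) (e := fun=> e)) => //; try exact: regular_at_cst.
  by apply: znbhsS (znbhsT _) _ => x _; apply: hg.
have nS : znbhs (g 0)
    (~` (strict_transform (@cubic k) `|` strict_transform (conic a))).
  rewrite g0; case: (z) => y hy /=.
  have ny1 : znbhs y (~` strict_transform (@cubic k)).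
    by apply: znbhs_zclosure => h; apply: hy; left.
  have ny2 : znbhs y (~` strict_transform (conic a)).
    by apply: znbhs_zclosure => h; apply: hy; right.
  by rewrite setCU; apply: znbhsI.
have [h hE] := @choose_map (affine_line k) S z (fun (x : affine_line k) (y : S) =>
  sval y = g x).
have {hE} nh : znbhs (0 : affine_line k) [set x | sval (h x) = g x].
  apply: znbhsS (mg.1 _ nS) _ => x /= hx.
  by apply: hE; exists (exist _ (g x) hx).
have h0 : h 0 = z by apply/sval_inj; rewrite (znbhs_self nh) g0.
have mh : morph_at h 0.
  apply: morph_at_sub; apply: eq_morph_at mg.
  by apply: znbhsS nh _ => x /= ->.
have mPh : morph_at (Phi \o h) 0 by apply: morph_at_comp => //; apply: Phi_mor.
have [j] := hc_coord_neq0 (Phi z); rewrite -h0 => hj.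
have [D D0 hD] := (znbhs_line _ _).1 nh.
pose V (x : k) := ext u x s e.
have rV i : regular_at (0 : affine_line k) (fun x => V x 0 i).
  under eq_fun do rewrite /V /ext mxE /ext0 /ext1 /ext2.
  by do ?[apply: regular_add|apply: regular_mul|exact: regular_at_cst
         |exact: rid].
have [E E0 hE] := (znbhs_line _ _).1 (mPh.1 _ (znbhs_hc hj)).
have lim i : V 0 0 i = V 0 0 j / hc (Phi (h 0)) 0 j * hc (Phi (h 0)) 0 i.
  apply/eqP; rewrite mulrAC -mulrA -subr_eq0.
  have DE0 : 'X * (D * E) != 0.
    have nz (p : {poly k}) : p.[0] != 0 -> p != 0.
      by apply: contraNneq => ->; rewrite horner0.
    by rewrite !mulf_neq0 ?polyX_eq0 ?nz.
  rewrite (regular_line_eq0 (h := fun x : affine_line k =>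
    V x 0 i - V x 0 j * (hc (Phi (h x)) 0 i / hc (Phi (h x)) 0 j)) _ DE0) //.
  - apply: regular_sub => //; apply: regular_mul => //.
    exact: (mPh.2 _ (regular_hc i hj)).
  - move=> x; rewrite !hornerM hornerX !mulf_eq0 !negb_or.
    move=> /andP[x0 /andP[/hD /= hx /hE /= Ex]].
    have [|c c0 PE] := @off_E (h x) u x s e _ x0; first by rewrite hx; apply: hg.
    move: Ex; rewrite PE -/(V x) !scale_rowE mulf_eq0 negb_or => /andP[_ Vj].
    by rewrite -mulf_div divff // mul1r mulrCA divff // mulr1 subrr.
have VE : V 0 = (V 0 0 j / hc (Phi (h 0)) 0 j) *: hc (Phi (h 0)).
  by apply/rowP => i; rewrite scale_rowE lim.
have V0 : V 0 != 0.
  rewrite /V /ext unfour_eq0 // /ext1 /ext2 !mul0r !addr0 !mulf_eq0.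
  rewrite (negPf n2) (negPf u0) /=.
  by apply/negP => /and3P[_ s0 e0]; rewrite s0 e0 in se.
have c0 : V 0 0 j / hc (Phi (h 0)) 0 j != 0.
  by apply: contra_neq V0; rewrite {2}VE => ->; rewrite scale0r.
exists (V 0 0 j / hc (Phi (h 0)) 0 j)^-1; first by rewrite invr_eq0.
by rewrite r0 -/(V 0) {2}VE scalerK // h0.
Qed.

Variables (M : 'M[k]_(1 + 2)) (F : S -> affine_space k 2).
Hypotheses (M_unit : M \in unitmx) (M_row : usubmx M = a)
  (F_def : forall z : S, let v : 'rV[k]_(1 + 2) := hc (Phi z) *m M^T in
     v 0 0 != 0 /\ F z = (v 0 0)^-1 *: rsubmx v).

(** The point of P^2 with affine coordinates y, normalized by the equation of L *)
Definition hpt (y : 'rV[k]_2) : 'rV[k]_3 :=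
  (row_mx (1 : 'M_1) y : 'rV[k]_(1 + 2)) *m (invmx M)^T.

Lemma mulmx_trK (v : 'rV[k]_(1 + 2)) : (v *m M^T) *m (invmx M)^T = v.
Proof. by rewrite -mulmxA -trmx_mul mulVmx // trmx1 mulmx1. Qed.

Lemma mulmx_trVK (v : 'rV[k]_(1 + 2)) : (v *m (invmx M)^T) *m M^T = v.
Proof. by rewrite -mulmxA -trmx_mul mulmxV // trmx1 mulmx1. Qed.

Lemma line_form_mx (Y : 'rV[k]_3) : line_form a Y = ((Y : 'rV_(1 + 2)) *m M^T) 0 0.
Proof.
rewrite /line_form mxE; apply: eq_bigr => i _; rewrite mulrC mxE -M_row.
by rewrite mxE; congr (_ * M _ _); apply/val_inj.
Qed.

Lemma row_mx1_00 (y : 'rV[k]_2) : (row_mx (1 : 'M_1) y : 'rV[k]_(1 + 2)) 0 0 = 1.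
Proof.
have -> : 0 = lshift 2 (0 : 'I_1) by apply/val_inj.
by rewrite row_mxEl mxE eqxx.
Qed.

Lemma row_mx_normalize (v : 'rV[k]_(1 + 2)) : v 0 0 != 0 ->
  row_mx 1 ((v 0 0)^-1 *: rsubmx v) = (v 0 0)^-1 *: v.
Proof.
move=> v0; transitivity ((v 0 0)^-1 *: row_mx (lsubmx v) (rsubmx v)).
  2: by rewrite hsubmxK.
rewrite scale_row_mx; congr row_mx.
apply/rowP => i; rewrite ord1 [LHS]mxE eqxx scale_rowE [lsubmx _ _ _]mxE.
have -> : lshift 2 0 = 0 :> 'I_(1 + 2) by apply/val_inj.
by rewrite mulVf.
Qed.

Lemma line_form_hpt y : line_form a (hpt y) = 1.
Proof. by rewrite line_form_mx /hpt mulmx_trVK row_mx1_00. Qed.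

Lemma hpt_inj : injective hpt.
Proof.
move=> y y' /(congr1 (fun v : 'rV_(1 + 2) => v *m M^T)).
by rewrite /hpt !mulmx_trVK => /eq_row_mx[].
Qed.

Lemma hptE y : hpt y = (row_mx (1 : 'M_1) y : 'rV[k]_(1 + 2)) *m (invmx M)^T.
Proof. by []. Qed.

Definition of_hpt (Y : 'rV[k]_3) : 'rV[k]_2 := rsubmx (Y *m M^T : 'rV[k]_(1 + 2)).

Lemma of_hptK (Y : 'rV[k]_3) : line_form a Y = 1 -> hpt (of_hpt Y) = Y.
Proof.
rewrite line_form_mx /of_hpt; set v : 'rV_(1 + 2) := _ *m _ => v1.
have v0 : v 0 0 != 0 by rewrite v1 oner_neq0.
have := row_mx_normalize v0; rewrite v1 invr1 !scale1r /hpt => ->.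
exact: mulmx_trK.
Qed.

Lemma hpt_F (z : S) u r s e : blow_coords (sval z) u r s e ->
  exists2 c, c != 0 & hpt (F z) = c *: ext u r s e.
Proof.
move=> /Phi_coords[c c0 PE]; have [v0 FE] := F_def z.
exists ((line_form a (hc (Phi z)))^-1 * c).
  by rewrite mulf_neq0 // invr_eq0 line_form_mx.
by rewrite FE /hpt row_mx_normalize // -scalemxAl mulmx_trK PE scalerA line_form_mx -PE.
Qed.

End KulikovMorphism.

(** * The Kulikov surface as a family of binary cubics *)

Section BinaryCubics.
Variable k : comNzRingType.
Implicit Types c l t s e : k.

(** The coefficients, in the affine coordinate t for which (s : e) = (1 + l t : t),
    of the binary cubic c0 (s^3 - e^3) - 3 c2 s^2 e + 3 c1 s e^2. *)
Definition cub0 l c0 c1 c2 := c0.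
Definition cub1 l c0 c1 c2 := 3 * l * c0 - 3 * c2.
Definition cub2 l c0 c1 c2 := 3 * l ^+ 2 * c0 - 6 * l * c2 + 3 * c1.
Definition cub3 l c0 c1 c2 := (l ^+ 3 - 1) * c0 - 3 * l ^+ 2 * c2 + 3 * l * c1.
Definition cub l c0 c1 c2 t := cub0 l c0 c1 c2 + cub1 l c0 c1 c2 * t
  + cub2 l c0 c1 c2 * t ^+ 2 + cub3 l c0 c1 c2 * t ^+ 3.
Definition dcub l c0 c1 c2 t := cub1 l c0 c1 c2
  + 2 * cub2 l c0 c1 c2 * t + 3 * cub3 l c0 c1 c2 * t ^+ 2.

Lemma cubE l c0 c1 c2 t : cub l c0 c1 c2 t =
  c0 * ((1 + l * t) ^+ 3 - t ^+ 3) - 3 * c2 * (1 + l * t) ^+ 2 * t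
  + 3 * c1 * (1 + l * t) * t ^+ 2.
Proof. by rewrite /cub /cub0 /cub1 /cub2 /cub3; ring. Qed.

End BinaryCubics.

Section Charts.
Variables (k : numClosedFieldType) (w : k).
Hypothesis w2 : w ^+ 2 = - w - 1.

Local Notation unfour := (unfour w).
Local Notation blow_coords := (blow_coords w).
Local Notation ext := (ext w).
Let n2 : 2 != 0 :> k. Proof. by rewrite pnatr_eq0. Qed.
Let n3 : 3 != 0 :> k. Proof. by rewrite pnatr_eq0. Qed.
Let n6 : 6 != 0 :> k. Proof. by rewrite pnatr_eq0. Qed.

(** The binary cubic results from the elimination of u and r between the equations
    (c0, c1, c2) = ext u r s e. *)
Lemma cub_ext (l m u r t : k) :
  cub l (m * ext0 u r (1 + l * t) t) (m * ext1 u r (1 + l * t) t)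
    (m * ext2 u r (1 + l * t) t) t = 0.
Proof. by rewrite cubE /ext0 /ext1 /ext2; ring. Qed.

(** Hence the direction of a point is a simple root of the cubic if and only if the
    point is off the strict transform of R. *)
Lemma dcub_ext (l m u r t : k) :
  dcub l (m * ext0 u r (1 + l * t) t) (m * ext1 u r (1 + l * t) t)
    (m * ext2 u r (1 + l * t) t) t = - 3 * m * ramif u r (1 + l * t) t.
Proof. by rewrite /dcub /cub1 /cub2 /cub3 /ext0 /ext1 /ext2 /ramif; ring. Qed.

(** ** Recovering a point from its image and its direction *)

(** Of the two formulas, the first fails on the directions with s^3 = e^3 and the
    second on those with s e = 0. *)
Lemma ext_inv1 (l c0 c1 c2 t : k) : let s := 1 + l * t in cub l c0 c1 c2 t = 0 ->
  ext ((c1 * s ^+ 2 - c2 * t ^+ 2) / 2) (c2 * s - c1 * t) s t =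
  (s ^+ 3 - t ^+ 3) *: unfour c0 c1 c2.
Proof.
move=> s; rewrite cubE -/s => h; rewrite /ext unfourZ /ext0 /ext1 /ext2.
congr (unfour _ _ _); try by field.
apply/eqP; rewrite -subr_eq0; apply/eqP; rewrite -oppr0 -h; ring.
Qed.

Lemma ext_inv2 (l c0 c1 c2 t : k) : let s := 1 + l * t in cub l c0 c1 c2 t = 0 ->
  ext (3 * s * t * c1 - t ^+ 2 * c0) (2 * s * c0) s t =
  (6 * s ^+ 2 * t) *: unfour c0 c1 c2.
Proof.
move=> s; rewrite cubE -/s => h; rewrite /ext unfourZ /ext0 /ext1 /ext2.
congr (unfour _ _ _); try by ring.
apply/eqP; rewrite -subr_eq0; apply/eqP; rewrite -[RHS](mulr0 2) -h; ring.
Qed.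

Variable a : 'rV[k]_3.
Local Notation S := (kulikov_surface a).
Variables (Phi : S -> proj_space k 2) (M : 'M[k]_(1 + 2)) (F : S -> affine_space k 2).
Hypotheses (Phi_mor : is_morphism Phi)
  (Phi_netQ : forall z : S, val (sigma (sval z)) != P111 k ->
    val (Phi z) = <[netQ (hc (sigma (sval z)))]>%VS)
  (M_unit : M \in unitmx) (M_row : usubmx M = a)
  (F_def : forall z : S, let v : 'rV[k]_(1 + 2) := hc (Phi z) *m M^T in
     v 0 0 != 0 /\ F z = (v 0 0)^-1 *: rsubmx v).

Local Notation hpt := (hpt M).

(** Fourier coordinates of the target plane *)
Definition co0 (y : 'rV[k]_2) := four0 (hpt y) / 3.
Definition co1 (y : 'rV[k]_2) := four1 w (hpt y) / 3.
Definition co2 (y : 'rV[k]_2) := four2 w (hpt y) / 3.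

Lemma hpt_co y : hpt y = unfour (co0 y) (co1 y) (co2 y).
Proof.
apply: (scalerI n3); rewrite unfourZ /co0 /co1 /co2 !(mulrC 3) !divfK //.
by rewrite unfourK.
Qed.

Lemma co_unfour y c0 c1 c2 : hpt y = unfour c0 c1 c2 ->
  [/\ co0 y = c0, co1 y = c1 & co2 y = c2].
Proof.
by rewrite /co0 /co1 /co2 => ->; rewrite !fourK // ![3 * _]mulrC !mulfK.
Qed.

Definition co_inv c0 c1 c2 : 'rV[k]_2 := of_hpt M (unfour c0 c1 c2).

Lemma co_invK c0 c1 c2 : line_form a (unfour c0 c1 c2) = 1 ->
  [/\ co0 (co_inv c0 c1 c2) = c0, co1 (co_inv c0 c1 c2) = c1
    & co2 (co_inv c0 c1 c2) = c2].
Proof. by move=> L1; apply: co_unfour; apply: of_hptK L1. Qed.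

Lemma line_form_co y : line_form a (unfour (co0 y) (co1 y) (co2 y)) = 1.
Proof. by rewrite -hpt_co (line_form_hpt M_unit M_row). Qed.

Lemma co_inj y y' : co0 y = co0 y' -> co1 y = co1 y' -> co2 y = co2 y' -> y = y'.
Proof. by move=> h0 h1 h2; apply: (hpt_inj M_unit); rewrite !hpt_co h0 h1 h2. Qed.

(** The affine coordinate e / (s - l e) of the direction (s : e), that is, of the
    line through P on which a point lies; it misses the direction (l : 1). *)
Definition dir1 (z : S) : k := slope1 w (hc (sval (sval z)).2).
Definition dir2 (z : S) : k := slope2 w (hc (sval (sval z)).2).
Definition chart_dom (l : k) : set S := [set z | dir1 z - l * dir2 z != 0].
Definition chart (l : k) (z : S) : k := dir2 z / (dir1 z - l * dir2 z).

Lemma dir_coords (z : S) u r s e : blow_coords (sval z) u r s e ->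
  exists2 d, d != 0 & dir1 z = d * s /\ dir2 z = d * e.
Proof.
move=> [_ [d d0 zE]]; exists (d * (w ^+ 2 - w)); first by rewrite mulf_neq0 ?ww_neq0.
rewrite /dir1 /dir2 zE.
have hs c1 (y : 'rV[k]_2) : slope1 w (c1 *: y) =
  c1 * slope1 w y by rewrite /slope1 !mxE; ring.
have he c1 (y : 'rV[k]_2) : slope2 w (c1 *: y) =
  c1 * slope2 w y by rewrite /slope2 !mxE; ring.
by rewrite hs he slope1K // slope2K // !mulrA.
Qed.

Lemma chart_coords l (z : S) : chart_dom l z ->
  exists u r, blow_coords (sval z) u r (1 + l * chart l z) (chart l z).
Proof.
rewrite /chart_dom /= => hl.
have [u [r [s [e hz]]]] := surface_coords w2 z; have [d d0 [h1 h2]] := dir_coords hz.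
have sl : s - l * e != 0.
  by apply: contra_neq hl => h0; rewrite h1 h2 mulrCA -mulrBr h0 mulr0.
have dsl : d * s - l * (d * e) != 0 by rewrite -h1 -h2.
have i0 : (s - l * e)^-1 != 0 by rewrite invr_eq0.
have := scale_blow_coords (oner_neq0 k) i0 hz.
have <- : chart l z = (s - l * e)^-1 * e.
  by rewrite /chart h1 h2; field; rewrite ?sl ?dsl.
suff <- : 1 + l * chart l z = (s - l * e)^-1 * s by move=> h; eexists; eexists; apply: h.
by rewrite /chart h1 h2; field; rewrite ?sl ?dsl.
Qed.

Lemma chart_of_coords l (z : S) u r t :
  blow_coords (sval z) u r (1 + l * t) t -> chart_dom l z /\ chart l z = t.
Proof.
move=> /dir_coords[d d0 [h1 h2]]; rewrite /chart_dom /chart /= h1 h2.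
have -> : d * (1 + l * t) - l * (d * t) = d by ring.
by rewrite mulrC mulKf.
Qed.

Lemma co_coords l (z : S) u r : blow_coords (sval z) u r (1 + l * chart l z) (chart l z)
  ->
  exists2 m, m != 0 & [/\ co0 (F z) = m * ext0 u r (1 + l * chart l z) (chart l z),
    co1 (F z) = m * ext1 u r (1 + l * chart l z) (chart l z)
    & co2 (F z) = m * ext2 u r (1 + l * chart l z) (chart l z)].
Proof.
move=> hz; have [m m0 hE] := hpt_F w2 Phi_mor Phi_netQ M_unit M_row F_def hz.
by exists m => //; apply: co_unfour; rewrite hE ext_unfour unfourZ.
Qed.

Lemma chart_root l (z : S) : chart_dom l z ->
  cub l (co0 (F z)) (co1 (F z)) (co2 (F z)) (chart l z) = 0 /\
  dcub l (co0 (F z)) (co1 (F z)) (co2 (F z)) (chart l z) != 0.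
Proof.
move=> /chart_coords[u [r hz]]; have [m m0 [-> -> ->]] := co_coords hz.
rewrite cub_ext dcub_ext; split=> //.
by rewrite !mulf_neq0 ?oppr_eq0 // (surface_ramif w2 hz).
Qed.

Let inv_cases l (t : k) : (1 + l * t) ^+ 3 - t ^+ 3 != 0 \/ 6 * (1 + l * t) ^+ 2 * t != 0.
Proof.
have [h|h] := eqVneq ((1 + l * t) ^+ 3 - t ^+ 3) 0; [right|by left].
have [t0|t0] := eqVneq t 0.
  by move/eqP: h; rewrite t0 mulr0 addr0 expr1n expr0n subr0 oner_eq0.
have s0 : 1 + l * t != 0.
  apply/eqP => s0; move/eqP: h; rewrite s0 expr0n sub0r oppr_eq0.
  by rewrite (negPf (expf_neq0 _ t0)).
by rewrite !mulf_neq0 ?expf_neq0.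
Qed.

Lemma surface_inv1 l (z : S) : let t := chart l z in let s := 1 + l * t in
    chart_dom l z -> s ^+ 3 - t ^+ 3 != 0 ->
  blow_coords (sval z) ((co1 (F z) * s ^+ 2 - co2 (F z) * t ^+ 2) / 2)
    (co2 (F z) * s - co1 (F z) * t) s t.
Proof.
move=> t s /chart_coords[u [r hz]] h0; have [m m0 [_ -> ->]] := co_coords hz.
have mh : m * (s ^+ 3 - t ^+ 3) != 0 by rewrite mulf_neq0.
have := scale_blow_coords mh (oner_neq0 k) hz; rewrite -/t -/s !mul1r divr1.
congr blow_coords; first by rewrite /ext1 /ext2; field.
by rewrite /ext1 /ext2; ring.
Qed.

Lemma surface_inv2 l (z : S) : let t := chart l z in let s := 1 + l * t in
    chart_dom l z -> 6 * s ^+ 2 * t != 0 ->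
  blow_coords (sval z) (3 * s * t * co1 (F z) - t ^+ 2 * co0 (F z))
    (2 * s * co0 (F z)) s t.
Proof.
move=> t s /chart_coords[u [r hz]] h0; have [m m0 [-> -> _]] := co_coords hz.
have mh : m * (6 * s ^+ 2 * t) != 0 by rewrite mulf_neq0.
have := scale_blow_coords mh (oner_neq0 k) hz; rewrite -/t -/s !mul1r divr1.
congr blow_coords; rewrite /ext0 /ext1; ring.
Qed.

Lemma chart_inj l (z z' : S) : chart_dom l z -> chart_dom l z' ->
  F z = F z' -> chart l z = chart l z' -> z = z'.
Proof.
move=> hz hz' FE tE; apply/sval_inj.
have [h|h] := inv_cases l (chart l z).
  have := surface_inv1 hz' (z := z'); rewrite -tE -FE => /(_ h).
  exact: blow_coords_inj (surface_inv1 hz h).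
have := surface_inv2 hz' (z := z'); rewrite -tE -FE => /(_ h).
exact: blow_coords_inj (surface_inv2 hz h).
Qed.

Lemma chart_surj l y t : cub l (co0 y) (co1 y) (co2 y) t = 0 ->
    dcub l (co0 y) (co1 y) (co2 y) t != 0 ->
  exists z : S, [/\ chart_dom l z, F z = y & chart l z = t].
Proof.
move=> c0 d0.
have build u r f : f != 0 ->
    ext u r (1 + l * t) t = f *: unfour (co0 y) (co1 y) (co2 y) ->
    exists z : S, [/\ chart_dom l z, F z = y & chart l z = t].
  move=> f0 extE.
  have [h0 h1 h2] : [/\ co0 y = f^-1 * ext0 u r (1 + l * t) t,
      co1 y = f^-1 * ext1 u r (1 + l * t) t & co2 y = f^-1 * ext2 u r (1 + l * t) t].
    by apply: co_unfour; rewrite -unfourZ -ext_unfour extE scalerK // hpt_co.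
  have R0 : ramif u r (1 + l * t) t != 0.
    by move: d0; rewrite h0 h1 h2 dcub_ext mulf_eq0 negb_or => /andP[].
  have st : (1 + l * t != 0) || (t != 0).
    by case: (eqVneq t 0) => [->|_]; rewrite ?orbT // mulr0 addr0 oner_neq0.
  have ur : (u != 0) || (r != 0).
    apply: contraNT R0; rewrite negb_or !negbK => /andP[/eqP-> /eqP->].
    by rewrite /ramif; apply/eqP; ring.
  have [z0 hz0] := blow_coords_exists w2 ur st.
  have L0 : line_form a (ext u r (1 + l * t) t) != 0.
    by rewrite extE line_formZ line_form_co mulr1.
  have [z zE] := surface_exists w2 hz0 R0 L0; exists z.
  have hz : blow_coords (sval z) u r (1 + l * t) t by rewrite zE.
  have [hl tE] := chart_of_coords hz; split=> //.
  have [m m0 [e0 e1 e2]] : exists2 m, m != 0 &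
      [/\ co0 (F z) = m * co0 y, co1 (F z) = m * co1 y & co2 (F z) = m * co2 y].
    have := @co_coords l z u r; rewrite tE => /(_ hz)[m m0 [-> -> ->]].
    exists (m * f); first by rewrite mulf_neq0.
    by rewrite h0 h1 h2 !mulrA mulfK.
  have m1 : m = 1.
    have := line_form_co (F z); rewrite e0 e1 e2 -unfourZ line_formZ line_form_co.
    by rewrite mulr1.
  by apply: co_inj; rewrite ?e0 ?e1 ?e2 m1 mul1r.
have [h|h] := inv_cases l t.
  exact: build h (ext_inv1 c0).
exact: build h (ext_inv2 c0).
Qed.

Lemma regular_chart l (z : S) : chart_dom l z ->
  regular_at z (chart l) /\ znbhs z (chart_dom l).
Proof.
move=> hl; pose py (y : S) : proj_space k 1 := (sval (sval y)).2.
have my : morph_at py z.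
  apply: (@morph_at_comp _ _ _ _ (fun y : S => sval y : blowup k)
           (fun y : blowup k => (sval y).2 : proj_space k 1)).
    exact: morph_at_sval.
  apply: (@morph_at_comp _ _ _ _ (fun y : blowup k => sval y)
           (fun y : prod_space (proj_space k 2) (proj_space k 1) => y.2)).
    exact: morph_at_sval.
  exact: morph_at_snd.
have [j yj] := hc_coord_neq0 (py z).
pose Y i (y : S) := hc (py y) 0 i / hc (py y) 0 j.
have rY i : regular_at z (Y i) by exact: (my.2 _ (regular_hc i yj)).
have ny := my.1 _ (znbhs_hc yj).
pose s y := Y 0 y + w ^+ 2 * Y 1 y; pose e y := Y 0 y + w * Y 1 y.
have cst c : regular_at z (fun=> c) by exact: regular_at_cst.
have rs : regular_at z s by apply: regular_add => //; apply: regular_mul.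
have re : regular_at z e by apply: regular_add => //; apply: regular_mul.
have seE (y : S) : hc (py y) 0 j != 0 ->
    s y = dir1 y / hc (py y) 0 j /\ e y = dir2 y / hc (py y) 0 j.
  by move=> yj'; rewrite /s /e /dir1 /dir2 /slope1 /slope2 /Y -/(py y); split; ring.
have rd : regular_at z (fun y => s y - l * e y).
  by apply: regular_sub => //; apply: regular_mul.
have dE (y : S) : hc (py y) 0 j != 0 ->
    s y - l * e y = (dir1 y - l * dir2 y) / hc (py y) 0 j.
  by move=> /seE[-> ->]; ring.
have d0 : s z - l * e z != 0 by rewrite dE // mulf_neq0 ?invr_eq0.
split.
  apply: eq_regular (regular_div re rd d0).
  apply: znbhsS (znbhsI ny (regular_neq0 rd d0)) _ => y [/= yj' sy].
  have := sy; rewrite dE // mulf_eq0 negb_or => /andP[dy _].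
  by rewrite /chart (seE y yj').2; field; rewrite yj' dy.
apply: znbhsS (znbhsI ny (regular_neq0 rd d0)) _ => y [/= yj'].
by rewrite dE // mulf_eq0 negb_or => /andP[].
Qed.

Lemma regular_co (X : kspace k) x (f : X -> 'rV[k]_2) :
    (forall i, regular_at x (fun y => f y 0 i)) ->
  [/\ regular_at x (fun y => co0 (f y)), regular_at x (fun y => co1 (f y))
    & regular_at x (fun y => co2 (f y))].
Proof.
move=> rf.
have cst c : regular_at x (fun=> c) by exact: regular_at_cst.
have rh j : regular_at x (fun y => hpt (f y) 0 j).
  under eq_fun do rewrite /hpt mxE.
  apply: regular_sum => i; apply: regular_mul => //.
  case: (split_ordP i) => i' ->.
    by under eq_fun do rewrite row_mxEl; apply: cst.
  by under eq_fun do rewrite row_mxEr; apply: rf.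
by split; apply: regular_mul => //;
  do ?[apply: regular_add|apply: regular_mul|apply: rh|apply: cst].
Qed.

Lemma regular_co_inv (X : kspace k) (x : X) (f0 f1 f2 : X -> k) i :
    regular_at x f0 -> regular_at x f1 -> regular_at x f2 ->
  regular_at x (fun y => co_inv (f0 y) (f1 y) (f2 y) 0 i).
Proof.
move=> r0 r1 r2; under eq_fun do rewrite /co_inv /of_hpt mxE mxE.
apply: regular_sum => j; apply: regular_mul; last exact: regular_at_cst.
under eq_fun do rewrite mxE.
by do ?[exact: regular_at_cst|exact: r0|exact: r1|exact: r2
  |apply: regular_add|apply: regular_mul].
Qed.

Lemma morph_at_chart (X : kspace k) (g : X -> S) l x :
    znbhs x [set y | chart_dom l (g y)] ->
    regular_at x (fun y => chart l (g y)) ->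
    (forall i, regular_at x (fun y => F (g y) 0 i)) ->
  morph_at g x.
Proof.
move=> nl rt rF; have [r0 r1 r2] := regular_co rF.
have cst c : regular_at x (fun=> c) by exact: regular_at_cst.
pose t y := chart l (g y); pose s y := 1 + l * t y.
have rs : regular_at x s by apply: regular_add => //; apply: regular_mul.
apply: morph_at_sub; have [h|h] := inv_cases l (chart l (g x)).
  apply: (morph_at_blowup (w := w)
    (u := fun y => (co1 (F (g y)) * s y ^+ 2 - co2 (F (g y)) * t y ^+ 2) / 2)
    (r := fun y => co2 (F (g y)) * s y - co1 (F (g y)) * t y) (s := s) (e := t)) => //.
  - apply: regular_mul => //; apply: regular_sub; apply: regular_mul => //;
      exact: regular_exp.
  - by apply: regular_sub; apply: regular_mul.
  have rh : regular_at x (fun y => s y ^+ 3 - t y ^+ 3).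
    by apply: regular_sub; apply: regular_exp.
  apply: znbhsS (znbhsI nl (regular_neq0 rh h)) _ => y [/= hl hy].
  exact: surface_inv1.
apply: (morph_at_blowup (w := w)
  (u := fun y => 3 * s y * t y * co1 (F (g y)) - t y ^+ 2 * co0 (F (g y)))
  (r := fun y => 2 * s y * co0 (F (g y))) (s := s) (e := t)) => //.
- by apply: regular_sub; do ?apply: regular_mul => //; apply: regular_exp.
- by apply: regular_mul => //; apply: regular_mul.
have rh : regular_at x (fun y => 6 * s y ^+ 2 * t y).
  by do ?apply: regular_mul => //; apply: regular_exp.
apply: znbhsS (znbhsI nl (regular_neq0 rh h)) _ => y [/= hl hy].
exact: surface_inv2.
Qed.

Lemma F_morph (z : S) : morph_at F z.
Proof.
apply: morph_at_affine => i.
have [j hj] := hc_coord_neq0 (Phi z).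
pose L l (x : proj_space k 2) := \sum_m hc x 0 m / hc x 0 j * M l m.
have rL l : regular_at (Phi z) (L l).
  by apply: regular_sum => m; apply: regular_mul (regular_hc m hj) (regular_at_cst _ _).
pose v (y : S) : 'rV[k]_(1 + 2) := hc (Phi y) *m M^T.
have FE y : v y 0 0 != 0 /\ F y = (v y 0 0)^-1 *: rsubmx (v y) by exact: F_def.
have LE l (y : S) : hc (Phi y) 0 j != 0 -> v y 0 l = L l (Phi y) * hc (Phi y) 0 j.
  move=> yj; rewrite mxE /L big_distrl; apply: eq_bigr => m _ /=.
  by rewrite mxE mulrAC divfK.
have L0 : L 0 (Phi z) != 0.
  by have [] := FE z; rewrite LE // mulf_eq0 negb_or => /andP[].
have mPhi : morph_at Phi z by exact: Phi_mor.
apply: eq_regular (mPhi.2 _ (regular_div (rL (rshift 1 i)) (rL 0) L0)).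
apply: znbhsS (mPhi.1 _ (znbhs_hc hj)) _ => y /= yj.
have [_ ->] := FE y; rewrite scale_rowE [rsubmx _ _ _]mxE !LE //.
by rewrite invfM mulrACA [_^-1 * _ in RHS]mulrC mulVf // mulr1 mulrC.
Qed.

Lemma chart_common (z z' : S) (p : {poly k}) : p != 0 ->
  exists l, [/\ p.[l] != 0, chart_dom l z & chart_dom l z'].
Proof.
move=> p0.
have d_neq0 (y : S) : (dir1 y)%:P - dir2 y *: 'X != 0.
  apply/eqP => h; have /= := congr1 (horner^~ 0) h; have /= := congr1 (horner^~ 1) h.
  rewrite !hornerE subr0 => h2 h1; move/eqP: h2; rewrite h1 sub0r oppr_eq0 => /eqP h2.
  have [u [r [s [e hy]]]] := surface_coords w2 y; have [d d0 [e1 e2]] := dir_coords hy.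
  have := blow_coords_dir w2 hy; move: h1 h2; rewrite e1 e2 => /eqP + /eqP.
  by rewrite !mulf_eq0 (negPf d0) /= => -> ->.
have [l] := poly_avoid (mulf_neq0 p0 (mulf_neq0 (d_neq0 z) (d_neq0 z'))).
rewrite !hornerM !mulf_eq0 !negb_or => /and3P[pl]; rewrite !hornerE => h h'.
by exists l; rewrite /chart_dom /= ![l * _]mulrC.
Qed.

Lemma chart_change l m (z : S) : chart_dom l z ->
  chart_dom m z <-> 1 + (l - m) * chart l z != 0.
Proof.
rewrite /chart_dom /chart /= => h.
have -> : 1 + (l - m) * (dir2 z / (dir1 z - l * dir2 z)) =
  (dir1 z - m * dir2 z) / (dir1 z - l * dir2 z) by field.
by rewrite mulf_eq0 invr_eq0 (negPf h) orbF.
Qed.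

Lemma chart_changeE l m (z : S) : chart_dom l z -> chart_dom m z ->
  chart m z = chart l z / (1 + (l - m) * chart l z).
Proof.
move=> hl /[dup] hm /(chart_change m hl) h; move: hl hm h.
rewrite /chart_dom /chart /= => hl hm h; field.
have -> : dir1 z - l * dir2 z + (l - m) * dir2 z = dir1 z - m * dir2 z by ring.
by rewrite hl hm.
Qed.

Lemma hpt_affine y d (x : k) : hpt (y + x *: d) = hpt y + x *: (hpt d - hpt 0).
Proof.
rewrite !hptE -mulmxBl scalemxAl -mulmxDl opp_row_mx add_row_mx scale_row_mx.
by rewrite add_row_mx subrr subr0 scaler0 addr0.
Qed.

Lemma co_affine y d (x : k) :
  [/\ co0 (y + x *: d) = co0 y + x * (co0 d - co0 0),
      co1 (y + x *: d) = co1 y + x * (co1 d - co1 0)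
    & co2 (y + x *: d) = co2 y + x * (co2 d - co2 0)].
Proof.
by rewrite /co0 /co1 /co2 hpt_affine /four0 /four1 /four2 !mxE; split; field.
Qed.

End Charts.

(** * Unramified covers defined by the net of cubics *)

(** What the rest of the argument uses of F : S -> k^2. The points of S are the
    pairs of a point y of k^2 and a simple root (s : e) of the binary cubic with
    coefficients C(y) = (C0 y, C1 y, C2 y), where C identifies k^2 with the plane
    L0 C0 + L1 C1 + L2 C2 = 1 with inverse Cinv; the map T l is the coordinate
    e / (s - l e) of the root, defined on the open set dom l. *)
Record cubic_cover (k : numClosedFieldType) (S : kspace k)
    (F : S -> affine_space k 2) := CubicCover {
  C0 : 'rV[k]_2 -> k; C1 : 'rV[k]_2 -> k; C2 : 'rV[k]_2 -> k;
  L0 : k; L1 : k; L2 : k; Cinv : k -> k -> k -> 'rV[k]_2;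
  dom : k -> set S; T : k -> S -> k;
  C_affine : forall y d x, [/\ C0 (y + x *: d) = C0 y + x * (C0 d - C0 0),
    C1 (y + x *: d) = C1 y + x * (C1 d - C1 0)
    & C2 (y + x *: d) = C2 y + x * (C2 d - C2 0)];
  C_regular : forall (X : kspace k) x (f : X -> 'rV[k]_2),
    (forall i, regular_at x (fun y => f y 0 i)) ->
    [/\ regular_at x (fun y => C0 (f y)), regular_at x (fun y => C1 (f y))
      & regular_at x (fun y => C2 (f y))];
  C_line : forall y, L0 * C0 y + L1 * C1 y + L2 * C2 y = 1;
  Cinv_regular : forall (X : kspace k) (x : X) (f0 f1 f2 : X -> k) i,
    regular_at x f0 -> regular_at x f1 -> regular_at x f2 ->
    regular_at x (fun y => Cinv (f0 y) (f1 y) (f2 y) 0 i);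
  CinvK : forall c0 c1 c2, L0 * c0 + L1 * c1 + L2 * c2 = 1 ->
    [/\ C0 (Cinv c0 c1 c2) = c0, C1 (Cinv c0 c1 c2) = c1
      & C2 (Cinv c0 c1 c2) = c2];
  T_root : forall l z, dom l z ->
    cub l (C0 (F z)) (C1 (F z)) (C2 (F z)) (T l z) = 0 /\
    dcub l (C0 (F z)) (C1 (F z)) (C2 (F z)) (T l z) != 0;
  T_inj : forall l z z', dom l z -> dom l z' ->
    F z = F z' -> T l z = T l z' -> z = z';
  T_surj : forall l y t, cub l (C0 y) (C1 y) (C2 y) t = 0 ->
    dcub l (C0 y) (C1 y) (C2 y) t != 0 ->
    exists z, [/\ dom l z, F z = y & T l z = t];
  T_regular : forall l z, dom l z -> regular_at z (T l) /\ znbhs z (dom l);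
  morph_at_T : forall (X : kspace k) (g : X -> S) l x,
    znbhs x [set y | dom l (g y)] -> regular_at x (fun y => T l (g y)) ->
    (forall i, regular_at x (fun y => F (g y) 0 i)) -> morph_at g x;
  cover_morph : forall z, morph_at F z;
  dom_common : forall z z' (p : {poly k}), p != 0 ->
    exists l, [/\ p.[l] != 0, dom l z & dom l z'];
  dom_change : forall l m z, dom l z -> dom m z <-> 1 + (l - m) * T l z != 0;
  T_change : forall l m z, dom l z -> dom m z ->
    T m z = T l z / (1 + (l - m) * T l z)
}.

Lemma kulikov_cubic_cover (k : numClosedFieldType) (a : 'rV[k]_3)
    (F : kulikov_surface a -> affine_space k 2) (w : k) :
    w ^+ 2 = - w - 1 -> kulikov_morphism F ->
  exists K : cubic_cover F, [/\ L0 K = line_form a (unfour w 1 0 0),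
    L1 K = line_form a (unfour w 0 1 0) & L2 K = line_form a (unfour w 0 0 1)].
Proof.
move=> w2 [Phi [Pm PQ [M [Mu Mr FE]]]].
unshelve eexists.
  apply: (@CubicCover k _ F (co0 M) (co1 w M) (co2 w M)
    (line_form a (unfour w 1 0 0)) (line_form a (unfour w 0 1 0))
    (line_form a (unfour w 0 0 1)) (co_inv w M)
    (@chart_dom k w a) (@chart k w a)).
  - exact: co_affine.
  - exact: regular_co.
  - by move=> y; rewrite -line_form_unfour (line_form_co w2 Mu Mr).
  - exact: regular_co_inv.
  - by move=> c0 c1 c2; rewrite -line_form_unfour; apply: (co_invK w2 Mu Mr).
  - exact: (chart_root w2 Pm PQ Mu Mr FE).
  - exact: (chart_inj w2 Pm PQ Mu Mr FE).
  - exact: (chart_surj w2 Pm PQ Mu Mr FE).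
  - exact: regular_chart.
  - exact: (morph_at_chart w2 Pm PQ Mu Mr FE).
  - exact: (F_morph Pm FE).
  - exact: chart_common.
  - exact: chart_change.
  - exact: chart_changeE.
by [].
Qed.

(** ** Polynomial lemmas *)

Section HomogeneousCombinations.
Variable k : fieldType.
Implicit Types (A B P : {poly k}) (Ps : seq {poly k}).

(** The homogenization of the polynomial in A / B with coefficients Ps *)
Fixpoint hcomb A B Ps : {poly k} :=
  if Ps is P :: Ps' then P * B ^+ size Ps' + A * hcomb A B Ps' else 0.

Lemma horner_hcomb A B Ps x : B.[x] != 0 ->
  (hcomb A B Ps).[x] * B.[x] = B.[x] ^+ size Ps *
    \sum_(j < size Ps) (nth 0 Ps j).[x] * (A.[x] / B.[x]) ^+ j.
Proof.
move=> Bx; elim: Ps => [|P Ps IHPs]; first by rewrite big_ord0 horner0 mul0r mulr0.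
rewrite /= big_ord_recl /= expr0 mulr1 !hornerE.
under eq_bigr => j _ do rewrite /bump /= add1n exprS mulrCA.
rewrite -big_distrr /= mulrDl mulrDr -[A.[x] * _ * B.[x]]mulrA IHPs exprS.
by congr (_ + _); [ring|field].
Qed.

(** A is prime to B and has larger degree than the coefficients, so reduction
    modulo A kills them one after the other. *)
Lemma hcomb_eq0 A B Ps : coprimep A B ->
    (forall P, P \in Ps -> (size P < size A)%N) -> hcomb A B Ps = 0 ->
  forall P, P \in Ps -> P = 0.
Proof.
move=> AB; have A0 : (exists P, P \in Ps) -> (forall P,
  P \in Ps -> (size P < size A)%N) -> A != 0.
  by move=> [P hP] /(_ P hP); rewrite -size_poly_gt0; apply: leq_ltn_trans.
elim: Ps A0 => [//|P Ps IHPs] A0 szPs h0.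
have {}A0 : A != 0 by apply: A0 => //; exists P; rewrite inE eqxx.
have P0 : P = 0.
  apply/eqP; apply: contraTT (szPs P (mem_head _ _)) => P0; rewrite -leqNgt.
  apply: dvdp_leq => //; rewrite -(Gauss_dvdpl _ (coprimep_expr (size Ps) AB)).
  have -> : P * B ^+ size Ps = - (A * hcomb A B Ps).
    by apply/eqP; rewrite -addr_eq0; apply/eqP.
  by rewrite dvdpNr dvdp_mulIl.
move=> Q; rewrite inE => /orP[/eqP->//|hQ].
apply: IHPs hQ; first by [].
  by move=> Q' hQ'; apply: szPs; rewrite inE hQ' orbT.
move/eqP: h0; rewrite /= P0 mul0r add0r mulf_eq0 (negPf A0) /=.
by move/eqP.
Qed.

Lemma regular_line_frac_common n (h : 'I_n -> affine_line k -> k) (x : affine_line k) :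
    (forall i, regular_at x (h i)) ->
  exists (N : 'I_n -> {poly k}) (D : {poly k}), D.[x] != 0 /\
    forall i y, D.[y] != 0 -> h i y = (N i).[y] / D.[y].
Proof.
move=> rh; have fr i := cid (regular_line_frac (rh i)).
pose N i := projT1 (fr i); have frD i := cid (projT2 (fr i)).
pose D i := projT1 (frD i).
have hD i : (D i).[x] != 0 /\
    forall y, (D i).[y] != 0 -> h i y = (N i).[y] / (D i).[y].
  exact: projT2 (frD i).
exists (fun i => N i * \prod_(j | j != i) D j), (\prod_j D j); split.
  by rewrite horner_prod; apply/prodf_neq0 => i _; case: (hD i).
move=> i y; rewrite (bigD1 i) //= hornerM mulf_eq0 negb_or => /andP[Di Dj].
by rewrite (hD i).2 // hornerM -mulf_div divff // mulr1.
Qed.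

End HomogeneousCombinations.

Lemma poly_eq0_off (k : numFieldType) (p E : {poly k}) :
  E != 0 -> (forall x, E.[x] != 0 -> p.[x] = 0) -> p = 0.
Proof.
move=> E0 pE; suff /eqP : p * E = 0 by rewrite mulf_eq0 (negPf E0) orbF => /eqP.
apply: poly_fun_eq0 => x; rewrite hornerM.
by have [->|/pE->] := eqVneq E.[x] 0; rewrite ?mulr0 ?mul0r.
Qed.

Lemma horner_neq0 (k : nzRingType) (p : {poly k}) x : p.[x] != 0 -> p != 0.
Proof. by apply: contraNneq => ->; rewrite horner0. Qed.

Lemma linear_poly_neq0 (k : nzRingType) (c d : k) :
  (c != 0) || (d != 0) -> c%:P + d *: 'X != 0.
Proof.
case/orP => h; apply/eqP => /polyP h0.
  by have := h0 0%N; rewrite coefD coefC coefZ coefX coef0 mulr0 addr0 => /eqP;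
    rewrite (negPf h).
by have := h0 1%N; rewrite coefD coefC coefZ coefX coef0 mulr1 add0r => /eqP;
  rewrite (negPf h).
Qed.

Lemma horner_linear (k : comNzRingType) (c d x : k) :
  (c%:P + d *: 'X).[x] = c + x * d.
Proof. by rewrite !hornerE mulrC. Qed.

(** ** Curves in a cubic cover *)

Definition cubp (k : comNzRingType) (l c0 c1 c2 : k) : {poly k} :=
  (cub0 l c0 c1 c2)%:P + cub1 l c0 c1 c2 *: 'X + cub2 l c0 c1 c2 *: 'X^2
  + cub3 l c0 c1 c2 *: 'X^3.

Lemma horner_cubp (k : comNzRingType) (l c0 c1 c2 x : k) :
  (cubp l c0 c1 c2).[x] = cub l c0 c1 c2 x.
Proof. by rewrite /cubp /cub !hornerE. Qed.

Lemma size_cubp (k : idomainType) (l c0 c1 c2 : k) :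
  cub3 l c0 c1 c2 != 0 -> size (cubp l c0 c1 c2) = 4.
Proof.
move=> h; rewrite /cubp addrC size_polyDl size_scale ?size_polyXn //.
rewrite ltnS; apply/leq_sizeP => -[|[|[|j]]] // _.
by rewrite !coefD coefC !coefZ coefX coefXn /= !mulr0 !addr0.
Qed.

Section CoverTheory.
Variables (k : numClosedFieldType) (S : kspace k) (F : S -> affine_space k 2).
Variable K : cubic_cover F.

Local Notation C0 := (C0 K).
Local Notation C1 := (C1 K).
Local Notation C2 := (C2 K).
Local Notation dom := (dom K).
Local Notation T := (T K).

Definition cub_at l y t := cub l (C0 y) (C1 y) (C2 y) t.
Definition dcub_at l y t := dcub l (C0 y) (C1 y) (C2 y) t.
Definition cub_dir l d t := cub l (C0 d - C0 0) (C1 d - C1 0) (C2 d - C2 0) t.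
Definition cubp_at l y := cubp l (C0 y) (C1 y) (C2 y).
Definition cubp_dir l d := cubp l (C0 d - C0 0) (C1 d - C1 0) (C2 d - C2 0).

Lemma cub_at_affine l y d x t :
  cub_at l (y + x *: d) t = cub_at l y t + x * cub_dir l d t.
Proof.
by rewrite /cub_at /cub_dir; have [-> -> ->] := C_affine K y d x; rewrite !cubE; ring.
Qed.

Lemma cub_dir_affine l e d x t :
  cub_dir l (e + x *: d) t = cub_dir l e t + x * cub_dir l d t.
Proof.
by rewrite /cub_dir; have [-> -> ->] := C_affine K e d x; rewrite !cubE; ring.
Qed.

(** Otherwise t would be a root of every member of the net. *)
Lemma cub_dir_neq0 l y t : cub_at l y t = 0 -> exists d, cub_dir l d t != 0.
Proof.
move=> y0; apply/not_existsP => hd.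
have {}hd y' : cub_at l y' t = 0.
  have -> : y' = y + 1 *: (y' - y) by rewrite scale1r addrC subrK.
  by rewrite cub_at_affine y0 add0r mul1r; apply/eqP/negP => /negP/hd.
pose f c0 c1 c2 := cub l c0 c1 c2 t.
have f0 c0 c1 c2 : f c0 c1 c2 = 0.
  pose x := 1 - (L0 K * c0 + L1 K * c1 + L2 K * c2).
  have [|e0 e1 e2] := @CinvK _ _ _ K (c0 + x * C0 0) (c1 + x * C1 0) (c2 + x * C2 0).
    have := C_line K 0; rewrite /x => h.
    transitivity (L0 K * c0 + L1 K * c1 + L2 K * c2 +
      (1 - (L0 K * c0 + L1 K * c1 + L2 K * c2)) *
      (L0 K * C0 0 + L1 K * C1 0 + L2 K * C2 0)); first by ring.
    by rewrite h; ring.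
  have := hd (Cinv K (c0 + x * C0 0) (c1 + x * C1 0) (c2 + x * C2 0)); have := hd 0;
    rewrite /cub_at e0 e1 e2 -/(f _ _ _) -/(f _ _ _).
  rewrite /f !cubE => h0 h1; rewrite -[RHS]h1 -[LHS]addr0 -[X in _ + X](mulr0 x) -h0.
  by ring.
have t0 : t = 0.
  have := f0 0 0 1; have := f0 0 1 0; have := f0 1 0 0; rewrite /f !cubE.
  move=> h1 h2 h3; apply/eqP/negPn/negP => tn0.
  have n3 : 3 != 0 :> k by rewrite pnatr_eq0.
  have s0 : 1 + l * t = 0.
    apply: (mulfI n3); apply: (mulIf (expf_neq0 2 tn0)).
    by rewrite mulr0 mul0r -h2; ring.
  move: h1; rewrite s0 => h1.
  have t3 : t ^+ 3 = 0 by rewrite -[RHS]oppr0 -h1; ring.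
  by have := expf_neq0 3 tn0; rewrite t3 eqxx.
have := f0 1 0 0; rewrite /f cubE t0 => h.
have : (1 : k) = 0 by rewrite -h; ring.
by move/eqP; rewrite oner_eq0.
Qed.

Lemma cub_dir_avoid l (ts : seq k) : (forall t, t \in ts -> exists d,
  cub_dir l d t != 0) ->
  exists d, forall t, t \in ts -> cub_dir l d t != 0.
Proof.
elim: ts => [|t ts IHts] hts; first by exists 0.
have [d hd] : exists d, forall t, t \in ts -> cub_dir l d t != 0.
  by apply: IHts => t' ht'; apply: hts; rewrite inE ht' orbT.
have [e he] := hts t (mem_head _ _).
pose p : {poly k} := \prod_(t' <- t :: ts) ((cub_dir l d t')%:P + cub_dir l e t' *: 'X).
have [|x hx] := @poly_avoid _ p.
  rewrite /p prodf_seq_neq0; apply/allP => t'; rewrite inE => /orP[/eqP->|ht'].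
    by rewrite linear_poly_neq0 ?he ?orbT.
  by rewrite linear_poly_neq0 ?hd.
exists (d + x *: e) => t' ht'; move: hx; rewrite /p horner_prod.
rewrite prodf_seq_neq0 => /allP/(_ t' ht') /=.
by rewrite horner_linear cub_dir_affine.
Qed.

Lemma regular_cub (X : kspace k) x l (y : X -> 'rV[k]_2) (t : X -> k) :
    (forall i, regular_at x (fun x => y x 0 i)) -> regular_at x t ->
  regular_at x (fun x => cub_at l (y x) (t x)) /\
  regular_at x (fun x => dcub_at l (y x) (t x)).
Proof.
move=> ry rt; have [r0 r1 r2] := C_regular K ry.
rewrite /cub_at /dcub_at /cub /dcub /cub0 /cub1 /cub2 /cub3.
by split; do ?[exact: regular_at_cst|exact: r0|exact: r1|exact: r2|exact: rt
  |apply: regular_sub|apply: regular_add|apply: regular_mul|apply: regular_exp].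
Qed.

(** A map to S is given by its two components. *)
Lemma cover_map (X : kspace k) (x0 : X) l (y : X -> 'rV[k]_2) (t : X -> k) :
    (forall i, regular_at x0 (fun x => y x 0 i)) -> regular_at x0 t ->
    znbhs x0 [set x | cub_at l (y x) (t x) = 0] ->
    dcub_at l (y x0) (t x0) != 0 ->
  exists g : X -> S, morph_at g x0 /\
    znbhs x0 [set x | [/\ dom l (g x), F (g x) = y x & T l (g x) = t x]].
Proof.
move=> ry rt h0 d0.
have [z0 _] := T_surj (znbhs_self h0) d0.
have [g hg] := choose_map z0 (fun x z => [/\ dom l z, F z = y x & T l z = t x]).
have ng : znbhs x0 [set x | [/\ dom l (g x), F (g x) = y x & T l (g x) = t x]].
  apply: znbhsS (znbhsI h0 (regular_neq0 (regular_cub l ry rt).2 d0)) _ => x [cx dx].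
  by apply: hg; apply: T_surj.
exists g; split=> //; apply: (@morph_at_T _ _ _ K _ _ l).
- by apply: znbhsS ng _ => x [].
- by apply: eq_regular rt; apply: znbhsS ng _ => x [_ _ /= ->].
- by move=> i; apply: eq_regular (ry i); apply: znbhsS ng _ => x [_ /= -> _].
Qed.

(** ** Irreducibility *)

(** Two points (y1, t1), (y2, t2) lie on a rational curve: their segment is
    corrected in a direction d so as to stay on S. *)
Lemma cover_irreducible (z1 z2 : S) N1 N2 :
  znbhs z1 N1 -> znbhs z2 N2 -> exists z, N1 z /\ N2 z.
Proof.
move=> n1 n2; have [l [_ dl1 dl2]] := dom_common K z1 z2 (oner_neq0 {poly k}).
have [r1 s1] := T_root dl1; have [r2 s2] := T_root dl2.
have [|d hd] := @cub_dir_avoid l [:: T l z1; T l z2].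
  by move=> t; rewrite !inE => /orP[]/eqP->;
    [apply: cub_dir_neq0 r1|apply: cub_dir_neq0 r2].
have hd1 : cub_dir l d (T l z1) != 0 by apply: hd; rewrite mem_head.
have hd2 : cub_dir l d (T l z2) != 0 by apply: hd; rewrite !inE eqxx orbT.
pose t (x : affine_line k) := T l z1 + x * (T l z2 - T l z1).
pose y0 (x : affine_line k) := F z1 + x *: (F z2 - F z1).
pose c (x : affine_line k) := - (cub_at l (y0 x) (t x) / cub_dir l d (t x)).
pose y x := y0 x + c x *: d.
have t0 : t 0 = T l z1 by rewrite /t mul0r addr0.
have t1 : t 1 = T l z2 by rewrite /t mul1r addrC subrK.
have y00 : y0 0 = F z1 by rewrite /y0 scale0r addr0.
have y01 : y0 1 = F z2 by rewrite /y0 scale1r addrC subrK.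
have y_0 : y 0 = F z1 by rewrite /y /c y00 t0 [cub_at _ _ _]r1 mul0r oppr0 scale0r addr0.
have y_1 : y 1 = F z2 by rewrite /y /c y01 t1 [cub_at _ _ _]r2 mul0r oppr0 scale0r addr0.
have cst (x : affine_line k) a : regular_at x (fun=> a) by exact: regular_at_cst.
have rt x : regular_at x t.
  by apply: regular_add => //; apply: regular_mul => //; apply: regular_line.
have ry0 x i : regular_at x (fun x => y0 x 0 i).
  under eq_fun do rewrite mxE scale_rowE.
  by apply: regular_add => //; apply: regular_mul => //; apply: regular_line.
have rd x : regular_at x (fun x => cub_dir l d (t x)).
  under eq_fun do rewrite /cub_dir -horner_cubp; exact: regular_horner.
have ry x i : cub_dir l d (t x) != 0 -> regular_at x (fun x => y x 0 i).
  move=> h; under eq_fun do rewrite mxE scale_rowE.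
  apply: regular_add => //; apply: regular_mul => //; apply: regular_opp.
  by apply: regular_div => //; apply: (regular_cub l (ry0 x) (rt x)).1.
have on_S x : cub_dir l d (t x) != 0 -> cub_at l (y x) (t x) = 0.
  by move=> h; rewrite /y cub_at_affine /c mulNr divfK // subrr.
have nS (x : affine_line k) : cub_dir l d (t x) != 0 ->
    znbhs x [set x | cub_at l (y x) (t x) = 0].
  by move=> h; apply: znbhsS (regular_neq0 (rd x) h) _ => x' /= /on_S.
have h0 : cub_dir l d (t 0) != 0 by rewrite t0.
have h1 : cub_dir l d (t 1) != 0 by rewrite t1.
have [|g0 [m0 ng0]] := cover_map (fun i => ry 0 i h0) (rt 0) (nS 0 h0).
  by rewrite y_0 t0.
have [|g1 [m1 ng1]] := cover_map (fun i => ry 1 i h1) (rt 1) (nS 1 h1).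
  by rewrite y_1 t1.
have g0E : g0 0 = z1.
  have [dz Fz Tz] := znbhs_self ng0.
  by apply: (T_inj dz dl1); rewrite ?Fz ?Tz.
have g1E : g1 1 = z2.
  have [dz Fz Tz] := znbhs_self ng1.
  by apply: (T_inj dz dl2); rewrite ?Fz ?Tz.
have n1' : znbhs (0 : affine_line k) (g0 @^-1` N1) by apply: m0.1; rewrite g0E.
have n2' : znbhs (1 : affine_line k) (g1 @^-1` N2) by apply: m1.1; rewrite g1E.
have [D0 D00 hD0] := (znbhs_line _ _).1 (znbhsI n1' ng0).
have [D1 D10 hD1] := (znbhs_line _ _).1 (znbhsI n2' ng1).
have [x] := poly_avoid (mulf_neq0 (horner_neq0 D00) (horner_neq0 D10)).
rewrite hornerM mulf_eq0 negb_or => /andP[/hD0[N1x [da Fa Ta]] /hD1[N2x [db Fb Tb]]].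
exists (g0 x); split=> //.
suff -> : g0 x = g1 x by [].
by apply: (T_inj da db); rewrite ?Fa ?Ta.
Qed.

Lemma zgeneric_open (z : S) (U : set S) : zopen U -> U z -> @zgeneric k S U.
Proof.
move=> oU Uz; exists U; split=> //; apply/seteqP; split=> // y _ N nN.
by have [x [Nx Ux]] := cover_irreducible nN (oU _ Uz); exists x.
Qed.

Lemma zgeneric_meets (z : S) (U D : set S) : znbhs z U -> @zgeneric k S D ->
  exists y, U y /\ D y.
Proof.
move=> nU [V [oV dV VD]]; have : zclosure V z by rewrite dV.
by move=> /(_ U nU)[y [Uy /VD Dy]]; exists y.
Qed.

End CoverTheory.

(** * The suspension is etale *)

Section Suspension.
Variables (k : numClosedFieldType) (S : kspace k) (F : S -> affine_space k 2).
Variable K : cubic_cover F.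
Variable p : S -> k.
Hypothesis p_regular : is_regular p.

Local Notation C0 := (C0 K).
Local Notation C1 := (C1 K).
Local Notation C2 := (C2 K).
Local Notation dom := (dom K).
Local Notation T := (T K).
Local Notation X := (prod_space (affine_line k) S).
Local Notation Y := (affine_space k (1 + 2)).

Definition susp : X -> Y := suspension p F.

Lemma suspE (z : X) : susp z = row_mx (const_mx (z.1 + p z.2)) (F z.2).
Proof. by []. Qed.

Lemma susp_morph (z : X) : morph_at susp z.
Proof.
apply: morph_at_affine => i.
have mp : regular_at z (fun y : X => p y.2).
  exact: ((morph_at_snd z).2 _ (p_regular z.2)).
have mF j : regular_at z (fun y : X => F y.2 0 j).
  apply: ((morph_at_snd z).2 (fun y => F y 0 j)).
  exact: ((cover_morph K z.2).2 _ (regular_affine _ j)).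
have m1 : regular_at z (fun y : X => y.1 : k).
  exact: ((morph_at_fst z).2 _ (regular_line _)).
case: (split_ordP i) => j ->.
  have -> : (fun y => susp y 0 (lshift 2 j)) = fun y : X => y.1 + p y.2.
    by apply/funext => y; rewrite suspE row_mxEl mxE.
  exact: regular_add.
have -> : (fun y => susp y 0 (rshift 1 j)) = fun y : X => F y.2 0 j.
  by apply/funext => y; rewrite suspE row_mxEr.
exact: mF.
Qed.

Lemma morph_at_affine_line n (v d : 'rV[k]_n) (x : affine_line k) :
  morph_at (fun x : affine_line k => v + x *: d : affine_space k n) x.
Proof.
apply: morph_at_affine => i; under eq_fun do rewrite mxE scale_rowE.
by apply: regular_add; [|apply: regular_mul; [apply: regular_line|]];
  apply: regular_at_cst.
Qed.

(** ** Directions transverse to the branches *)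

Definition transversal l y d := coprimep (cubp_at K l y) (cubp_dir K l d).

Lemma transversalP l y d :
  transversal l y d <-> forall t, cub_at K l y t = 0 -> cub_dir K l d t != 0.
Proof.
rewrite /transversal; split=> [/Pdiv.ClosedField.coprimepP h t ht|h].
  by rewrite /cub_dir -horner_cubp; apply: h; rewrite /root horner_cubp; apply/eqP.
apply/Pdiv.ClosedField.coprimepP => t /rootP; rewrite horner_cubp => /h.
by rewrite /cub_dir -horner_cubp.
Qed.

Lemma cub_roots l y : cub3 l (C0 y) (C1 y) (C2 y) != 0 ->
  exists ts : seq k, forall t, t \in ts <-> cub_at K l y t = 0.
Proof.
move=> h3; have [ts tsE] := closed_field_poly_normal (cubp_at K l y).
exists ts => t; rewrite /cub_at -horner_cubp -root_prod_XsubC.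
rewrite -(@rootZ _ _ (lead_coef (cubp_at K l y))) -?tsE; first by split=> /rootP.
by rewrite lead_coef_eq0 -size_poly_eq0 size_cubp.
Qed.

Lemma transversal_exists l y : cub3 l (C0 y) (C1 y) (C2 y) != 0 ->
  exists d, transversal l y d.
Proof.
move=> /cub_roots[ts htsE]; have [|d hd] := @cub_dir_avoid _ _ _ K l ts.
  by move=> t /htsE; apply: cub_dir_neq0.
by exists d; apply/transversalP => t /htsE/hd.
Qed.

Lemma transversal_generic l y e d : cub3 l (C0 y) (C1 y) (C2 y) != 0 ->
    transversal l y d ->
  exists2 E : {poly k}, E != 0 & forall x, E.[x] != 0 -> transversal l y (e + x *: d).
Proof.
move=> /cub_roots[ts htsE] /transversalP hd.
exists (\prod_(t <- ts) ((cub_dir K l e t)%:P + cub_dir K l d t *: 'X)).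
  rewrite prodf_seq_neq0; apply/allP => t /htsE/hd h.
  by rewrite linear_poly_neq0 ?h ?orbT.
move=> x; rewrite horner_prod prodf_seq_neq0 => /allP h; apply/transversalP => t.
by move=> /htsE/h; rewrite horner_linear cub_dir_affine.
Qed.

(** ** Linear independence of 1, t, t^2 over the functions of susp z *)

Section Free.
Variables (z : X) (l : k).
Hypotheses (dz : dom l z.2) (z3 : cub3 l (C0 (F z.2)) (C1 (F z.2)) (C2 (F z.2)) != 0).
Variable c : 'I_3 -> Y -> k.
Hypotheses (c_regular : forall i, regular_at (susp z) (c i))
  (c_zero : znbhs z [set x : X | \sum_(i < 3) c i (susp x) * T l x.2 ^+ i = 0]).

(** Over a line through susp z in a transversal direction, S is a rational curve
    with parameter t, and the parameter of the line is a fraction of degree 3 of t. *)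
Lemma coef_zero_line (d : 'rV[k]_(1 + 2)) : transversal l (F z.2) (rsubmx d) ->
  forall i, znbhs (0 : affine_line k) [set x | c i (susp z + x *: d) = 0].
Proof.
move=> tr; have [r0 s0] := T_root dz.
pose t0 : affine_line k := T l z.2.
pose A := cubp_at K l (F z.2); pose B := cubp_dir K l (rsubmx d).
have A0 : A.[t0] = 0 by rewrite /A horner_cubp.
have B0 : B.[t0] != 0 by rewrite /B horner_cubp; apply: ((transversalP _ _ _).1 tr).
pose sg (x : affine_line k) : affine_line k := - A.[x] / B.[x].
have sg0 : sg t0 = 0 by rewrite /sg A0 oppr0 mul0r.
have rsg : regular_at t0 (sg : affine_line k -> k).
  apply: regular_div => //; first apply: regular_opp;
    exact: regular_horner (regular_line _).
pose y (x : affine_line k) := F z.2 + sg x *: rsubmx d.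
have ry i : regular_at t0 (fun x => y x 0 i).
  under eq_fun do rewrite mxE scale_rowE.
  by apply: regular_add; [|apply: regular_mul => //]; apply: regular_at_cst.
have rB : regular_at t0 (horner B) by exact: regular_horner (regular_line _).
have nB := regular_neq0 rB B0.
have [||g [mg ng]] := cover_map (K := K) (l := l) ry (regular_line t0).
- apply: znbhsS nB _ => x /= Bx; rewrite /y cub_at_affine /sg.
  by rewrite /cub_at /cub_dir -!horner_cubp divfK // addrN.
- by rewrite /y sg0 scale0r addr0.
have g0 : g t0 = z.2.
  have [dg Fg Tg] := znbhs_self ng.
  by apply: (T_inj dg dz); rewrite ?Fg ?Tg // /y sg0 scale0r addr0.
pose a (x : affine_line k) : affine_line k :=
  (susp z + sg x *: d) 0 (lshift 2 0) - p (g x).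
have ra : regular_at t0 (a : affine_line k -> k).
  apply: regular_sub; last exact: (mg.2 _ (p_regular _)).
  under eq_fun do rewrite mxE scale_rowE.
  by apply: regular_add; [|apply: regular_mul => //]; apply: regular_at_cst.
pose gg (x : affine_line k) : X := (a x, g x).
have mgg : morph_at gg t0 by apply: morph_at_pair => //; apply: morph_at_line.
have gg0 : gg t0 = z.
  rewrite /gg g0 /a sg0 scale0r addr0 g0 suspE row_mxEl mxE.
  by rewrite addrK; case: (z).
have susp_gg x : F (g x) = y x -> susp (gg x) = susp z + sg x *: d.
  move=> Fg; rewrite suspE /= Fg -[RHS]hsubmxK; congr row_mx.
    by apply/rowP => i; rewrite ord1 [LHS]mxE [RHS]mxE /= subrK.
  by rewrite linearD linearZ /= suspE row_mxKr.
have rh i : regular_at (0 : affine_line k) (fun x => c i (susp z + x *: d)).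
  have := (morph_at_affine_line (susp z) d 0).2 (c i).
  by apply; rewrite scale0r addr0.
have [N [D [D0 hD]]] := regular_line_frac_common rh.
have rD : regular_at t0 (fun x => D.[sg x]) by exact: regular_horner.
have nD : znbhs t0 [set x | D.[sg x] != 0] by apply: regular_neq0; rewrite ?sg0.
have nc : znbhs t0 (gg @^-1` [set x : X | \sum_(i < 3) c i (susp x) * T l x.2 ^+ i = 0]).
  by apply: mgg.1; rewrite gg0.
have [E E0 hE] := (znbhs_line _ _).1 (znbhsI nB (znbhsI nc (znbhsI nD ng))).
pose m := \max_(i < 3) size (N i).
have szN i : (size (N i) <= m)%N by exact: (leq_bigmax (F := fun i => size (N i))).
pose P j : {poly k} := \sum_(i < 3) (N i)`_j *: 'X^i.
have szP j : (size (P j) < 4)%N.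
  rewrite ltnS (leq_trans (size_sum _ _ _)) //; apply/bigmax_leqP => i _.
  by rewrite (leq_trans (size_scale_leq _ _)) // size_polyXn.
have comb0 : hcomb (- A) B (mkseq P m) = 0.
  apply: (poly_eq0_off (horner_neq0 E0)) => x /hE[/= Bx [cx [Dx [dx Fx Tx]]]].
  apply: (mulIf Bx); rewrite mul0r horner_hcomb // size_mkseq.
  suff -> : \sum_(j < m) (nth 0 (mkseq P m) j).[x] * ((- A).[x] / B.[x]) ^+ j = 0.
    by rewrite mulr0.
  transitivity (\sum_(i < 3) (N i).[sg x] * x ^+ i).
    under eq_bigr => j _ do rewrite nth_mkseq // /P horner_sum big_distrl /=.
    rewrite exchange_big; apply: eq_bigr => i _ /=.
    rewrite (horner_coef_wide _ (szN i)) big_distrl /=; apply: eq_bigr => j _.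
    by rewrite hornerZ hornerXn hornerN /sg mulrAC.
  apply: (mulIf (invr_neq0 Dx)); rewrite mul0r big_distrl -[RHS]cx /=.
  by apply: eq_bigr => i _; rewrite susp_gg // hD // Tx mulrAC.
have coprimeNA : coprimep (- A) B by rewrite -scaleN1r coprimepZl // oppr_eq0 oner_eq0.
have P0 j : (j < m)%N -> P j = 0.
  move=> jm; apply: (hcomb_eq0 coprimeNA _ comb0); last first.
    by rewrite -(nth_mkseq 0 P jm) mem_nth // size_mkseq.
  by move=> _ /mapP[i _ ->]; rewrite size_polyN /A size_cubp.
have N0 i : N i = 0.
  apply/polyP => j; rewrite coef0.
  case: (ltnP j m) => [jm|mj]; last first.
    by rewrite nth_default // (leq_trans (szN i)).
  have := congr1 (fun q : {poly k} => q`_i) (P0 j jm).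
  rewrite /P coef0 coef_sum (bigD1 i) //= coefZ coefXn eqxx mulr1 big1 ?addr0 //.
  by move=> i' ni; rewrite coefZ coefXn eq_sym (negPf (ni : (i' : nat) != i)) mulr0.
move=> i; apply/znbhs_line; exists D => // x Dx.
by rewrite /= hD // N0 horner0 mul0r.
Qed.

(** Lines through susp z in a transversal direction only fill a dense set: the
    coefficient vanishes at the other points by continuity along a line whose
    generic point is in that set. *)
Lemma coef_zero i : znbhs (susp z) [set y | c i y = 0].
Proof.
have [d0 hd0] := transversal_exists z3.
pose d : 'rV[k]_(1 + 2) := row_mx 0 d0.
have trd : transversal l (F z.2) (rsubmx d) by rewrite row_mxKr.
(* the value at y' of a coefficient that vanishes near susp z on the line to y' *)
have on_line y' : regular_at y' (c i) ->
    transversal l (F z.2) (rsubmx (y' - susp z)) -> c i y' = 0.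
  move=> ry' /coef_zero_line/(_ i)/znbhs_line[D Dx hD].
  pose h (x : affine_line k) := c i (susp z + x *: (y' - susp z)).
  have h1 : h 1 = c i y' by rewrite /h scale1r addrC subrK.
  rewrite -h1; apply: regular_line_eq0 (horner_neq0 Dx) hD.
  apply: (morph_at_affine_line (susp z) (y' - susp z) 1).2.
  by rewrite scale1r addrC subrK.
apply: znbhsS (regular_near (c_regular i)) _ => y' /= ry'.
have [E E0 hE] := transversal_generic (rsubmx (y' - susp z)) z3 trd.
pose h (x : affine_line k) := c i (y' + x *: d).
have h0 : h 0 = c i y' by rewrite /h scale0r addr0.
have rh0 : regular_at (0 : affine_line k) h.
  by apply: (morph_at_affine_line y' d 0).2; rewrite scale0r addr0.
have nr : znbhs (0 : affine_line k) [set x | regular_at (y' + x *: d : Y) (c i)].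
  have := (morph_at_affine_line y' d 0).1 [set y : Y | regular_at y (c i)].
  by apply; rewrite scale0r addr0; apply: regular_near.
have [D Dx hD] := (znbhs_line _ _).1 nr.
rewrite -h0; apply: (regular_line_eq0 rh0 (mulf_neq0 E0 (horner_neq0 Dx))) => x.
rewrite hornerM mulf_eq0 negb_or => /andP[/hE tr /hD rx].
apply: on_line => //; suff -> : y' + x *: d - susp z = (y' - susp z) + x *: d.
  by rewrite linearD linearZ.
by rewrite addrAC.
Qed.

End Free.

Lemma cub3_avoid y : exists2 q : {poly k}, q != 0 &
  forall l, q.[l] != 0 -> cub3 l (C0 y) (C1 y) (C2 y) != 0.
Proof.
exists ((- C0 y)%:P + (3 * C1 y) *: 'X + (- 3 * C2 y) *: 'X^2 + (C0 y) *: 'X^3).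
  have n3 : 3 != 0 :> k by rewrite pnatr_eq0.
  apply/eqP => /polyP h; have := h 0%N; have := h 1%N; have := h 2%N.
  rewrite !coef0 !coefD !coefC !coefZ !coefX !coefXn /= !mulr0 !mulr1 !addr0 !add0r.
  move=> h2 h1 h0; have := C_line K y.
  have -> : C0 y = 0 by apply/eqP; rewrite -oppr_eq0 h0.
  have -> : C1 y = 0 by apply: (mulfI n3); rewrite h1 mulr0.
  have n3' : - 3 != 0 :> k by rewrite oppr_eq0.
  have -> : C2 y = 0 by apply: (mulfI n3'); rewrite h2 mulr0.
  by rewrite !mulr0 !addr0 => /eqP; rewrite eq_sym oner_eq0.
move=> l; set q := (X in X.[l]).
have -> // : q.[l] = cub3 l (C0 y) (C1 y) (C2 y).
by rewrite /q !hornerE /cub3 /=; ring.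
Qed.

(** S with y and t as its only local coordinates *)
Definition cover_chart (l : k) : kspace k := @KSpace k S (fun U f =>
  (U = setT /\ exists i, f = fun z => F z 0 i) \/ (U = dom l /\ f = T l)).

(** By the universal property of S, regular functions on S are locally rational
    expressions in y and t. *)
Lemma cover_chart_morph l (z : S) : dom l z ->
  morph_at (id : cover_chart l -> S) z.
Proof.
move=> dz; apply: (@morph_at_T _ _ _ K _ _ l).
- apply: (@ratexp_znbhs _ (cover_chart l) z (dom l) (T l)).
  by apply: ratexp_coord => //; right.
- by apply: (@regular_coord _ (cover_chart l) z (dom l)) => //; right.
- move=> i; apply: (@regular_coord _ (cover_chart l) z setT) => //.
  by left; split=> //; exists i.
Qed.

(** At a point (x, z), the coordinate t of z satisfies a cubic equation over k^3,
    with simple root t(z), and generates everything: y and t are coordinates of S,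
    and the coordinate x is the difference of the first coordinate of susp (x, z)
    and p(z). *)
Theorem susp_etale : etale susp.
Proof.
split; first by move=> z; apply: susp_morph.
move=> z; have [q q0 hq] := cub3_avoid (F z.2).
have [l [/hq z3 dz _]] := dom_common K z.2 z.2 q0.
pose t (x : X) := T l x.2.
pose y (v : Y) : 'rV[k]_2 := rsubmx (v : 'rV_(1 + 2)).
have yE (x : X) : y (susp x) = F x.2 by rewrite /y suspE row_mxKr.
pose c3 v := cub3 l (C0 (y v)) (C1 (y v)) (C2 (y v)).
pose g (i : 'I_3) (v : Y) := - (match val i with
  | 0%N => cub0 l (C0 (y v)) (C1 (y v)) (C2 (y v))
  | 1%N => cub1 l (C0 (y v)) (C1 (y v)) (C2 (y v))
  | _ => cub2 l (C0 (y v)) (C1 (y v)) (C2 (y v)) end) / c3 v.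
have c3z : c3 (susp z) != 0 by rewrite /c3 yE.
have ry i : regular_at (susp z) (fun v : Y => y v 0 i).
  by under eq_fun do rewrite /y mxE; exact: regular_affine.
have [r0 r1 r2] := C_regular K ry.
have rc3 : regular_at (susp z) c3.
  rewrite /c3 /cub3.
  by do ?[exact: regular_at_cst|exact: r0|exact: r1|exact: r2
    |apply: regular_sub|apply: regular_add|apply: regular_mul].
have rg i : regular_at (susp z) (g i).
  apply: regular_div => //; apply: regular_opp.
  case: i => [[|[|i]]] hi /=; rewrite /cub0 /cub1 /cub2;
  by do ?[exact: regular_at_cst|exact: r0|exact: r1|exact: r2
    |apply: regular_sub|apply: regular_add|apply: regular_mul].
have [rt nt] : regular_at z t /\ znbhs z [set x : X | dom l x.2].
  have [rT nT] := T_regular dz.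
  split; [exact: ((morph_at_snd z).2 _ rT)|exact: ((morph_at_snd z).1 _ nT)].
have root_at (x : X) : dom l x.2 -> c3 (susp x) != 0 ->
    t x ^+ 3 = \sum_(i < 3) g i (susp x) * t x ^+ i.
  move=> dx c3x; rewrite sum3E /g /= /c3; move: c3x; rewrite /c3 !yE.
  have [] := T_root dx; rewrite /cub -/(t x).
  move: (cub0 _ _ _ _) (cub1 _ _ _ _) (cub2 _ _ _ _) (cub3 _ _ _ _) => b0 b1 b2 b3.
  move=> h _ b30; apply: (mulfI b30).
  transitivity (- (b0 + b1 * t x + b2 * t x ^+ 2)); last by field.
  by apply/eqP; rewrite -addr_eq0 addrC h.
have t_root : znbhs z [set x | t x ^+ 3 = \sum_(i < 3) g i (susp x) * t x ^+ i].
  have := (susp_morph z).1 _ (regular_neq0 rc3 c3z).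
  by move=> n3; apply: znbhsS (znbhsI nt n3) _ => x [dx c3x]; apply: root_at.
have mz := susp_morph z.
have t_free (c : 'I_3 -> Y -> k) : (forall i, regular_at (susp z) (c i)) ->
    znbhs z [set x | \sum_(i < 3) c i (susp x) * t x ^+ i = 0] ->
    forall i, znbhs (susp z) [set v | c i v = 0].
  by move=> rc nc i; apply: coef_zero nc _.
pose fr := fraction susp z 3 t.
have fr_comp h (rh : regular_at (susp z) h) : fr (h \o susp).
  exact: (fraction_comp mz rt rg t_root rh).
have fr_pull (W : kspace k) (u : X -> W) : morph_at u z ->
    (forall U h, loc_coord U h -> U (u z) -> fr (h \o u)) ->
    forall h, regular_at (u z) h -> fr (h \o u).
  exact: (fraction_pull mz rt rg t_root).
have fr_t : fr t by exact: (fraction_t mz rt rg t_root).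
have fr_F i : fr (fun x : X => F x.2 0 i).
  have := fr_comp _ (ry i); apply: eq_fraction.
  by apply: znbhsS (znbhsT z) _ => x _ /=; rewrite yE.
have fr_S h : regular_at z.2 h -> fr (fun x : X => h x.2).
  move=> rh; pose u (x : X) : cover_chart l := x.2.
  have mu : morph_at u z.
    apply: morph_at_coord => U f [[-> [i ->]]|[-> ->]] Uz.
      by split; [exact: znbhsT|have [] := fr_F i].
    by split; [exact: nt|exact: rt].
  apply: (fr_pull _ u mu); last exact: (cover_chart_morph dz).2 h rh.
  by move=> U f [[-> [i ->]]|[-> ->]] Uz; [exact: fr_F|exact: fr_t].
have fr_line : fr (fun x : X => x.1 : k).
  have r0' := @regular_affine k (1 + 2) (susp z) (lshift 2 0).
  have := fraction_add mz rt rg t_root (fr_comp _ r0')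
    (fraction_mul mz rt rg t_root (fraction_cst mz rt rg t_root (-1))
      (fr_S _ (p_regular z.2))).
  apply: eq_fraction; apply: znbhsS (znbhsT z) _ => x _ /=.
  by rewrite suspE row_mxEl mxE; ring.
have t_gen U h : loc_coord U h -> U z -> fr h.
  case=> -[V [f [lf -> ->]]] Vz; first by case: lf => _ ->; apply: fr_line.
  exact: fr_S (regular_coord lf Vz).
split; first exact: (standard_flat mz rt rg t_root t_free t_gen).
apply: (standard_unramified mz rt rg t_root t_gen).
have [_] := T_root dz; rewrite /dcub => d0.
rewrite sum3E /g /= expr0 expr1 /c3 yE -/(t z).
rewrite !derivE !hornerE /=.
move: d0 c3z; rewrite /c3 yE -/(t z).
move: (cub1 _ _ _ _) (cub2 _ _ _ _) (cub3 _ _ _ _) => b1 b2 b3 d0 b30.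
have -> : t z ^+ 2 + t z ^+ 2 + t z ^+ 2 - (- b1 / b3 + - b2 / b3 * (t z + t z)) =
  (b1 + 2 * b2 * t z + 3 * b3 * t z ^+ 2) / b3 by field.
by rewrite mulf_neq0 ?invr_eq0.
Qed.

End Suspension.

(** * Flatness over the image makes p injective on the fibres *)

Section Separation.
Variables (k : numClosedFieldType) (S : kspace k) (F : S -> affine_space k 2).
Variable K : cubic_cover F.
Variable p : S -> k.
Hypothesis p_regular : is_regular p.

Local Notation dom := (dom K).
Local Notation T := (T K).
Local Notation X := (prod_space (affine_line k) S).
Local Notation Y := (affine_space k (1 + 2)).

Let at0 (x : S) : X := (0, x).
Definition graph (x : S) : Y := susp F p (at0 x).

Lemma at0_morph x : morph_at at0 x.
Proof.
by apply: morph_at_pair; [apply: morph_at_line; apply: regular_at_cst|split].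
Qed.

Lemma graph_morph x : morph_at graph x.
Proof. exact: morph_at_comp (at0_morph x) (susp_morph K p_regular _). Qed.

Lemma graph0 x : graph x 0 (lshift 2 0) = p x.
Proof. by rewrite /graph suspE row_mxEl mxE add0r. Qed.

Lemma graphF x : rsubmx (graph x : 'rV_(1 + 2)) = F x.
Proof. by rewrite /graph suspE row_mxKr. Qed.

Lemma regular_generic_eq0 x (f : S -> k) : regular_at x f ->
  @zgeneric k S [set y | f y = 0] -> znbhs x [set y | f y = 0].
Proof.
move=> rf gf; apply: znbhsS (regular_near rf) _ => y /= ry; apply/eqP/negPn/negP => fy.
by have [y' [/= + fy']] := zgeneric_meets (regular_neq0 ry fy) gf; rewrite fy' eqxx.
Qed.

Lemma rsub_morph (v : Y) :
  morph_at (fun v : Y => rsubmx (v : 'rV_(1 + 2)) : affine_space k 2) v.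
Proof.
by apply: morph_at_affine => i; under eq_fun do rewrite mxE; apply: regular_affine.
Qed.

(** The morphism F is dominant, since otherwise 1 would be linearly dependent over
    the functions on k^2. *)
Lemma affine2_comp_nonzero (D : affine_space k 2 -> k) (x : S) (y : affine_space k 2) :
  is_regular D -> D y != 0 -> exists x', D (F x') != 0.
Proof.
move=> rD Dy; apply/not_existsP => hD.
have {}hD x' : D (F x') = 0 by apply/eqP/negP => /negP/hD.
have [q q0 hq] := cub3_avoid K (F x).
have [l [/hq x3 dx _]] := dom_common K x x q0.
pose c (i : 'I_3) (v : Y) := if i == 0 then D (rsubmx (v : 'rV_(1 + 2))) else 0.
have rc i : regular_at (susp F p (at0 x)) (c i).
  by rewrite /c; case: (i == 0); [apply: (rsub_morph _).2;
    apply: rD|apply: regular_at_cst].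
have nc : znbhs (at0 x)
    [set x' : X | \sum_(i < 3) c i (susp F p x') * T l x'.2 ^+ i = 0].
  apply: znbhsS (znbhsT _) _ => x' _ /=.
  by rewrite sum3E /c /= suspE row_mxKr hD !mul0r !addr0.
have nD := @coef_zero _ _ _ K p p_regular (at0 x) l dx x3 c rc nc 0.
pose y' : Y := row_mx (p x)%:M y : 'rV_(1 + 2).
have := (morph_at_affine_line (graph x) (y' - graph x) 0).1 [set v | c 0 v = 0].
rewrite scale0r addr0 => /(_ nD)/znbhs_line[E E0 hE].
case/eqP: Dy; pose h (s : affine_line k) := c 0 (graph x + s *: (y' - graph x)).
have -> : D y = h 1 by rewrite /h scale1r addrC subrK /c /= row_mxKr.
apply: (regular_line_eq0 (x := 1) _ (horner_neq0 E0) hE).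
apply: (morph_at_affine_line (graph x) (y' - graph x) 1).2.
by rewrite /c /=; apply: (rsub_morph _).2; apply: rD.
Qed.

(** The rational functions on S that are fractions of regular functions of
    (p, F) *)
Definition graph_fraction : {pred ratfun S} := fun u => `[< exists al be : Y -> k,
  [/\ is_regular al, is_regular be, @zgeneric k S [set x | be (graph x) != 0]
    & @zgeneric k S [set x | germ_fun u x * be (graph x) = al (graph x)]] >].

Lemma graph_fraction_subring : subring_closed graph_fraction.
Proof.
pose FS := zgeneric_filter S; split.
- apply/asboolP; exists (fun=> 1), (fun=> 1); split.
  + by move=> y; apply: regular_at_cst.
  + by move=> y; apply: regular_at_cst.
  + by apply: filterE => x; rewrite /= oner_neq0.
  + by apply: filterS (@germ_fun1 _ _ _ FS) => x /= h1; rewrite mulr1.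
- move=> u v /asboolP[al [be [ral rbe nbe hu]]] /asboolP[al' [be' [ral' rbe' nbe' hv]]].
  apply/asboolP; exists (fun y => al y * be' y - al' y * be y), (fun y => be y * be' y).
  split.
  + by move=> y; apply: regular_sub; apply: regular_mul.
  + by move=> y; apply: regular_mul.
  + by apply: filterS2 nbe nbe' => x ? ?; rewrite /= mulf_neq0.
  + apply: filterS3 (germ_funD u (- v)) (germ_funN v) (filterI hu hv).
    by move=> x /= -> -> [/= <- <-]; ring.
- move=> u v /asboolP[al [be [ral rbe nbe hu]]] /asboolP[al' [be' [ral' rbe' nbe' hv]]].
  apply/asboolP; exists (fun y => al y * al' y), (fun y => be y * be' y); split.
  + by move=> y; apply: regular_mul.
  + by move=> y; apply: regular_mul.
  + by apply: filterS2 nbe nbe' => x ? ?; rewrite /= mulf_neq0.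
  + by apply: filterS3 (germ_funM u v) hu hv => x /= -> <- <-; ring.
Qed.

Lemma graph_fraction_inv (u v : ratfun S) :
  u \in graph_fraction -> u * v = 1 -> v \in graph_fraction.
Proof.
pose FS := zgeneric_filter S.
move=> /asboolP[al [be [ral rbe nbe hu]]] uv.
have huv : @zgeneric k S [set x | germ_fun u x * germ_fun v x = 1].
  have h1 := @germ_fun1 _ _ _ FS; have := germ_funM u v; rewrite uv => hM.
  by apply: filterS2 h1 hM => x /= -> ->.
apply/asboolP; exists be, al; split=> //.
  apply: filterS3 nbe hu huv => x /= nb <- h1; rewrite mulf_neq0 //.
  by apply: contra_eq_neq h1 => ->; rewrite mul0r eq_sym oner_neq0.
by apply: filterS2 hu huv => x /= <- h1; rewrite mulrA [germ_fun v x * _]mulrC h1 mul1r.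
Qed.

Lemma graph_fraction_base (x : S) (u : ratfun (affine_space k 2)) :
  @ratfun_map k S _ F u \in graph_fraction.
Proof.
pose FS := zgeneric_filter S.
have [V [oV dV Vr]] := germ_fun_regular u.
have [y [_ /Vr ry]] : (setT `&` V) !=set0.
  have h : zclosure V (0 : affine_space k 2) by rewrite dV.
  exact: h (znbhsT _).
have [U [g [hg ug]]] := ry.
have [||||N [D [rN rD Dy hD]]] :=
  @ratexp_frac _ (affine_space k 2) (@is_regular k (affine_space k 2)) y U g _ _ _ _ hg.
- by move=> c v; apply: regular_at_cst.
- by move=> f h rf rh v; apply: regular_add.
- by move=> f h rf rh v; apply: regular_mul.
- by move=> U' f [-> [i ->]]; split=> // v; apply: regular_affine.
have [x0 Dx0] := affine2_comp_nonzero x rD Dy.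
have rDF x' : regular_at x' (D \o F) by apply: (cover_morph K x').2; apply: rD.
have gD : @zgeneric k S [set x | D (F x) != 0].
  by apply: (zgeneric_open K (z := x0)) => // x' Dx'; apply: regular_neq0 (rDF x') Dx'.
have uE : @zgeneric k S [set x | germ_fun (@ratfun_map k S _ F u) x = germ_fun u (F x)].
  apply: (@germ_funK _ _ _ FS (germ_fun u \o F)).
  apply: filterS gD => x' /= /hD[Ux' _]; apply: (cover_morph K x').2.
  by exists U, g; split=> //; apply: ratexp_near hg Ux'.
apply/asboolP; exists (fun v : Y => N (rsubmx (v : 'rV_(1 + 2)))),
  (fun v : Y => D (rsubmx (v : 'rV_(1 + 2)))); split.
- by move=> v; apply: (rsub_morph v).2; apply: rN.
- by move=> v; apply: (rsub_morph v).2; apply: rD.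
- by apply: filterS gD => x' /=; rewrite graphF.
- apply: filterS2 uE gD => x' /= -> Dx'; rewrite graphF.
  by have [Ux' gE] := hD _ Dx'; rewrite ug ?inE // gE divfK.
Qed.

Lemma graph_fraction_p : germ (zgeneric_filter S) p \in graph_fraction.
Proof.
pose FS := zgeneric_filter S.
apply/asboolP; exists (fun v : Y => v 0 (lshift 2 0)), (fun=> 1); split.
- by move=> v; apply: regular_affine.
- by move=> v; apply: regular_at_cst.
- by apply: filterE => x; rewrite /= oner_neq0.
- have gp : @zgeneric k S [set x | germ_fun (germ FS p) x = p x].
    by apply: germ_funK; apply: filterE.
  by apply: filterS gp => x /= ->; rewrite mulr1 graph0.
Qed.

Hypothesis p_primitive : primitive_element F p.

(** The fractions of functions of (p, F) form a field that contains p and the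
    functions on k^2, so they exhaust the function field of S. *)
Lemma T_graph_fraction (x : S) l : dom l x -> exists al be : Y -> k,
  [/\ is_regular al, is_regular be, @zgeneric k S [set x | be (graph x) != 0]
    & forall y, dom l y -> znbhs y [set x | T l x * be (graph x) = al (graph x)]].
Proof.
move=> dx; pose FS := zgeneric_filter S.
have /asboolP[al [be [ral rbe nbe hT]]] : germ FS (T l) \in graph_fraction.
  apply: p_primitive; [exact: graph_fraction_subring|exact: graph_fraction_inv|
    exact: graph_fraction_base x|exact: graph_fraction_p].
exists al, be; split=> // y dy; have [rT _] := T_regular dy.
have gd : @zgeneric k S (dom l).
  by apply: (zgeneric_open K (z := x)) => // x' dx'; have [] := T_regular dx'.
have gT : @zgeneric k S [set x | germ_fun (germ FS (T l)) x = T l x].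
  by apply: germ_funK; apply: filterS gd => x' dx'; have [] := T_regular dx'.
have := @regular_generic_eq0 y (fun x => T l x * be (graph x) - al (graph x)).
move=> h; apply: znbhsS (h _ _) _.
- apply: regular_sub; [apply: regular_mul => //|]; apply: (graph_morph y).2;
    [exact: rbe|exact: ral].
- by apply: filterS2 gT hT => x' /= -> ->; rewrite subrr.
- by move=> x' /= /eqP; rewrite subr_eq0 => /eqP.
Qed.

Let S0 : set X := [set z | z.1 = 0].
Let Z : set Y := zclosure (susp F p @` S0).
Variable Fbar0 : sub_space S0 -> sub_space Z.
Hypotheses (Fbar0E : forall z, sval (Fbar0 z) = susp F p (sval z))
           (Fbar0_etale : etale Fbar0).

(** Otherwise x1 and x2 would have the same image in Z. Write the coordinate T of
    the root as al / be, with al and be functions of (p, F). Since be divides al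
    in the local ring at x1, flatness at x1 makes be divide al in the local ring of
    Z at the common image; so T is near x1 and near x2 the pull-back of the same
    function on Z, and T x1 = T x2. *)
Theorem etale_separates (x1 x2 : S) : F x1 = F x2 -> p x1 = p x2 -> x1 = x2.
Proof.
move=> F12 p12; have [l [_ d1 d2]] := dom_common K x1 x2 (oner_neq0 {poly k}).
apply: (T_inj d1 d2 F12).
have [al [be [ral rbe nbe hT]]] := T_graph_fraction d1.
pose in0 (x : S) : sub_space S0 := exist _ (at0 x) erefl.
have in0_morph x : morph_at in0 x by apply: morph_at_sub; apply: at0_morph.
pose pr (z : sub_space S0) : S := (sval z).2.
have pr_morph z : morph_at pr z.
  apply: (@morph_at_comp _ _ _ _ (fun z : sub_space S0 => sval z) (fun z : X => z.2)).
    exact: morph_at_sval.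
  exact: morph_at_snd.
have Fbar0_morph z : morph_at Fbar0 z by exact: Fbar0_etale.1.
have graphE z : graph (pr z) = sval (Fbar0 z).
  by rewrite Fbar0E /graph /pr /at0; case: z => [[x0 x] h] /=; rewrite (h : x0 = 0).
pose eta := Fbar0 (in0 x1).
have eta2 : Fbar0 (in0 x2) = eta.
  apply/sval_inj; rewrite -!graphE /= /graph !suspE /= F12.
  by rewrite p12.
pose al' (v : sub_space Z) := al (sval v); pose be' (v : sub_space Z) := be (sval v).
have ral' : regular_at eta al' by apply: (morph_at_sval eta).2; apply: ral.
have rbe' : regular_at eta be' by apply: (morph_at_sval eta).2; apply: rbe.
have m1 := Fbar0_morph (in0 x1).
have rT1 : regular_at (in0 x1) (fun z => T l (pr z)).
  by apply: (pr_morph (in0 x1)).2; have [] := T_regular d1.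
have [c alE] : exists c : stalk eta, stalk_germ eta al' = stalk_germ eta be' * c.
  apply/not_existsP => hc.
  have := @flat_not_dvd k (stalk eta) (stalk (in0 x1)) (@stalk_map _ _ _ Fbar0 (in0 x1))
    (@stalk_ev _ _ eta) (@stalk_ev _ _ (in0 x1)) (@stalk_evD _ _ eta)
    (@stalk_evM _ _ eta) (@stalk_ev1 _ _ eta) (@stalk_local _ _ eta)
    (@stalk_evD _ _ (in0 x1)) (@stalk_evM _ _ (in0 x1)) (@stalk_ev1 _ _ (in0 x1))
    (stalk_ev_map m1) (Fbar0_etale.2 (in0 x1)).1 (stalk_germ eta al')
    (stalk_germ eta be') _ (stalk_germ (in0 x1) (fun z => T l (pr z))).
  move/(_ _)/negP; apply; first by move=> c; apply/eqP => /hc.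
  rewrite !stalk_map_germ // stalk_germM //; last exact: m1.2.
  apply/eqP/stalk_germ_eq; first exact: m1.2.
  apply: znbhsS ((pr_morph (in0 x1)).1 _ (hT x1 d1)) _ => z /=.
  by rewrite /al' /be' -graphE => <-; rewrite mulrC.
pose h := germ_fun c.
have rh : regular_at eta h by exact: regular_germ_fun.
have nh : znbhs eta [set v | al' v = be' v * h v].
  apply: stalk_germ_inj => //; first exact: regular_mul.
  by rewrite alE -(stalk_germ_fun c) stalk_germM.
have T_h x : dom l x -> Fbar0 (in0 x) = eta -> T l x = h eta.
  move=> dx ex; have mF := morph_at_comp (in0_morph x) (Fbar0_morph (in0 x)).
  have nhx : znbhs x [set x' | al (graph x') = be (graph x') * h (Fbar0 (in0 x'))].
    have := mF.1 _; rewrite /= ex => /(_ _ nh) n; apply: znbhsS n _ => x' /=.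
    by rewrite /al' /be' -graphE.
  pose q x' := T l x' - h (Fbar0 (in0 x')).
  have rq : regular_at x q.
    apply: regular_sub; first by have [] := T_regular dx.
    by apply: mF.2; rewrite /= ex.
  suff : q x = 0 by rewrite /q ex => /eqP; rewrite subr_eq0 => /eqP.
  apply/eqP/negPn/negP => qx.
  have := znbhsI (regular_neq0 rq qx) (znbhsI nhx (hT x dx)).
  move=> /zgeneric_meets/(_ nbe)[x' [[/= qx' [e1 e2]] /= bx']].
  case/eqP: qx'; apply: (mulIf bx'); rewrite mul0r /q mulrBl e2 e1 mulrC.
  by rewrite subrr.
by rewrite (T_h x1) // (T_h x2).
Qed.

End Separation.

(** * Differences of p on the fibres *)

Section Triples.
Variables (k : numClosedFieldType) (S : kspace k) (F : S -> affine_space k 2).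
Variable K : cubic_cover F.

Local Notation dom := (dom K).
Local Notation T := (T K).

Implicit Types A B : k * k.

(** The cubic with roots (s1 : e1), (s2 : e2), (s3 : e3) is a member of the net if
    and only if s1 s2 s3 = e1 e2 e3; its coefficients are then the tri's. *)
Definition tri0 A1 A2 A3 := A1.1 * A2.1 * A3.1.
Definition tri1 A1 A2 A3 :=
  (A1.1 * A2.1 * A3.2 + A1.1 * A2.2 * A3.1 + A1.2 * A2.1 * A3.1) / 3.
Definition tri2 A1 A2 A3 :=
  (A1.1 * A2.2 * A3.2 + A1.2 * A2.1 * A3.2 + A1.2 * A2.2 * A3.1) / 3.
Definition tri_line A1 A2 A3 :=
  L0 K * tri0 A1 A2 A3 + L1 K * tri1 A1 A2 A3 + L2 K * tri2 A1 A2 A3.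
Definition in_net A1 A2 A3 := tri0 A1 A2 A3 = A1.2 * A2.2 * A3.2.
Definition tri_pt A1 A2 A3 : 'rV[k]_2 :=
  Cinv K (tri0 A1 A2 A3 / tri_line A1 A2 A3) (tri1 A1 A2 A3 / tri_line A1 A2 A3)
    (tri2 A1 A2 A3 / tri_line A1 A2 A3).

Definition vdet A B := A.1 * B.2 - A.2 * B.1.

Definition at_root (z : S) (y : 'rV[k]_2) A := F z = y /\
  exists l, [/\ A.1 - l * A.2 != 0, dom l z & T l z = A.2 / (A.1 - l * A.2)].

Lemma at_root_dom z y A : at_root z y A -> forall l,
  (dom l z <-> A.1 - l * A.2 != 0) /\ (dom l z -> T l z = A.2 / (A.1 - l * A.2)).
Proof.
move=> [_ [m [Am dm TE]]] l.
have e : 1 + (m - l) * T m z = (A.1 - l * A.2) / (A.1 - m * A.2).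
  by rewrite TE; field.
have iff : dom l z <-> A.1 - l * A.2 != 0.
  rewrite (dom_change l dm) e; split; last by move=> h; rewrite mulf_neq0 ?invr_eq0.
  by rewrite mulf_eq0 invr_eq0 (negPf Am) orbF.
split=> // dl; have Al := iff.1 dl.
by rewrite (T_change dm dl) e TE; field; rewrite Am Al.
Qed.

Lemma at_root_unique z z' y A A' :
  at_root z y A -> at_root z' y A' -> vdet A A' = 0 -> z = z'.
Proof.
move=> h h' v; have [l [_ dl dl']] := dom_common K z z' (oner_neq0 {poly k}).
have [i1 t1] := at_root_dom h l; have [i2 t2] := at_root_dom h' l.
have [f _] := h; have [f' _] := h'; apply: (T_inj dl dl'); first by rewrite f f'.
rewrite t1 // t2 //; have := i1.1 dl; have := i2.1 dl' => n2 n1.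
apply/eqP; rewrite eqr_div //; apply/eqP/eqP; rewrite -subr_eq0; apply/eqP.
by transitivity (- vdet A A'); [rewrite /vdet; ring|rewrite v oppr0].
Qed.

Lemma tri_sym12 A1 A2 A3 : [/\ tri0 A2 A1 A3 = tri0 A1 A2 A3,
  tri1 A2 A1 A3 = tri1 A1 A2 A3 & tri2 A2 A1 A3 = tri2 A1 A2 A3].
Proof. by rewrite /tri0 /tri1 /tri2; split; ring. Qed.

Lemma tri_cyc A1 A2 A3 : [/\ tri0 A2 A3 A1 = tri0 A1 A2 A3,
  tri1 A2 A3 A1 = tri1 A1 A2 A3 & tri2 A2 A3 A1 = tri2 A1 A2 A3].
Proof. by rewrite /tri0 /tri1 /tri2; split; ring. Qed.

Lemma tri_pt_sym12 A1 A2 A3 : tri_pt A2 A1 A3 = tri_pt A1 A2 A3.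
Proof. by rewrite /tri_pt /tri_line; have [-> -> ->] := tri_sym12 A1 A2 A3. Qed.

Lemma tri_pt_cyc A1 A2 A3 : tri_pt A2 A3 A1 = tri_pt A1 A2 A3.
Proof. by rewrite /tri_pt /tri_line; have [-> -> ->] := tri_cyc A1 A2 A3. Qed.

Lemma tri_line_cyc A1 A2 A3 : tri_line A2 A3 A1 = tri_line A1 A2 A3.
Proof. by rewrite /tri_line; have [-> -> ->] := tri_cyc A1 A2 A3. Qed.

Lemma tri_line_sym12 A1 A2 A3 : tri_line A2 A1 A3 = tri_line A1 A2 A3.
Proof. by rewrite /tri_line; have [-> -> ->] := tri_sym12 A1 A2 A3. Qed.

Definition scaleA (c : k) A := (c * A.1, c * A.2).

Lemma tri_scale c1 c2 c3 A1 A2 A3 :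
  let c := c1 * c2 * c3 in
  [/\ tri0 (scaleA c1 A1) (scaleA c2 A2) (scaleA c3 A3) = c * tri0 A1 A2 A3,
   tri1 (scaleA c1 A1) (scaleA c2 A2) (scaleA c3 A3) = c * tri1 A1 A2 A3
   & tri2 (scaleA c1 A1) (scaleA c2 A2) (scaleA c3 A3) = c * tri2 A1 A2 A3].
Proof. by rewrite /tri0 /tri1 /tri2 /=; split; ring. Qed.

Lemma tri_line_scale c1 c2 c3 A1 A2 A3 :
  tri_line (scaleA c1 A1) (scaleA c2 A2) (scaleA c3 A3) =
  c1 * c2 * c3 * tri_line A1 A2 A3.
Proof.
by rewrite /tri_line; have /= [-> -> ->] := tri_scale c1 c2 c3 A1 A2 A3; ring.
Qed.

Lemma tri_pt_scale c1 c2 c3 A1 A2 A3 : c1 != 0 -> c2 != 0 -> c3 != 0 ->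
  tri_pt (scaleA c1 A1) (scaleA c2 A2) (scaleA c3 A3) = tri_pt A1 A2 A3.
Proof.
move=> n1 n2 n3; rewrite /tri_pt tri_line_scale.
have /= [-> -> ->] := tri_scale c1 c2 c3 A1 A2 A3.
have n : c1 * c2 * c3 != 0 by rewrite !mulf_neq0.
have e x y : c1 * c2 * c3 * x / (c1 * c2 * c3 * y) = x / y.
  by rewrite -mulf_div divff // mul1r.
by rewrite !e.
Qed.

(** The triples whose first root is simple and whose cubic lies off the line L *)
Definition good1 A1 A2 A3 := [/\ in_net A1 A2 A3, tri_line A1 A2 A3 != 0,
  vdet A1 A2 != 0 & vdet A1 A3 != 0].

Let n3 : 3 != 0 :> k. Proof. by rewrite pnatr_eq0. Qed.

Lemma tri_cub l A1 A2 A3 t : in_net A1 A2 A3 ->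
  cub l (tri0 A1 A2 A3) (tri1 A1 A2 A3) (tri2 A1 A2 A3) t =
  (A1.2 - t * (A1.1 - l * A1.2)) * (A2.2 - t * (A2.1 - l * A2.2))
  * (A3.2 - t * (A3.1 - l * A3.2)).
Proof.
by move=> h; rewrite cubE mulrBr {1}h /tri0 /tri1 /tri2; field.
Qed.

Lemma tri_dcub l A1 A2 A3 t : in_net A1 A2 A3 ->
  A1.2 - t * (A1.1 - l * A1.2) = 0 ->
  dcub l (tri0 A1 A2 A3) (tri1 A1 A2 A3) (tri2 A1 A2 A3) t =
  - (A1.1 - l * A1.2) * ((A2.2 - t * (A2.1 - l * A2.2))
    * (A3.2 - t * (A3.1 - l * A3.2))).
Proof.
move=> h v0; pose u A := A.1 - l * A.2; pose v A := A.2 - t * u A.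
transitivity (- (u A1 * v A2 * v A3 + v A1 * (u A2 * v A3 + v A2 * u A3))
  + (tri0 A1 A2 A3 - A1.2 * A2.2 * A3.2) * (3 * l + 6 * l ^+ 2 * t + 3 * l ^+ 3 * t ^+
    2)).
  by rewrite /dcub /cub1 /cub2 /cub3 /v /u /tri0 /tri1 /tri2; field.
by rewrite (h : _ = _) subrr mul0r addr0 [v A1]v0 mul0r addr0 mulNr -!mulrA.
Qed.

Lemma vdet_neq0 A B : vdet A B != 0 -> exists l, A.1 - l * A.2 != 0.
Proof.
rewrite /vdet => h; have [a1|a1] := eqVneq A.1 0; last first.
  by exists 0; rewrite mul0r subr0.
exists 1; rewrite a1 mul1r sub0r oppr_eq0; apply: contraNneq h => ->.
by rewrite a1 !mul0r subrr.
Qed.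

Lemma tri_pt_root l A1 A2 A3 : good1 A1 A2 A3 -> A1.1 - l * A1.2 != 0 ->
  let t := A1.2 / (A1.1 - l * A1.2) in
  cub_at K l (tri_pt A1 A2 A3) t = 0 /\ dcub_at K l (tri_pt A1 A2 A3) t != 0.
Proof.
move=> [net D0 v12 v13] u0 t; have v0 : A1.2 - t * (A1.1 - l * A1.2) = 0.
  by rewrite /t divfK // subrr.
have vE B : B.2 - t * (B.1 - l * B.2) = vdet A1 B / (A1.1 - l * A1.2).
  by rewrite /t /vdet; field.
have [|e0 e1 e2] := @CinvK _ _ _ K (tri0 A1 A2 A3 / tri_line A1 A2 A3)
  (tri1 A1 A2 A3 / tri_line A1 A2 A3) (tri2 A1 A2 A3 / tri_line A1 A2 A3).
  have : L0 K * tri0 A1 A2 A3 + L1 K * tri1 A1 A2 A3 + L2 K * tri2 A1 A2 A3 =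
    tri_line A1 A2 A3 by [].
  move: D0; move: (tri_line _ _ _) => D D0 DE.
  by apply: (mulIf D0); rewrite mul1r -[RHS]DE; field.
rewrite /cub_at /dcub_at /tri_pt e0 e1 e2.
have -> : cub l (tri0 A1 A2 A3 / tri_line A1 A2 A3)
    (tri1 A1 A2 A3 / tri_line A1 A2 A3) (tri2 A1 A2 A3 / tri_line A1 A2 A3) t =
    cub l (tri0 A1 A2 A3) (tri1 A1 A2 A3) (tri2 A1 A2 A3) t / tri_line A1 A2 A3.
  by rewrite !cubE; ring.
have -> : dcub l (tri0 A1 A2 A3 / tri_line A1 A2 A3)
    (tri1 A1 A2 A3 / tri_line A1 A2 A3) (tri2 A1 A2 A3 / tri_line A1 A2 A3) t =
    dcub l (tri0 A1 A2 A3) (tri1 A1 A2 A3) (tri2 A1 A2 A3) t / tri_line A1 A2 A3.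
  by rewrite /dcub /cub1 /cub2 /cub3; ring.
rewrite tri_cub // tri_dcub // v0 !mul0r; split=> //.
by rewrite !vE !mulf_neq0 ?oppr_eq0 ?invr_eq0.
Qed.

Variable p : S -> k.
Hypothesis p_regular : is_regular p.

(** The value of p at the point of S over y given by the root A *)
Definition pval (y : 'rV[k]_2) A : k :=
  if pselect (exists z, at_root z y A) is left h then p (projT1 (cid h)) else 0.

Lemma pvalE z y A : at_root z y A -> pval y A = p z.
Proof.
move=> h; rewrite /pval; case: pselect => [h'|[]]; last by exists z.
case: cid => z' /= hz'; congr p; apply: at_root_unique hz' h _.
by rewrite /vdet mulrC subrr.
Qed.

Lemma pval_scale c y A : c != 0 -> pval y (scaleA c A) = pval y A.
Proof.
move=> c0; have iff z : at_root z y (scaleA c A) <-> at_root z y A.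
  have e l : c * A.1 - l * (c * A.2) = c * (A.1 - l * A.2) by ring.
  split=> -[Fz [l [n d t]]]; split=> //; exists l; move: n t => /=; rewrite e.
    rewrite mulf_eq0 negb_or => /andP[_ n] ->; split=> //.
    by rewrite -mulf_div divff // mul1r.
  move=> n ->; split=> //; first by rewrite mulf_neq0.
  by rewrite -mulf_div divff // mul1r.
have [[z hz]|h] := pselect (exists z, at_root z y A).
  by rewrite (pvalE hz) (pvalE ((iff z).2 hz)).
rewrite /pval; case: pselect => [h1|_]; last by case: pselect.
by exfalso; apply: h; have [z /iff hz] := h1; exists z.
Qed.

Lemma tri_at_root A1 A2 A3 : good1 A1 A2 A3 ->
  exists z, at_root z (tri_pt A1 A2 A3) A1.
Proof.
move=> g; have [_ _ v12 _] := g; have [l hl] := vdet_neq0 v12.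
have [r0 d0] := tri_pt_root g hl; have [z [dz Fz Tz]] := T_surj r0 d0.
by exists z; split=> //; exists l.
Qed.

(** By the universal property of S, the point of S given by a simple root that
    varies regularly also varies regularly. *)
Lemma regular_pval (X : kspace k) (x : X) (A1 A2 A3 : X -> k * k) :
    (forall i : bool, regular_at x (fun y => if i then (A1 y).1 else (A1 y).2)) ->
    (forall i : bool, regular_at x (fun y => if i then (A2 y).1 else (A2 y).2)) ->
    (forall i : bool, regular_at x (fun y => if i then (A3 y).1 else (A3 y).2)) ->
    (forall y, in_net (A1 y) (A2 y) (A3 y)) -> good1 (A1 x) (A2 x) (A3 x) ->
  regular_at x (fun y => pval (tri_pt (A1 y) (A2 y) (A3 y)) (A1 y)).
Proof.
move=> r1 r2 r3 net g; have [_ D0 v12 v13] := g.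
have cst c : regular_at x (fun=> c) by exact: regular_at_cst.
have [r11 r12] := (r1 true, r1 false); have [r21 r22] := (r2 true, r2 false).
have [r31 r32] := (r3 true, r3 false).
have [l hl] := vdet_neq0 v12.
have ru : regular_at x (fun y => (A1 y).1 - l * (A1 y).2).
  by apply: regular_sub => //; apply: regular_mul.
have ra0 : regular_at x (fun y => tri0 (A1 y) (A2 y) (A3 y)).
  by do ?apply: regular_mul.
have ra1 : regular_at x (fun y => tri1 (A1 y) (A2 y) (A3 y)).
  by apply: regular_mul => //; do ?apply: regular_add; do ?apply: regular_mul.
have ra2 : regular_at x (fun y => tri2 (A1 y) (A2 y) (A3 y)).
  by apply: regular_mul => //; do ?apply: regular_add; do ?apply: regular_mul.
have rD : regular_at x (fun y => tri_line (A1 y) (A2 y) (A3 y)).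
  by do ?apply: regular_add; apply: regular_mul.
have rv (B : X -> k * k) : regular_at x (fun y => (B y).1) -> regular_at x (fun y =>
  (B y).2) ->
    regular_at x (fun y => vdet (A1 y) (B y)).
  by move=> rb1 rb2; apply: regular_sub; apply: regular_mul.
have ry i : regular_at x (fun y => tri_pt (A1 y) (A2 y) (A3 y) 0 i).
  by apply: Cinv_regular; apply: regular_div.
have rt : regular_at x (fun y => (A1 y).2 / ((A1 y).1 - l * (A1 y).2)).
  exact: regular_div.
have near : znbhs x [set y | good1 (A1 y) (A2 y) (A3 y) /\
    (A1 y).1 - l * (A1 y).2 != 0].
  have nv2 := regular_neq0 (rv A2 r21 r22) v12.
  have nv3 := regular_neq0 (rv A3 r31 r32) v13.
  have nD := regular_neq0 rD D0; have nu := regular_neq0 ru hl.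
  by apply: znbhsS (znbhsI nv2 (znbhsI nv3 (znbhsI nD nu))) _ => y [? [? [? ?]]].
have [||h [mh nh]] := cover_map (K := K) (l := l) ry rt.
- by apply: znbhsS near _ => y [gy uy]; have [] := tri_pt_root gy uy.
- by have [] := tri_pt_root g hl.
apply: eq_regular (mh.2 _ (p_regular (h x))).
apply: znbhsS (znbhsI near nh) _ => y [[gy uy] [dy Fy Ty]] /=.
by rewrite (@pvalE (h y)) //; split=> //; exists l.
Qed.

Definition pdiff A1 A2 A3 := pval (tri_pt A1 A2 A3) A1 - pval (tri_pt A1 A2 A3) A2.

Definition good A1 A2 A3 := [/\ in_net A1 A2 A3, tri_line A1 A2 A3 != 0,
  vdet A1 A2 != 0, vdet A1 A3 != 0 & vdet A2 A3 != 0].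

Lemma vdetC A B : vdet A B = - vdet B A.
Proof. by rewrite /vdet; ring. Qed.

Lemma in_net_sym12 A1 A2 A3 : in_net A1 A2 A3 -> in_net A2 A1 A3.
Proof. by rewrite /in_net /tri0 [A2.1 * _]mulrC [A2.2 * _]mulrC. Qed.

Lemma in_net_cyc A1 A2 A3 : in_net A1 A2 A3 -> in_net A2 A3 A1.
Proof.
have e (x y z : k) : y * z * x = x * y * z by rewrite mulrC mulrA.
by rewrite /in_net /tri0 [A2.1 * _ * _]e [A2.2 * _ * _]e.
Qed.

Lemma good_cyc A1 A2 A3 : good A1 A2 A3 -> good A2 A3 A1.
Proof.
move=> [net D0 v12 v13 v23]; split.
- exact: in_net_cyc net.
- by rewrite tri_line_cyc.
- exact: v23.
- by rewrite vdetC oppr_eq0.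
- by rewrite vdetC oppr_eq0.
Qed.

Lemma good_sym12 A1 A2 A3 : good A1 A2 A3 -> good A2 A1 A3.
Proof.
move=> [net D0 v12 v13 v23]; split.
- exact: in_net_sym12 net.
- by rewrite tri_line_sym12.
- by rewrite vdetC oppr_eq0.
- exact: v23.
- exact: v13.
Qed.

Lemma good_good1 A1 A2 A3 : good A1 A2 A3 -> good1 A1 A2 A3.
Proof. by case. Qed.

Lemma pdiff_sym12 A1 A2 A3 : pdiff A2 A1 A3 = - pdiff A1 A2 A3.
Proof. by rewrite /pdiff tri_pt_sym12 opprB. Qed.

Lemma pdiff_cyc A1 A2 A3 :
  pdiff A1 A2 A3 + pdiff A2 A3 A1 + pdiff A3 A1 A2 = 0.
Proof. by rewrite /pdiff (tri_pt_cyc A1 A2 A3) -(tri_pt_cyc A3 A1 A2); ring. Qed.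

Lemma pdiff_scale c1 c2 c3 A1 A2 A3 : c1 != 0 -> c2 != 0 -> c3 != 0 ->
  pdiff (scaleA c1 A1) (scaleA c2 A2) (scaleA c3 A3) = pdiff A1 A2 A3.
Proof. by move=> n1 n2 n3'; rewrite /pdiff tri_pt_scale // !pval_scale. Qed.

Lemma regular_pdiff (X : kspace k) (x : X) (A1 A2 A3 : X -> k * k) :
    (forall i : bool, regular_at x (fun y => if i then (A1 y).1 else (A1 y).2)) ->
    (forall i : bool, regular_at x (fun y => if i then (A2 y).1 else (A2 y).2)) ->
    (forall i : bool, regular_at x (fun y => if i then (A3 y).1 else (A3 y).2)) ->
    (forall y, in_net (A1 y) (A2 y) (A3 y)) -> good (A1 x) (A2 x) (A3 x) ->
  regular_at x (fun y => pdiff (A1 y) (A2 y) (A3 y)).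
Proof.
move=> r1 r2 r3 net g; apply: regular_sub.
  exact: regular_pval (good_good1 g).
under eq_fun do rewrite -tri_pt_sym12.
apply: regular_pval => //; last exact/good_good1/good_sym12.
by move=> y; apply/in_net_sym12/net.
Qed.

Hypothesis p_separates : forall x1 x2 : S, F x1 = F x2 -> p x1 = p x2 -> x1 = x2.

Lemma pdiff_neq0 A1 A2 A3 : good A1 A2 A3 -> pdiff A1 A2 A3 != 0.
Proof.
move=> g; have [z1 h1] := tri_at_root (good_good1 g).
have [z2] := tri_at_root (good_good1 (good_sym12 g)); rewrite tri_pt_sym12 => h2.
rewrite /pdiff (pvalE h1) (pvalE h2) subr_eq0; apply/eqP => /p_separates eq12.
have {}eq12 : z1 = z2 by apply: eq12; have [-> _] := h1; have [-> _] := h2.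
have [_ _ v12 _ _] := g; case/eqP: v12.
have [_ [l [n1 d1 t1]]] := h1; have [i2 t2] := at_root_dom h2 l.
rewrite -eq12 in i2 t2; have n2 := i2.1 d1; move: (t2 d1); rewrite t1 => /eqP.
rewrite eqr_div // -subr_eq0 => /eqP e; rewrite -[RHS]oppr0 -e /vdet; ring.
Qed.

End Triples.

(** * Units on open subsets of the line *)

Section Units.
Variable k : numClosedFieldType.
Implicit Types (P Q N E G : {poly k}) (R : seq k).

Lemma mup_eq_eqp P Q : P != 0 -> Q != 0 -> (forall x, mup x P = mup x Q) ->
  exists2 c, c != 0 & P = c *: Q.
Proof.
have [n] := ubnP (size P); elim: n P Q => // n IHn P Q szP P0 Q0 PQ.
have [P1|P1] := eqVneq (size P) 1%N.
  have Qnr x : ~~ root Q x.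
    rewrite -dvdp_XsubCl XsubC_dvd // -PQ -XsubC_dvd // dvdp_XsubCl.
    have /size_poly1P[c c0 ->] : size P == 1%N by rewrite P1.
    by rewrite rootC.
  have szQ : size Q == 1%N.
    by apply: contraT => /closed_rootP[x]; rewrite (negPf (Qnr x)).
  have /size_poly1P[c c0 ->] : size P == 1%N by rewrite P1.
  have /size_poly1P[d d0 ->] := szQ.
  by exists (c / d); rewrite ?mulf_neq0 ?invr_eq0 // -mul_polyC -polyCM divfK.
have [x rP] : exists x, root P x by apply/closed_rootP.
have rQ : root Q x.
  by rewrite -dvdp_XsubCl XsubC_dvd // -PQ -XsubC_dvd // dvdp_XsubCl.
have /factor_theorem[P' PE] := rP; have /factor_theorem[Q' QE] := rQ.
have P'0 : P' != 0 by apply: contraNneq P0 => P'0; rewrite PE P'0 mul0r.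
have Q'0 : Q' != 0 by apply: contraNneq Q0 => Q'0; rewrite QE Q'0 mul0r.
have X0 : 'X - x%:P != 0 by rewrite polyXsubC_eq0.
have [|y|c c0 P'E] := IHn P' Q' _ P'0 Q'0.
- move: szP; rewrite PE size_Mmonic ?monicXsubC // size_XsubC addn2.
  by rewrite ltnS.
- have /eqP := PQ y; by rewrite PE QE !mupM // eqn_add2r => /eqP.
by exists c => //; rewrite PE P'E QE scalerAl.
Qed.

Lemma mup_prod R (f : k -> nat) x : uniq R ->
  mup x (\prod_(r <- R) ('X - r%:P) ^+ f r) = if x \in R then f x else 0%N.
Proof.
elim: R => [|r R IHR] /=.
  by rewrite big_nil mupNroot // rootC oner_neq0.
move=> /andP[rR uR]; rewrite big_cons mupM.
- rewrite mup_XsubCX IHR // inE eq_sym; case: eqP => [->|_] /=; last by [].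
  by rewrite (negPf rR) addn0.
- by rewrite expf_neq0 // polyXsubC_eq0.
- by rewrite prodf_seq_neq0; apply/allP => r' _; rewrite /= expf_neq0 // polyXsubC_eq0.
Qed.

Definition ord_frac N E (x : k) : int := (mup x N)%:Z - (mup x E)%:Z.

(** Off R the function h = N / E is a local unit, so N and E vanish there to the
    same order. *)
Lemma unit_factorization (h : affine_line k -> k) N E G R :
    uniq R -> E != 0 -> G != 0 ->
    (forall x, G.[x] != 0 -> E.[x] * h x = N.[x]) ->
    (forall x : affine_line k, x \notin R -> regular_at x h /\ h x != 0) ->
  exists2 c, c != 0 &
    forall x, x \notin R -> h x = c * \prod_(r <- R) (x - r) ^ ord_frac N E r.
Proof.
move=> uR E0 G0 hE hR.
have local x : x \notin R -> exists N' D' : {poly k},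
    [/\ D'.[x] != 0, N'.[x] != 0, h x = N'.[x] / D'.[x] & E * N' = N * D'].
  move=> /hR[/regular_line_frac[N' [D' [D0 hD]]] hx]; exists N', D'; split=> //.
  - by apply: contraNneq hx => N0; rewrite hD // N0 mul0r.
  - exact: hD.
  - apply/eqP; rewrite -subr_eq0; apply/eqP.
    apply: (poly_eq0_off (mulf_neq0 G0 (horner_neq0 D0))) => y.
    rewrite !hornerE mulf_eq0 negb_or => /andP[Gy Dy].
    by rewrite -(hE y Gy) hD // -mulrA divfK // subrr.
have [x0 x0R] : exists x0, x0 \notin R.
  have [|x0] := @poly_avoid _ (\prod_(r <- R) ('X - r%:P)).
    by rewrite prodf_seq_neq0; apply/allP => r _; rewrite /= polyXsubC_eq0.
  by rewrite -/(root _ _) root_prod_XsubC => ?; exists x0.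
have N0 : N != 0.
  have [N' [D' [D0 N0 _ e]]] := local x0 x0R.
  have : E * N' != 0 by rewrite mulf_neq0 // (horner_neq0 N0).
  by rewrite e mulf_eq0 negb_or => /andP[].
pose A (P : {poly k}) := \prod_(r <- R) ('X - r%:P) ^+ mup r P.
have A0 P : A P != 0.
  by rewrite prodf_seq_neq0; apply/allP => r _; rewrite /= expf_neq0 // polyXsubC_eq0.
have [||x|c c0 cE] := @mup_eq_eqp (N * A E) (E * A N); rewrite ?mulf_neq0 //.
  rewrite !mupM // !(mup_prod (fun r => mup r _)) //.
  case: ifPn => [_|/local[N' [D' [D0 N'0 _ e]]]]; first by rewrite addnC.
  by rewrite !addn0 -(mupMl (q2 := D') N) // -e mupMl.
exists c => // x xR; have [N' [D' [D0 N'0 -> e]]] := local x xR.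
have {}e : N' * A E = c *: (D' * A N).
  apply: (mulfI E0); rewrite mulrA e mulrAC cE.
  by rewrite -!mul_polyC; ring.
have AE P : (A P).[x] = \prod_(r <- R) (x - r) ^+ mup r P.
  by rewrite horner_prod; apply: eq_bigr => r _; rewrite horner_exp hornerXsubC.
have xr r : r \in R -> x - r != 0.
  by move=> rR; rewrite subr_eq0; apply: contraNneq xR => ->.
have AE0 : (A E).[x] != 0.
  by rewrite AE prodf_seq_neq0; apply/allP => r /xr ?; rewrite /= expf_neq0.
have -> : \prod_(r <- R) (x - r) ^ ord_frac N E r = (A N).[x] / (A E).[x].
  rewrite !AE -prodf_div !big_seq; apply: eq_bigr => r /xr ?.
  by rewrite /ord_frac expfzDr // exprnP -exprnN.
have := congr1 (horner^~ x) e; rewrite hornerM hornerZ hornerM => ex.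
apply: (mulIf AE0); apply: (mulIf D0); rewrite mulrA divfK //.
by rewrite mulrAC divfK // ex; ring.
Qed.

Lemma regular_exprz (X : kspace k) (x : X) (f : X -> k) (n : int) :
  regular_at x f -> f x != 0 -> regular_at x (fun y => f y ^ n).
Proof.
move=> rf fx; case: n => n; first exact: regular_exp.
by apply: regular_inv; [apply: regular_exp|rewrite expf_neq0].
Qed.

(** Otherwise u or v would vanish at x, according to the sign of n. *)
Lemma order_unique (x : affine_line k) (n : int) (u v : affine_line k -> k) G :
    regular_at x u -> u x != 0 -> regular_at x v -> v x != 0 -> G != 0 ->
    (forall y, G.[y] != 0 -> (y - x) ^ n * u y = v y) ->
  n = 0.
Proof.
move=> ru ux rv vx G0 hG.
have rl : regular_at x (fun y : affine_line k => y - x).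
  by apply: regular_sub; [apply: regular_line|apply: regular_at_cst].
have GX0 : G * ('X - x%:P) != 0 by rewrite mulf_neq0 // polyXsubC_eq0.
case: n hG => [[//|n]|n] hG.
  have := @regular_line_eq0 _ x (fun y => v y - (y - x) ^+ n.+1 * u y) G.
  rewrite subrr expr0n mul0r subr0 => h; case/eqP: vx; apply: h => //.
    by apply: regular_sub => //; apply: regular_mul => //; apply: regular_exp.
  by move=> y /hG <-; rewrite subrr.
have := @regular_line_eq0 _ x (fun y => u y - (y - x) ^+ n.+1 * v y) _ _ GX0.
rewrite subrr expr0n mul0r subr0 => h; case/eqP: ux; apply: h => //.
  by apply: regular_sub => //; apply: regular_mul => //; apply: regular_exp.
move=> y; rewrite hornerM hornerXsubC mulf_eq0 negb_or => /andP[/hG <- yx].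
by rewrite NegzE -exprnN mulVKf ?expf_neq0 // subrr.
Qed.

Lemma mup_size x P : P != 0 -> (mup x P <= size P)%N.
Proof.
move=> P0; have /dvdp_leq : ('X - x%:P) ^+ mup x P %| P by rewrite -mup_geq.
by rewrite size_exp_XsubC => /(_ P0)/ltnW.
Qed.

(** If every t failed on some nonempty open set, all of them would fail on the
    intersection of these sets. *)
Lemma finite_choice_dense (T : finType) (P : T -> k -> Prop) G : G != 0 ->
    (forall x, G.[x] != 0 -> exists t, P t x) ->
  exists t, forall Q, Q != 0 -> exists x, [/\ G.[x] != 0, Q.[x] != 0 & P t x].
Proof.
move=> G0 hP; apply/not_existsP => ht.
have /choice[Q hQ] : forall t, exists Q, Q != 0 /\
    forall x, G.[x] != 0 -> Q.[x] != 0 -> ~ P t x.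
  move=> t; have /existsNP[Q /not_implyP[Q0 hQ]] := ht t.
  by exists Q; split=> // x Gx Qx Px; apply: hQ; exists x.
have [|x] := @poly_avoid _ (G * \prod_t Q t).
  by rewrite mulf_neq0 //; apply/prodf_neq0 => t _; case: (hQ t).
rewrite hornerM mulf_eq0 negb_or horner_prod => /andP[Gx /prodf_neq0 Qx].
by have [t] := hP x Gx; apply: (hQ t).2 => //; apply: Qx.
Qed.

End Units.

(** * The difference of p at two roots *)

(** ** Normalized triples of roots *)

Section FibreUnit.
Variables (k : numClosedFieldType) (S : kspace k) (F : S -> affine_space k 2).
Variables (K : cubic_cover F) (p : S -> k).
Hypothesis p_regular : is_regular p.
Hypothesis p_separates : forall x1 x2 : S, F x1 = F x2 -> p x1 = p x2 -> x1 = x2.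

Local Notation a0 := (L0 K).
Local Notation a1 := (L1 K / 3).
Local Notation a2 := (L2 K / 3).
Implicit Types (s z : k).

(** The scaling of the roots brings every triple of the net to this form, with s
    determined up to a sign, because s^2 is the third root. *)
Definition normal_good s z := good K (z, s) (1, s * z) (s ^+ 2, 1).
Definition normal_diff s z := pdiff K p (z, s) (1, s * z) (s ^+ 2, 1).
Definition normal_gap s z : k := (z - s ^+ 3) * (s ^+ 3 * z - 1).
Definition normal_line s z : k :=
  (a1 * s ^+ 3 + a2 * s) * (z ^+ 2 + 1) + (a0 * s ^+ 2 + a1 + a2 * s ^+ 4) * z.

Lemma normal_lineE s z : tri_line K (z, s) (1, s * z) (s ^+ 2, 1) = normal_line s z.
Proof. by rewrite /tri_line /tri0 /tri1 /tri2 /normal_line /=; ring. Qed.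

Lemma normal_goodE s z : normal_good s z <->
  [/\ s != 0, z - 1 != 0, z + 1 != 0, normal_gap s z != 0 & normal_line s z != 0].
Proof.
have e : s * (z - 1) * (z + 1) = vdet (z, s) (1, s * z) by rewrite /vdet /=; ring.
have e' : normal_gap s z = - (vdet (z, s) (s ^+ 2, 1) * vdet (1, s * z) (s ^+ 2, 1)).
  by rewrite /normal_gap /vdet /=; ring.
have net : in_net (z, s) (1, s * z) (s ^+ 2, 1) by rewrite /in_net /tri0 /=; ring.
rewrite /normal_good /good normal_lineE e' oppr_eq0 -e !mulf_eq0 !negb_or; split.
  by case=> _ -> /andP[/andP[-> ->] ->] -> ->.
by case=> -> -> -> /andP[-> ->] ->.
Qed.

Lemma regular_at_pair (X : kspace k) (x : X) (f g : X -> k) :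
  regular_at x f -> regular_at x g ->
  forall i : bool, regular_at x (fun y => if i then (f y, g y).1 else (f y, g y).2).
Proof. by move=> rf rg []. Qed.

Lemma regular_normal_diff (X : kspace k) (x : X) (f g : X -> k) :
    regular_at x f -> regular_at x g -> normal_good (f x) (g x) ->
  regular_at x (fun y => normal_diff (f y) (g y)).
Proof.
move=> rf rg h; apply: (regular_pdiff p_regular
  (A1 := fun y => (g y, f y)) (A2 := fun y => (1, f y * g y))
  (A3 := fun y => (f y ^+ 2, 1))) => //.
- exact: regular_at_pair.
- by apply: regular_at_pair; [apply: regular_at_cst|apply: regular_mul].
- by apply: regular_at_pair; [apply: regular_exp|apply: regular_at_cst].
- by move=> y; rewrite /in_net /tri0 /=; ring.
Qed.

Lemma normal_diff_neq0 s z : normal_good s z -> normal_diff s z != 0.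
Proof. by move=> h; apply: pdiff_neq0 h. Qed.

Lemma normal_diffV s z : z != 0 -> normal_diff s z^-1 = - normal_diff s z.
Proof.
move=> z0; rewrite /normal_diff -pdiff_sym12.
rewrite -(@pdiff_scale _ _ _ K p z z 1 (z^-1, s)) ?oner_neq0 //.
by rewrite /scaleA /= !mul1r !mulr1 mulfV // mulrCA mulfV // mulr1 [z * s]mulrC.
Qed.

Lemma normal_diffN s z : normal_diff (- s) (- z) = normal_diff s z.
Proof.
rewrite /normal_diff -(@pdiff_scale _ _ _ K p (-1) 1 1) ?oppr_eq0 ?oner_neq0 //.
by rewrite /scaleA /= !mulN1r !mul1r !opprK mulrNN sqrrN.
Qed.

Lemma normal_goodV s z : z != 0 -> normal_good s z -> normal_good s z^-1.
Proof.
move=> z0 /normal_goodE[s0 z1 z2 G0 D0]; apply/normal_goodE.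
have e1 : z^-1 - 1 = - (z - 1) / z by field.
have e2 : z^-1 + 1 = (z + 1) / z by field.
have e3 : normal_gap s z^-1 = normal_gap s z / z ^+ 2 by rewrite /normal_gap; field.
have e4 : normal_line s z^-1 = normal_line s z / z ^+ 2 by rewrite /normal_line; field.
by split=> //; rewrite ?(e1, e2, e3, e4) mulf_neq0 ?invr_eq0 ?oppr_eq0 ?expf_neq0.
Qed.

(** ** Polynomials in two variables *)

Definition specialize (N : {poly {poly k}}) s : {poly k} := map_poly (horner_eval s) N.

Lemma horner_specialize N s z : (specialize N s).[z] = N.[z%:P].[s].
Proof.
have -> : z = horner_eval s z%:P by rewrite /horner_eval hornerC.
by rewrite /specialize horner_map /horner_eval hornerC.
Qed.

Lemma size_specialize N s : (size (specialize N s) <= size N)%N.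
Proof. exact: size_poly. Qed.

Lemma specialize_neq0 N s : (lead_coef N).[s] != 0 -> specialize N s != 0.
Proof.
apply: contraNneq => /polyP/(_ (size N).-1).
by rewrite coef0 coef_map /= -lead_coefE /horner_eval => ->.
Qed.

(** The degrees of N and E will bound, uniformly in s, the orders of the zeros and
    poles of the function of z. *)
Lemma normal_diff_frac s0 z0 : normal_good s0 z0 -> exists N E : {poly {poly k}},
  E != 0 /\
  forall s z, (specialize E s).[z] != 0 -> (specialize E s).[z] * normal_diff s z =
    (specialize N s).[z].
Proof.
move=> ok0; pose x0 : affine_space k 2 := \row_i (if i == 0 then s0 else z0).
have [|U [g [hg fg]]] := @regular_normal_diff (affine_space k 2) x0 (fun y => y 0 0)
    (fun y => y 0 1) (regular_affine _ _) (regular_affine _ _).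
  by rewrite /x0 !mxE.
pose P (f : affine_space k 2 -> k) :=
  exists N : {poly {poly k}}, forall y, f y = (specialize N (y 0 0)).[y 0 1].
have [] := @ratexp_frac _ (affine_space k 2) P _ _ _ _ _ _ _ hg.
- by move=> c; exists c%:P%:P => y; rewrite horner_specialize !hornerC.
- by move=> u v [N hN] [M hM]; exists (N + M) => y;
    rewrite hN hM !horner_specialize !hornerD.
- by move=> u v [N hN] [M hM]; exists (N * M) => y;
    rewrite hN hM !horner_specialize !hornerM.
- move=> _ _ [-> [i ->]]; split=> //.
  have [->|i0] := eqVneq i 0; first by exists 'X%:P => y;
    rewrite horner_specialize hornerC hornerX.
  have -> : i = 1 by apply/val_inj; case: i i0 => -[|[|]].
  by exists 'X => y; rewrite horner_specialize hornerX hornerC.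
move=> N1 [D1 [[N hN] [E hE] E0 h]]; exists N, E; split.
  by apply: contraNneq E0 => E0; rewrite hE E0 horner_specialize !horner0.
move=> s z; pose y : affine_space k 2 := \row_i (if i == 0 then s else z).
have [ys yz] : y 0 0 = s /\ y 0 1 = z by rewrite !mxE.
have := h y; rewrite hN hE ys yz => {}h /[dup] Esz /h[Uy].
by rewrite -fg ?inE // ys yz => ->; rewrite mulrC divfK.
Qed.

End FibreUnit.

(** ** The function of z at a fixed s *)

Lemma regular_prodz (k : numClosedFieldType) (X : kspace k) (x : X) (I : eqType)
    (r : seq I) (P : pred I) (f : I -> X -> k) (o : I -> int) :
    (forall i, i \in r -> P i -> regular_at x (f i) /\ f i x != 0) ->
  regular_at x (fun y => \prod_(i <- r | P i) f i y ^ o i) /\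
  \prod_(i <- r | P i) f i x ^ o i != 0.
Proof.
move=> h; split; last first.
  rewrite prodf_seq_neq0; apply/allP => i /h hi; apply/implyP => /hi[_ fx].
  by rewrite expfz_neq0.
elim: r h => [|i r IHr] h.
  under eq_fun do rewrite big_nil; exact: regular_at_cst.
have {}IHr := IHr (fun j jr => h j (mem_behead (s := i :: r) jr)).
have [Pi|nPi] := boolP (P i); last first.
  by under eq_fun do rewrite big_cons (negPf nPi).
under eq_fun do rewrite big_cons Pi.
have [ri ix] := h i (mem_head _ _) Pi.
by apply: regular_mul => //; apply: regular_exprz.
Qed.

(** The orders of h at x and 1/x agree, because h(1/z) = - h(z). *)
Lemma ord_inv (k : numClosedFieldType) (R : seq k) (o : k -> int) c (h : k -> k) x :
    uniq R -> 0 \notin R -> (forall r, r \in R -> r^-1 \in R) -> c != 0 ->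
    (forall z, z \notin R -> h z = c * \prod_(r <- R) (z - r) ^ o r) ->
    (forall z, z != 0 -> h z^-1 = - h z) -> x \in R ->
  o x^-1 = o x.
Proof.
move=> uR R0 RV c0 hE hV xR; apply/eqP; rewrite -subr_eq0; apply/eqP.
have x0 : x != 0 by apply: contraNneq R0 => <-.
have rl : regular_at (x : affine_line k) (id : affine_line k -> k).
  exact: regular_line.
have rV : regular_at (x : affine_line k) (fun y : affine_line k => y^-1 : k).
  exact: regular_inv.
pose u (z : affine_line k) : k :=
  (- (x * z)^-1) ^ o x^-1 * \prod_(r <- R | r != x^-1) (z^-1 - r) ^ o r.
pose v (z : affine_line k) : k := - \prod_(r <- R | r != x) (z - r) ^ o r.
have xx0 : - (x * x)^-1 != 0 by rewrite oppr_eq0 invr_eq0 mulf_neq0.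
have [ru u0] : regular_at (x : affine_line k) u /\ u x != 0.
  have [|r1 n1] := @regular_prodz k (affine_line k) x _ R (fun r => r != x^-1)
      (fun r z => z^-1 - r) o.
    move=> r _ rx; split; first by apply: regular_sub => //; apply: regular_at_cst.
    by rewrite subr_eq0 eq_sym.
  split; last by rewrite mulf_neq0 // expfz_neq0.
  apply: regular_mul => //; apply: regular_exprz => //; apply: regular_opp.
  apply: regular_inv; last by rewrite mulf_neq0.
  by apply: regular_mul => //; apply: regular_at_cst.
have [rv v0] : regular_at (x : affine_line k) v /\ v x != 0.
  have [|r1 n1] := @regular_prodz k (affine_line k) x _ R (fun r => r != x)
      (fun r z => z - r) o.
    move=> r _ rx; split; last by rewrite subr_eq0 eq_sym.
    by apply: regular_sub => //; apply: regular_at_cst.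
  by split; [apply: regular_opp|rewrite oppr_eq0].
pose G : {poly k} := 'X * \prod_(r <- R) ('X - r%:P).
apply: (@order_unique _ x _ u v G ru u0 rv v0).
  by rewrite mulf_neq0 ?polyX_eq0 // prodf_seq_neq0; apply/allP => r _;
    rewrite /= polyXsubC_eq0.
move=> z; rewrite hornerM hornerX mulf_eq0 negb_or -[X in _ && ~~ X]/(root _ _).
rewrite root_prod_XsubC => /andP[z0 zR].
have zx : z - x != 0 by rewrite subr_eq0; apply: contraNneq zR => ->.
have := hV z z0; rewrite !hE //; last by apply: contraNN zR => /RV; rewrite invrK.
rewrite -mulrN => /(mulfI c0).
rewrite (bigD1_seq _ (RV _ xR) uR) /= [in RHS](bigD1_seq _ xR uR) /= -mulrN -/(v z).
have -> : z^-1 - x^-1 = (z - x) * (- (x * z)^-1) by field; rewrite ?x0 ?z0.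
rewrite expfzMl -mulrA -/(u z) => e.
by rewrite expfzDr // mulrAC e mulrAC -expfzDr // subrr expr0z mul1r.
Qed.

Section FibreUnitLine.
Variables (k : numClosedFieldType) (S : kspace k) (F : S -> affine_space k 2).
Variables (K : cubic_cover F) (p : S -> k).
Hypothesis p_regular : is_regular p.
Hypothesis p_separates : forall x1 x2 : S, F x1 = F x2 -> p x1 = p x2 -> x1 = x2.

Local Notation a0 := (L0 K).
Local Notation a1 := (L1 K / 3).
Local Notation a2 := (L2 K / 3).
Local Notation normal_gap := (@normal_gap k).
Local Notation normal_line := (normal_line K).
Local Notation normal_good := (normal_good K).
Local Notation normal_diff := (normal_diff K p).
Implicit Types (s z : k).

Definition lead s := a1 * s ^+ 3 + a2 * s.

(** The polynomial is reciprocal. *)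
Lemma normal_line_factor s : lead s != 0 ->
  exists2 r, r != 0 & forall z, normal_line s z = lead s * ((z - r) * (z - r^-1)).
Proof.
move=> A0; pose B := a0 * s ^+ 2 + a1 + a2 * s ^+ 4.
pose P : {poly k} := lead s *: ('X ^+ 2 + 1) + B *: 'X.
have PE z : P.[z] = normal_line s z by rewrite /P !hornerE.
have [|r] := @closed_rootP _ P _.
  apply/eqP => szP; have : P`_2 = 0 by rewrite nth_default // szP.
  by rewrite /P !coefE /= mulr0 !addr0 mulr1; apply/eqP.
rewrite rootE PE => /eqP Pr.
have r0 : r != 0.
  apply: contraNneq A0 => r0; move: Pr;
    rewrite r0 /normal_line expr0n /= add0r mulr1 mulr0 addr0.
  by rewrite /lead => ->.
exists r => // z; apply/eqP; rewrite -subr_eq0; apply/eqP.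
transitivity (z / r * normal_line s r); last by rewrite Pr mulr0.
by rewrite /normal_line /lead; field.
Qed.

Definition monomial (i1 i2 j m : int) s z : k :=
  (z - 1) ^ i1 * (z + 1) ^ i2 * normal_gap s z ^ j * normal_line s z ^ m.

Lemma monomial_neq0 i1 i2 j m s z : normal_good s z -> monomial i1 i2 j m s z != 0.
Proof. by move=> /normal_goodE[_ n1 n2 n3 n4]; rewrite !mulf_neq0 // expfz_neq0. Qed.

(** Integers of absolute value less than n, encoded in a finite type *)
Definition diffz (n : nat) (ij : 'I_n * 'I_n) : int := ij.1%:Z - ij.2%:Z.

Lemma diffz_ord N E s r n : specialize E s != 0 -> specialize N s != 0 ->
    (size N < n)%N -> (size E < n)%N ->
  exists ij, diffz (n := n) ij = ord_frac (specialize N s) (specialize E s) r.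
Proof.
move=> E0 N0 szN szE.
have b M : specialize M s != 0 -> (size M < n)%N -> (mup r (specialize M s) < n)%N.
  by move=> M0 szM; apply: leq_ltn_trans szM;
    apply: leq_trans (mup_size r M0) (size_specialize M s).
by exists (Ordinal (b N N0 szN), Ordinal (b E E0 szE)).
Qed.

(** As a function of z, the difference is regular and nonzero where the triple is
    good, that is, off the six zeros of (z^2 - 1) normal_gap normal_line; by ord_inv
    the zeros of either of the last two polynomials have the same order. *)
Lemma normal_diff_fixed N E s n :
    (forall z, (specialize E s).[z] != 0 -> (specialize E s).[z] * normal_diff s z =
      (specialize N s).[z]) ->
    (size N < n)%N -> (size E < n)%N ->
    specialize E s != 0 -> s != 0 -> s ^+ 6 != 1 -> lead s != 0 ->
    normal_line s 1 != 0 -> normal_line s (-1) != 0 -> normal_line s (s ^+ 3) != 0 ->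
  exists (t : ('I_n * 'I_n) * ('I_n * 'I_n) * ('I_n * 'I_n) * ('I_n * 'I_n)) c,
    c != 0 /\ forall z, normal_good s z -> normal_diff s z =
      c * monomial (diffz t.1.1.1) (diffz t.1.1.2) (diffz t.1.2) (diffz t.2) s z.
Proof.
move=> qE szN szE E0 s0 s6 A0 d1 d2 d3.
have [r r0 dE] := normal_line_factor A0.
have s3 : s ^+ 3 != 0 by rewrite expf_neq0.
have gE z : normal_gap s z = s ^+ 3 * ((z - s ^+ 3) * (z - (s ^+ 3)^-1)) by rewrite
  /normal_gap; field.
rewrite (exprM s 3 2) in s6.
move: (s ^+ 3) s3 s6 d3 gE => t t0 t2 d3 gE.
pose R := [:: 1; -1; t; t^-1; r; r^-1].
have RE z : z \notin R <-> normal_good s z.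
  rewrite normal_goodE gE dE !mulf_eq0 (negPf A0) (negPf t0) s0 /= !negb_or !subr_eq0
    addr_eq0.
  split; first by case/and5P=> -> -> -> -> /and3P[-> ->].
  by case=> _ -> -> /andP[-> ->] /andP[-> ->].
have nroot z : normal_line s z != 0 -> (z != r) && (z != r^-1).
  by rewrite dE !mulf_eq0 (negPf A0) /= negb_or !subr_eq0.
have /andP[r1 rV1] := nroot _ d1; have /andP[rN1 rVN1] := nroot _ d2.
have /andP[rs rVs] := nroot _ d3.
have n11 : 1 != -1 :> k by rewrite -subr_eq0 opprK -(natrD _ 1 1) pnatr_eq0.
have [s1 sN1] : t != 1 /\ t != -1.
  move: t2; rewrite sqrf_eq1 negb_or => /andP[]; by [].
have nt1 : 1 != t^-1 by rewrite eq_sym invr_eq1.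
have ntN1 : -1 != t^-1 by rewrite -invrN1 (inj_eq invr_inj) eq_sym.
have ntr : t^-1 != r by rewrite -[r]invrK (inj_eq invr_inj).
have nrt : t^-1 != r^-1 by rewrite (inj_eq invr_inj).
have nV (x : k) : x != 0 -> x ^+ 2 != 1 -> x != x^-1.
  move=> x0; apply: contra_neq => xE.
  by rewrite expr2 -(mulfV x0) -xE.
have nr : r != r^-1 by rewrite nV // sqrf_eq1 negb_or eq_sym r1 eq_sym.
have uR : uniq R.
  rewrite /= !inE !negb_or n11 r1 rV1 rN1 rVN1 rs rVs nt1 ntN1 ntr nrt nV // nr.
  by rewrite eq_sym s1 eq_sym sN1.
have RV x : x \in R -> x^-1 \in R.
  rewrite !inE; do 5?[case/orP]; move=> /eqP->;
  by rewrite ?invrK ?invr1 ?invrN1 ?eqxx ?orbT.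
have R0 : 0 \notin R.
  by rewrite /R !inE !negb_or ![0 == _]eq_sym oppr_eq0 !invr_eq0 !oner_eq0 t0 r0.
have [|c c0 hc] := @unit_factorization k (fun z =>
  normal_diff s z) (specialize N s) (specialize E s) (specialize E s) R uR E0 E0 qE.
  move=> x /RE okx; split; last exact: normal_diff_neq0.
  by apply: regular_normal_diff okx => //; [apply: regular_at_cst|apply: regular_line].
have N0 : specialize N s != 0.
  have [|z] := @poly_avoid _ (specialize E s * \prod_(r <- R) ('X - r%:P)).
    by rewrite mulf_neq0 // prodf_seq_neq0; apply/allP => x _; rewrite /= polyXsubC_eq0.
  rewrite hornerM mulf_eq0 negb_or -[X in _ && ~~ X]/(root _ _) root_prod_XsubC.
  move=> /andP[Ez /RE okz];
    apply: contraTneq (mulf_neq0 Ez (normal_diff_neq0 p_separates okz)).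
  by move=> N0; rewrite qE // N0 horner0 eqxx.
pose o := ord_frac (specialize N s) (specialize E s).
have oV x : x \in R -> o x^-1 = o x.
  by apply: (@ord_inv k R o c (normal_diff s)) => // z /normal_diffV->.
have [n1 e1] := diffz_ord 1 E0 N0 szN szE; have [n2 e2] := diffz_ord (-1) E0 N0 szN szE.
have [n3 e3] := diffz_ord t E0 N0 szN szE; have [n4 e4] := diffz_ord r E0 N0 szN szE.
exists (n1, n2, n3, n4), (c / t ^ o t / (lead s) ^ o r); split.
  by rewrite !mulf_neq0 ?invr_eq0 // expfz_neq0.
move=> z okz; rewrite hc; last exact/RE.
rewrite /monomial /= e1 e2 e3 e4 -/o /R !big_cons big_nil -/(o _) -!/(o _).
rewrite !oV ?inE ?eqxx ?orbT //.
rewrite gE dE !expfzMl opprK.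
have := expfz_neq0 (o r) A0; have := expfz_neq0 (o t) t0.
move: (t ^ _) (lead s ^ _) ((z - 1) ^ _) ((z + 1) ^ _) ((z - t) ^ _) ((z - t^-1) ^ _).
move: ((z - r) ^ _) ((z - r^-1) ^ _).
by clear; move=> Y Y' x y u v X X' x0 y0; field; rewrite x0 y0.
Qed.

End FibreUnitLine.

(** ** The dependence on s *)

Local Notation horner_rules :=
  (hornerD, hornerN, hornerM, hornerZ, hornerX, hornerXn, hornerC).

Section FibreUnitFormula.
Variables (k : numClosedFieldType) (S : kspace k) (F : S -> affine_space k 2).
Variables (K : cubic_cover F) (p : S -> k).
Hypothesis p_regular : is_regular p.
Hypothesis p_separates : forall x1 x2 : S, F x1 = F x2 -> p x1 = p x2 -> x1 = x2.

Local Notation a0 := (L0 K).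
Local Notation a1 := (L1 K / 3).
Local Notation a2 := (L2 K / 3).
Local Notation normal_gap := (@normal_gap k).
Local Notation normal_line := (normal_line K).
Local Notation normal_good := (normal_good K).
Local Notation normal_diff := (normal_diff K p).
Local Notation monomial := (monomial K).
Local Notation lead := (lead K).
Implicit Types (s z : k).

Hypothesis a12 : (a1 != 0) || (a2 != 0).
(* The equation of L does not vanish identically on the triples with a given s. *)
Hypothesis nondegenerate : forall s, s != 0 ->
  (lead s != 0) || (a0 * s ^+ 2 + a1 + a2 * s ^+ 4 != 0).

Lemma normal_good_poly s : s != 0 ->
  exists2 G : {poly k}, G != 0 & forall z, G.[z] != 0 -> normal_good s z.
Proof.
move=> s0; have s3 : s ^+ 3 != 0 by rewrite expf_neq0.
pose B := a0 * s ^+ 2 + a1 + a2 * s ^+ 4.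
pose D : {poly k} := lead s *: ('X ^+ 2 + 1) + B *: 'X.
have DE z : D.[z] = normal_line s z by rewrite /D !hornerE.
exists (('X - 1%:P) * ('X - (-1)%:P) * (('X - (s ^+ 3)%:P) * ((-1)%:P + s ^+ 3 *: 'X)) *
  D).
  rewrite !mulf_neq0 ?polyXsubC_eq0 ?linear_poly_neq0 ?s3 ?orbT //.
  have /orP[h|h] := nondegenerate s0; apply: contraNneq h => /polyP D0.
    have := D0 2; rewrite /D coefD !coefZ coefD coefXn coefX coef1 coef0 /=.
    by rewrite addr0 mulr1 mulr0 addr0 => ->.
  have := D0 1%N; rewrite coefD !coefZ coefD coefXn coefX coef1 coef0 /=.
  by rewrite addr0 mulr1 mulr0 add0r => /eqP.
move=> z; rewrite !hornerM !mulf_eq0 !negb_or =>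
  /andP[/andP[/andP[h1 h2] /andP[h3 h4]] h5].
apply/normal_goodE; move: h1 h2 h3 h4 h5; rewrite DE !hornerE opprK => h1 h2 h3 h4 h5;
  split=> //.
by rewrite /normal_gap mulf_neq0 // addrC.
Qed.

Lemma normal_good_exists s : s != 0 -> exists z, normal_good s z.
Proof.
move=> /normal_good_poly[G G0 hG]; have [z Gz] := poly_avoid G0.
by exists z; apply: hG.
Qed.

Lemma regular_normal_gap (X : kspace k) (x : X) (f g : X -> k) :
  regular_at x f -> regular_at x g -> regular_at x (fun y => normal_gap (f y) (g y)).
Proof.
move=> rf rg; rewrite /normal_gap.
by do ?[exact: rf|exact: rg|exact: regular_at_cst|apply: regular_sub
  |apply: regular_mul|apply: regular_exp].
Qed.

Lemma regular_normal_line (X : kspace k) (x : X) (f g : X -> k) :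
  regular_at x f -> regular_at x g -> regular_at x (fun y => normal_line (f y) (g y)).
Proof.
move=> rf rg; rewrite /normal_line.
by do ?[exact: rf|exact: rg|exact: regular_at_cst|apply: regular_add
  |apply: regular_mul|apply: regular_exp].
Qed.

Lemma regular_monomial i1 i2 j m (X : kspace k) (x : X) (f g : X -> k) :
    regular_at x f -> regular_at x g -> normal_good (f x) (g x) ->
  regular_at x (fun y => monomial i1 i2 j m (f y) (g y)).
Proof.
move=> rf rg /normal_goodE[_ n1 n2 n3 n4]; have r1 := regular_at_cst x (1 : k).
do ?apply: regular_mul; apply: regular_exprz => //.
- exact: regular_sub.
- exact: regular_add.
- exact: regular_normal_gap.
- exact: regular_normal_line.
Qed.

Lemma normal_good_near (X : kspace k) (x : X) (f g : X -> k) :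
    regular_at x f -> regular_at x g -> normal_good (f x) (g x) ->
  znbhs x [set y | normal_good (f y) (g y)].
Proof.
move=> rf rg /normal_goodE[n0 n1 n2 n3 n4]; have r1 := regular_at_cst x (1 : k).
have h0 := regular_neq0 rf n0.
have h1 := regular_neq0 (regular_sub rg r1) n1.
have h2 := regular_neq0 (regular_add rg r1) n2.
have h3 := regular_neq0 (regular_normal_gap rf rg) n3.
have h4 := regular_neq0 (regular_normal_line rf rg) n4.
apply: znbhsS (znbhsI h0 (znbhsI h1 (znbhsI h2 (znbhsI h3 h4)))) _.
by move=> y [? [? [? [? ?]]]]; apply/normal_goodE.
Qed.

(** The product of the conditions on s in normal_diff_fixed *)
Definition generic_s : {poly k} :=
  'X * ('X^6 - 1%:P) * (a1 *: 'X^3 + a2 *: 'X)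
  * (a1%:P + (2 * a2) *: 'X + a0 *: 'X^2 + (2 * a1) *: 'X^3 + a2 *: 'X^4)
  * (a1%:P - (2 * a2) *: 'X + a0 *: 'X^2 - (2 * a1) *: 'X^3 + a2 *: 'X^4)
  * (a2 *: 'X + (2 * a1) *: 'X^3 + a0 *: 'X^5 + (2 * a2) *: 'X^7 + a1 *: 'X^9).

Lemma generic_s_neq0 : generic_s != 0.
Proof.
have c12 (P : {poly k}) i j : P`_i = a1 -> P`_j = a2 -> P != 0.
  move=> Pi Pj; apply: contraTneq a12 => P0; move: Pi Pj.
  by rewrite P0 !coef0 => <- <-; rewrite eqxx.
rewrite /generic_s; do 5?[apply: mulf_neq0].
- by rewrite polyX_eq0.
- by rewrite -size_poly_eq0 size_XnsubC.
- by apply: (c12 _ 3 1%N); rewrite !coefE /= ?mulr0 ?mulr1 ?addr0 ?add0r.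
- by apply: (c12 _ 0%N 4); rewrite !coefE /= ?mulr0 ?mulr1 ?addr0 ?add0r.
- by apply: (c12 _ 0%N 4); rewrite !coefE /= ?mulr0 ?mulr1 ?oppr0 ?addr0 ?add0r.
- by apply: (c12 _ 9 1%N); rewrite !coefE /= ?mulr0 ?mulr1 ?addr0 ?add0r.
Qed.

Lemma generic_sP s : generic_s.[s] != 0 ->
  [/\ s != 0, s ^+ 6 != 1 & lead s != 0] /\
  [/\ normal_line s 1 != 0, normal_line s (-1) != 0 & normal_line s (s ^+ 3) != 0].
Proof.
have e1 : (a1%:P + (2 * a2) *: 'X + a0 *: 'X^2 + (2 * a1) *: 'X^3 + a2 *: 'X^4).[s] =
  normal_line s 1.
  by rewrite !horner_rules /normal_line; ring.
have e2 : (a1%:P - (2 * a2) *: 'X + a0 *: 'X^2 - (2 * a1) *: 'X^3 + a2 *: 'X^4).[s] =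
  - normal_line s (-1).
  by rewrite !horner_rules /normal_line; ring.
have e3 : (a2 *: 'X + (2 * a1) *: 'X^3 + a0 *: 'X^5 + (2 * a2) *: 'X^7 + a1 *: 'X^9).[s]
    = normal_line s (s ^+ 3).
  by rewrite !horner_rules /normal_line; ring.
rewrite /generic_s; rewrite 5!hornerM e1 e2 e3 !mulf_eq0 oppr_eq0 !negb_or.
have e4 : (a1 *: 'X^3 + a2 *: 'X).[s] = lead s by rewrite !horner_rules.
rewrite e4 hornerX hornerD hornerN hornerXn hornerC subr_eq0.
by case/andP=> /andP[/andP[/andP[/andP[-> ->] ->] ->] ->] ->.
Qed.

Section Quotient.
Variables (i1 i2 j m : int) (D : set k).
Hypothesis D_dense : forall Q : {poly k}, Q != 0 -> exists s, Q.[s] != 0 /\ D s.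
Hypothesis normal_diff_mon : forall s, D s ->
  exists c, forall z, normal_good s z -> normal_diff s z = c * monomial i1 i2 j m s z.

Let rho s z := normal_diff s z / monomial i1 i2 j m s z.

Lemma regular_rho (X : kspace k) (x : X) (f g : X -> k) :
    regular_at x f -> regular_at x g -> normal_good (f x) (g x) ->
  regular_at x (fun y => rho (f y) (g y)) /\ rho (f x) (g x) != 0.
Proof.
move=> rf rg h; have n := monomial_neq0 i1 i2 j m h; split.
  by apply: regular_div => //; [apply: regular_normal_diff|apply: regular_monomial].
by rewrite mulf_neq0 ?invr_eq0 //; apply: normal_diff_neq0.
Qed.

(** Both sides agree at the points s of a dense set. *)
Lemma rho_const s z z' : normal_good s z -> normal_good s z' -> rho s z = rho s z'.
Proof.
move=> h h'; apply/eqP; rewrite -subr_eq0; apply/eqP.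
have rl := regular_line (s : affine_line k).
have cst c : regular_at (s : affine_line k) (fun=> c) by exact: regular_at_cst.
have [r1 _] := regular_rho rl (cst z) h; have [r2 _] := regular_rho rl (cst z') h'.
have /znbhs_line[G Gs Gok] := znbhsI (normal_good_near rl (cst z) h) (normal_good_near
  rl (cst z') h').
have [N [E [Es NE]]] := regular_line_frac (regular_sub r1 r2).
rewrite [LHS]NE //; suff -> : N = 0 by rewrite horner0 mul0r.
apply/eqP; apply: contraT => N0.
have [|t [+ /normal_diff_mon[c tE]]] := D_dense (Q := N * E * G).
  by rewrite !mulf_neq0 ?(horner_neq0 Es) ?(horner_neq0 Gs).
rewrite !hornerM !mulf_eq0 !negb_or => /andP[/andP[Nt Et] /Gok[ok1 ok2]].
case/eqP: Nt; apply: (mulIf (invr_neq0 Et)); rewrite -NE // mul0r /rho.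
by rewrite !tE // !mulfK ?monomial_neq0 ?subrr.
Qed.

Lemma normal_diff_formula_aux : exists c (l : int), c != 0 /\
  forall s z, normal_good s z -> normal_diff s z = c * s ^ l * monomial i1 i2 j m s z.
Proof.
have [ch hch] := choose_map (0 : k) (fun s z => normal_good s z).
have {}hch s : s != 0 -> normal_good s (ch s) by move=> /normal_good_exists/hch.
pose c s := rho s (ch s).
have cst x (z : k) : regular_at (x : affine_line k) (fun=> z) by exact: regular_at_cst.
have rc (s : affine_line k) : s \notin [:: 0] -> regular_at s c /\ c s != 0.
  rewrite inE => s0; have h := hch s s0; have rl := regular_line s.
  have [r n] := regular_rho rl (cst s (ch s)) h; split=> //.
  apply: eq_regular r; apply: znbhsS (normal_good_near rl (cst s (ch s)) h) _ => t okt /=.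
  by apply: rho_const => //; apply: hch; have /normal_goodE[] := okt.
have [|r1 _] := rc 1; first by rewrite inE oner_eq0.
have [N [E [E1 NE]]] := regular_line_frac r1.
have E0 := horner_neq0 E1.
have [//|x Ex|c0 c0n cE] := @unit_factorization k c N E E [:: 0] _ E0 E0 _ rc.
  by rewrite NE // mulrC divfK.
exists c0, (ord_frac N E 0); split=> // s z h;
  have [s0 _ _ _ _] := (normal_goodE K s z).1 h.
have := cE s; rewrite inE => /(_ s0); rewrite big_seq1 subr0 => <-.
by rewrite /c (rho_const (hch s s0) h) divfK ?monomial_neq0.
Qed.

End Quotient.

(** The exponents take finitely many values, so one choice of exponents is valid
    for a dense set of values of s; hence for all of them, up to a factor that is a
    unit on s != 0, so a power of s. *)
Lemma normal_diff_formula : exists c (l i1 i2 j m : int), c != 0 /\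
  forall s z, normal_good s z -> normal_diff s z = c * s ^ l * monomial i1 i2 j m s z.
Proof.
have [z1 ok1] := normal_good_exists (oner_neq0 k).
have [N [E [E0 NE]]] := normal_diff_frac p_regular ok1.
pose n := (maxn (size N) (size E)).+1.
pose W := lead_coef E * generic_s.
have W0 : W != 0 by rewrite mulf_neq0 ?lead_coef_eq0 ?generic_s_neq0.
have [|t ht] := @finite_choice_dense k _ (fun t s => exists c, c != 0 /\
  forall z, normal_good s z -> normal_diff s z =
    c * monomial (@diffz n t.1.1.1) (@diffz n t.1.1.2)
    (@diffz n t.1.2) (@diffz n t.2) s z) W W0.
  move=> s; rewrite hornerM mulf_eq0 negb_or => /andP[Es /generic_sP].
  case=> -[s0 s6 A0] [d1 d2 d3].
  apply: (@normal_diff_fixed _ _ _ K p _ _ N E) => //.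
  - exact: NE.
  - by rewrite /n ltnS leq_maxl.
  - by rewrite /n ltnS leq_maxr.
  - exact: specialize_neq0.
have [||c [l [c0 cE]]] := @normal_diff_formula_aux (diffz t.1.1.1) (diffz t.1.1.2)
    (diffz t.1.2) (diffz t.2) [set s | exists c, c != 0 /\
  forall z, normal_good s z -> normal_diff s z =
    c * monomial (@diffz n t.1.1.1) (@diffz n t.1.1.2)
    (@diffz n t.1.2) (@diffz n t.2) s z].
- by move=> Q /ht[s [_ Qs h]]; exists s.
- by move=> s [c [_ h]]; exists c.
by exists c, l, (diffz t.1.1.1), (diffz t.1.1.2), (diffz t.1.2), (diffz t.2).
Qed.

End FibreUnitFormula.

(** ** The exponents *)

Section FibreUnitContradiction.
Variables (k : numClosedFieldType) (S : kspace k) (F : S -> affine_space k 2).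
Variables (K : cubic_cover F) (p : S -> k).
Hypothesis p_regular : is_regular p.
Hypothesis p_separates : forall x1 x2 : S, F x1 = F x2 -> p x1 = p x2 -> x1 = x2.

Local Notation a0 := (L0 K).
Local Notation a1 := (L1 K / 3).
Local Notation a2 := (L2 K / 3).
Local Notation normal_gap := (@normal_gap k).
Local Notation normal_line := (normal_line K).
Local Notation normal_good := (normal_good K).
Local Notation normal_diff := (normal_diff K p).
Local Notation monomial := (monomial K).
Local Notation lead := (lead K).
Implicit Types (s z : k).

Hypothesis a12 : (a1 != 0) || (a2 != 0).
Hypothesis nondegenerate : forall s, s != 0 ->
  (lead s != 0) || (a0 * s ^+ 2 + a1 + a2 * s ^+ 4 != 0).

Section Exponents.
Variables (c : k) (l i1 i2 j m : int).
Hypothesis c0 : c != 0.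
Hypothesis diffE : forall s z, normal_good s z -> normal_diff s z =
  c * s ^ l * monomial i1 i2 j m s z.

(** Compare the orders at z = 1 in the identity normal_diffN. *)
Lemma exponents_sign : i1 = i2.
Proof.
apply/eqP; rewrite -subr_eq0; apply/eqP.
have [G G0 hG] := normal_good_poly nondegenerate (oner_neq0 k).
have cst a : regular_at (1 : affine_line k) (fun=> a) by exact: regular_at_cst.
have rl := regular_line (1 : affine_line k).
have n2 : 1 + 1 != 0 :> k by rewrite -(natrD _ 1 1) pnatr_eq0.
have n1 : -1 != 0 :> k by rewrite oppr_eq0 oner_eq0.
pose u (z : affine_line k) : k := (z + 1) ^ i2.
pose v (z : affine_line k) : k := (-1) ^ (l + i1 + i2 + j + m) * (z + 1) ^ i1.
apply: (@order_unique _ 1 _ u v (G * ('X - 1%:P))).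
- by apply: regular_exprz => //; apply: regular_add.
- by rewrite expfz_neq0.
- apply: regular_mul => //; apply: regular_exprz => //; exact: regular_add.
- by rewrite mulf_neq0 ?expfz_neq0.
- by rewrite mulf_neq0 ?polyXsubC_eq0.
move=> z; rewrite hornerM mulf_eq0 negb_or hornerXsubC => /andP[/hG h z1].
have [_ _ z2 g0 d0] := (normal_goodE K 1 z).1 h.
have gN : normal_gap (-1) (- z) = - normal_gap 1 z by rewrite /normal_gap; ring.
have dN : normal_line (-1) (- z) = - normal_line 1 z by rewrite /normal_line; ring.
have hN : normal_good (-1) (- z).
  apply/normal_goodE; rewrite gN dN !oppr_eq0 oner_eq0; split=> //.
    by rewrite -opprD oppr_eq0.
  by rewrite addrC subr_eq0 eq_sym -subr_eq0.
have := diffE hN; rewrite normal_diffN (diffE h) exp1rz /monomial gN dN.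
have -> : - z - 1 = -1 * (z + 1) by ring.
have -> : - z + 1 = -1 * (z - 1) by ring.
rewrite -(mulN1r (normal_gap 1 z)) -(mulN1r (normal_line 1 z)).
move: (normal_gap 1 z) g0 (normal_line 1 z) d0 => g g0 d d0; rewrite !expfzMl => e.
have B0 := expfz_neq0 i2 z1.
have X0 : c * g ^ j * d ^ m * (z - 1) ^ i2 != 0 by rewrite !mulf_neq0 // expfz_neq0.
rewrite /u /v !expfzDr // -invr_expz; apply: (mulIf X0).
move: (g ^ j) (d ^ m) ((z - 1) ^ i2) B0 e => g' d' B B0 e.
by rewrite [LHS](_ : _ = c * 1 * ((z - 1) ^ i1 * (z + 1) ^ i2 * g' * d')); [rewrite e;
  ring|field].
Qed.

(** Compare the orders at z = 0 in the identity normal_diffV. *)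
Lemma exponents_inv : i1 + i2 + (j + m) * 2 = 0.
Proof.
have [G G0 hG] := normal_good_poly nondegenerate (oner_neq0 k).
have cst a : regular_at (0 : affine_line k) (fun=> a) by exact: regular_at_cst.
have n1 : -1 != 0 :> k by rewrite oppr_eq0 oner_eq0.
apply/eqP; rewrite -oppr_eq0; apply/eqP.
apply: (@order_unique _ 0 _ (fun=> (-1) ^ i1) (fun=> -1) (G * 'X)) => //.
- by rewrite expfz_neq0.
- by rewrite mulf_neq0 ?polyX_eq0.
move=> z; rewrite hornerM mulf_eq0 negb_or hornerX subr0 => /andP[/hG h z0].
have [_ z1 z2 g0 d0] := (normal_goodE K 1 z).1 h.
have M0 := mulf_neq0 c0 (monomial_neq0 i1 i2 j m h).
have := diffE (normal_goodV z0 h); rewrite normal_diffV // (diffE h) exp1rz /monomial.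
have -> : z^-1 - 1 = -1 * (z - 1) * z^-1 by field.
have -> : z^-1 + 1 = (z + 1) * z^-1 by field.
have -> : normal_gap 1 z^-1 = normal_gap 1 z * (z^-1 * z^-1) by rewrite /normal_gap;
  field.
have -> : normal_line 1 z^-1 = normal_line 1 z * (z^-1 * z^-1) by rewrite /normal_line;
  field.
move: M0; rewrite /monomial; move: (normal_gap 1 z) (normal_line 1 z) => g d M0;
  rewrite !expfzMl => e.
apply: (mulIf M0); rewrite mulN1r -[c in RHS]mulr1 e.
have -> : - (i1 + i2 + (j + m) * 2) = (- i1) + (- i2) + (- j) + (- j) + (- m) + (- m) by
  ring.
rewrite !expfzDr // -!exprz_inv; ring.
Qed.

(** On a curve of triples that is good at e = 0, the difference has order 0 at
    e = 0, even if the normalized parameters s = f(e) and z = g(e) degenerate. *)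
Lemma exponents_curve (A1 A2 A3 : affine_line k -> k * k) (f g : k -> k)
    (P1 P2 P3 P4 : {poly k}) (b0 b1 b2 b3 b4 : int) :
    (forall i : bool, regular_at (0 : affine_line k)
      (fun y => if i then (A1 y).1 else (A1 y).2)) ->
    (forall i : bool, regular_at (0 : affine_line k)
      (fun y => if i then (A2 y).1 else (A2 y).2)) ->
    (forall i : bool, regular_at (0 : affine_line k)
      (fun y => if i then (A3 y).1 else (A3 y).2)) ->
    (forall y, in_net (A1 y) (A2 y) (A3 y)) -> good K (A1 0) (A2 0) (A3 0) ->
    P1.[0] != 0 -> P2.[0] != 0 -> P3.[0] != 0 -> P4.[0] != 0 ->
    (forall e, e != 0 -> pdiff K p (A1 e) (A2 e) (A3 e) = normal_diff (f e) (g e)) ->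
    (forall e, e != 0 -> f e = e ^ b0 /\ [/\ g e - 1 = e ^ b1 * P1.[e],
      g e + 1 = e ^ b2 * P2.[e], normal_gap (f e) (g e) = e ^ b3 * P3.[e]
      & normal_line (f e) (g e) = e ^ b4 * P4.[e]]) ->
  b0 * l + b1 * i1 + b2 * i2 + b3 * j + b4 * m = 0.
Proof.
move=> r1 r2 r3 net good0 p1 p2 p3 p4 pE fE.
have cst a : regular_at (0 : affine_line k) (fun=> a) by exact: regular_at_cst.
have rl := regular_line (0 : affine_line k).
pose u (e : affine_line k) : k :=
  c * (P1.[e] ^ i1 * P2.[e] ^ i2 * P3.[e] ^ j * P4.[e] ^ m).
apply: (@order_unique _ 0 _ u (fun e => pdiff K p (A1 e) (A2 e) (A3 e))
  ('X * (P1 * P2 * P3 * P4))).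
- by apply: regular_mul => //; do ?apply: regular_mul;
    apply: regular_exprz => //; apply: regular_horner.
- by rewrite !mulf_neq0 ?expfz_neq0.
- exact: regular_pdiff.
- exact: pdiff_neq0 good0.
- by rewrite !mulf_neq0 ?polyX_eq0 ?(horner_neq0 p1) ?(horner_neq0 p2)
    ?(horner_neq0 p3) ?(horner_neq0 p4).
move=> e; rewrite !hornerM hornerX !mulf_eq0 !negb_or subr0.
move=> /andP[e0 /andP[/andP[/andP[n1 n2] n3] n4]].
have [f_e [g1 g2 gme dle]] := fE e e0; rewrite pE //.
have h : normal_good (f e) (g e).
  by apply/normal_goodE; rewrite f_e g1 g2 -f_e gme dle; split;
    rewrite ?mulf_neq0 ?expfz_neq0 // f_e expfz_neq0.
rewrite diffE // /monomial g1 g2 gme dle f_e /u !expfzMl !exprz_exp !expfzDr //.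
by ring.
Qed.

(** The two curves of triples tend to (w : 1), (1 : 0), (0 : 1) and to (w : 1),
    (0 : 1), (1 : 0). *)
Lemma exponents : [/\ i1 = j, i2 = j, l = j & m = - (j * 2)].
Proof.
(* The second condition on w keeps the limits of the two curves off L. *)
have [w] : exists w : k, ('X * (a2%:P + a1 *: 'X)).[w] != 0.
  by apply: poly_avoid; rewrite mulf_neq0 ?polyX_eq0 ?linear_poly_neq0 // orbC.
rewrite hornerM hornerX horner_linear mulf_eq0 negb_or => /andP[w0 wa].
have cst a : regular_at (0 : affine_line k) (fun=> a) by exact: regular_at_cst.
have rl := regular_line (0 : affine_line k).
have n3 : 3 != 0 :> k by rewrite pnatr_eq0.
have eB : 1 * l + 0 * i1 + 0 * i2 + 1 * j + 1 * m = 0.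
  apply: (@exponents_curve (fun=> (w, 1)) (fun e => (1, w * e ^+ 2)) (fun e =>
    (e ^+ 2, 1))
    id (fun e => w * e) (w *: 'X - 1%:P) (w *: 'X + 1%:P)
    ((w%:P - 'X^2) * (w *: 'X^4 - 1%:P))
    ((a1 *: 'X^2 + a2%:P) * ((w ^+ 2) *: 'X^2 + 1%:P)
      + w *: (a0 *: 'X^2 + a1%:P + a2 *: 'X^4))).
  - exact: regular_at_pair.
  - apply: regular_at_pair => //; apply: regular_mul => //; exact: regular_exp.
  - by apply: regular_at_pair => //; apply: regular_exp.
  - by move=> y; rewrite /in_net /tri0 /=; ring.
  - split.
    + by rewrite /in_net /tri0 /=; ring.
    + rewrite [X in X != 0](_ : _ = a2 + w * a1) // /tri_line /tri0 /tri1 /tri2 /=.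
      by field.
    + by rewrite /vdet /= expr0n /= !mulr0 sub0r mulr1 oppr_eq0 oner_eq0.
    + by rewrite /vdet /= expr0n /= mulr1 mulr0 subr0.
    + by rewrite /vdet /= expr0n /= mulr1 mulr0 subr0 oner_eq0.
  - by rewrite !horner_rules mulr0 sub0r oppr_eq0 oner_eq0.
  - by rewrite !horner_rules mulr0 add0r oner_eq0.
  - rewrite [X in X != 0](_ : _ = - w) ?oppr_eq0 // !horner_rules; ring.
  - rewrite [X in X != 0](_ : _ = a2 + w * a1) // !horner_rules; ring.
  - move=> e e0; rewrite /normal_diff -(@pdiff_scale _ _ _ K p e 1 1) ?oner_neq0 //.
    rewrite /scaleA /= !mul1r !mulr1; congr (pdiff _ _ (_, _) (_, _) _); ring.
  - move=> e e0; split=> //; rewrite !horner_rules expr0z expr1z; split;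
      rewrite /normal_gap /normal_line; ring.
have eC : -1 * l + -1 * i1 + -1 * i2 + -7 * j + -5 * m = 0.
  apply: (@exponents_curve (fun=> (w, 1)) (fun e => (e ^+ 2, w)) (fun e => (1, e ^+ 2))
    (fun e => e^-1) (fun e => w / e) (w%:P - 'X) (w%:P + 'X)
    ((w *: 'X^2 - 1%:P) * (w%:P - 'X^4))
    ((a2 *: 'X^2 + a1%:P) * ('X^2 + (w ^+ 2)%:P)
      + w *: (a0 *: 'X^2 + a1 *: 'X^4 + a2%:P))).
  - exact: regular_at_pair.
  - by apply: regular_at_pair => //; apply: regular_exp.
  - by apply: regular_at_pair => //; apply: regular_exp.
  - by move=> y; rewrite /in_net /tri0 /=; ring.
  - split.
    + by rewrite /in_net /tri0 /=; ring.
    + rewrite [X in X != 0](_ : _ = w * (a2 + w * a1)) ?mulf_neq0 //.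
      by rewrite /tri_line /tri0 /tri1 /tri2 /=; field.
    + by rewrite /vdet /= expr0n /= mulr0 subr0 mulf_neq0.
    + by rewrite /vdet /= expr0n /= mulr1 mulr0 sub0r oppr_eq0 oner_eq0.
    + by rewrite /vdet /= expr0n /= mulr1 mulr0 sub0r oppr_eq0.
  - by rewrite !horner_rules subr0.
  - by rewrite !horner_rules addr0.
  - rewrite [X in X != 0](_ : _ = - w) ?oppr_eq0 // !horner_rules; ring.
  - rewrite [X in X != 0](_ : _ = w * (a2 + w * a1)) ?mulf_neq0 // !horner_rules; ring.
  - move=> e e0; rewrite /normal_diff -(@pdiff_scale _ _ _ K p e (e ^+ 2) (e ^+ 2) (w /
      e, _)) ?expf_neq0 //.
    rewrite /scaleA /= !mulr1; congr (pdiff _ _ (_, _) (_, _) (_, _)); by field.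
  - move=> e e0; split; first by [].
    rewrite !horner_rules [e ^ (-1)](_ : _ = e^-1) // [e ^ (-7)](_ : _ = e ^- 7) //.
    rewrite [e ^ (-5)](_ : _ = e ^- 5) //; split; rewrite /normal_gap /normal_line;
      by field.
have eI := exponents_inv; have eS := exponents_sign.
by split; lia.
Qed.

End Exponents.
(** ** Contradiction *)

(** A square root of the discriminant of the cubic, made homogeneous of degree 0 in
    each root by means of the equation of L *)
Definition vandermonde (A1 A2 A3 : k * k) : k :=
  vdet A1 A2 * vdet A2 A3 * vdet A3 A1 / tri_line K A1 A2 A3 ^+ 2.

Lemma good_scale c1 c2 c3 A1 A2 A3 : c1 != 0 -> c2 != 0 -> c3 != 0 ->
  good K (scaleA c1 A1) (scaleA c2 A2) (scaleA c3 A3) -> good K A1 A2 A3.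
Proof.
move=> n1 n2 n3; have n : c1 * c2 * c3 != 0 by rewrite !mulf_neq0.
have e c d A B : vdet (scaleA c A) (scaleA d B) = c * d * vdet A B.
  by rewrite /vdet /=; ring.
rewrite /good tri_line_scale !e !mulf_eq0 !negb_or => -[net].
move=> /andP[_ h0] /andP[_ h1] /andP[_ h2] /andP[_ h3]; split=> //.
move: net; rewrite /in_net; have /= [-> _ _] := tri_scale c1 c2 c3 A1 A2 A3 => net.
by apply: (mulfI n); rewrite net; ring.
Qed.

Lemma pdiff_vandermonde : exists c (j : int), c != 0 /\
  forall A1 A2 A3, A1.1 != 0 -> A1.2 != 0 -> A2.1 != 0 -> A3.1 != 0 -> A3.2 != 0 ->
    good K A1 A2 A3 -> pdiff K p A1 A2 A3 = c * vandermonde A1 A2 A3 ^ j.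
Proof.
have [c [l [i1 [i2 [j [m [c0 diffE]]]]]]] := normal_diff_formula p_regular p_separates
  a12 nondegenerate.
have [e1 e2 e3 e4] := exponents c0 diffE; exists c, j; split=> //.
move=> [s1 t1] [s2 t2] [s3 t3] /= s10 t10 s20 s30 t30 gd; have [net _ _ _ _] := gd.
pose s := sqrtC (s3 / t3); have sE : s ^+ 2 = s3 / t3 by rewrite sqrtCK.
have s0 : s != 0.
  have : s ^+ 2 != 0 by rewrite sE mulf_neq0 ?invr_eq0.
  by rewrite expf_eq0.
pose z := s * s1 / t1.
have E1 : (s1, t1) = scaleA (t1 / s) (z, s).
  by rewrite /scaleA /z /=; congr (_, _); field; rewrite ?s0 ?t10.
have E2 : (s2, t2) = scaleA s2 (1, s * z).
  rewrite /scaleA /= mulr1; congr (_, _); rewrite /z.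
  have -> : s * (s * s1 / t1) = s3 / t3 * s1 / t1 by rewrite -sE; ring.
  move: net; rewrite /in_net /tri0 /= => net.
  apply: (mulIf (mulf_neq0 t10 t30)); transitivity (t1 * t2 * t3); first by ring.
  by rewrite -net; field; rewrite t10 t30.
have E3 : (s3, t3) = scaleA t3 (s ^+ 2, 1).
  by rewrite /scaleA /= mulr1 sE; congr (_, _); field.
have n1 : t1 / s != 0 by rewrite mulf_neq0 ?invr_eq0.
move: gd; rewrite E1 E2 E3 pdiff_scale // => gd.
have h : normal_good s z := good_scale n1 s20 t30 gd.
rewrite -/(normal_diff s z) diffE // /vandermonde tri_line_scale normal_lineE.
have [_ _ _ g0 d0] := (normal_goodE K s z).1 h.
rewrite /monomial e1 e2 e3 e4 -mulrA; congr (_ * _).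
have -> : vdet (scaleA (t1 / s) (z, s)) (scaleA s2 (1, s * z)) *
     vdet (scaleA s2 (1, s * z)) (scaleA t3 (s ^+ 2, 1)) *
     vdet (scaleA t3 (s ^+ 2, 1)) (scaleA (t1 / s) (z, s)) /
     (t1 / s * s2 * t3 * normal_line s z) ^+ 2 =
       s * (z - 1) * (z + 1) * normal_gap s z * (normal_line s z)^-1 * (normal_line s
       z)^-1.
  rewrite /vdet /scaleA /normal_gap /=; move: (normal_line s z) d0 => d d0.
  by field; rewrite ?(d0, t30, s20, s0, t10).
rewrite !expfzMl.
have -> : - (j * 2) = - j + - j by ring.
by rewrite expfzDr // -!exprz_inv; ring.
Qed.

Lemma vandermonde_cyc A1 A2 A3 : vandermonde A2 A3 A1 = vandermonde A1 A2 A3.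
Proof. by rewrite /vandermonde tri_line_cyc; ring. Qed.

Lemma vandermonde_neq0 A1 A2 A3 : good K A1 A2 A3 -> vandermonde A1 A2 A3 != 0.
Proof.
move=> [_ D0 v12 v13 v23]; rewrite /vandermonde [vdet A3 A1]vdetC.
by rewrite !mulf_neq0 ?invr_eq0 ?oppr_eq0 ?expf_neq0.
Qed.

(** The formula for the difference of p at two roots is invariant under cyclic
    permutations of the three roots, while the three differences add up to 0. *)
Lemma fibre_separation_false : False.
Proof.
have [c [j [c0 pE]]] := pdiff_vandermonde.
have [G G0 hG] := normal_good_poly nondegenerate (oner_neq0 k).
have [|z] := @poly_avoid _ ('X * G); first by rewrite mulf_neq0 ?polyX_eq0.
rewrite hornerM hornerX mulf_eq0 negb_or => /andP[z0 /hG h].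
have h1 := oner_neq0 k; have h2 := good_cyc h; have h3 := good_cyc h2.
have := pdiff_cyc K p (z, 1) (1, 1 * z) (1 ^+ 2, 1).
have n2 : 1 ^+ 2 != 0 :> k by rewrite expr1n.
have n3 : 1 * z != 0 by rewrite mul1r.
rewrite !pE //= (vandermonde_cyc (1, 1 * z)) (vandermonde_cyc (z, 1)) -mulrDl -mulrDl.
apply/eqP; rewrite mulf_neq0 ?expfz_neq0 ?vandermonde_neq0 //.
rewrite [X in X != 0](_ : _ = 3 * c); last by ring.
by rewrite mulf_neq0 // pnatr_eq0.
Qed.

End FibreUnitContradiction.

(** * Generic conics *)

Section FormsMap.
Variables (A B : comNzRingType) (f : {rmorphism A -> B}).

Lemma Qform_map i (x : 'rV[A]_3) : Qform i (map_mx f x) = f (Qform i x).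
Proof. by rewrite /Qform !mxE !(rmorphB, rmorphXn, rmorph_nat, rmorphM). Qed.

Lemma conic_map (a x : 'rV[A]_3) : conic (map_mx f a) (map_mx f x) = f (conic a x).
Proof.
by rewrite /conic rmorph_sum; apply: eq_bigr => i _; rewrite Qform_map mxE rmorphM.
Qed.

Lemma cubic_map (x : 'rV[A]_3) : cubic (map_mx f x) = f (cubic x).
Proof.
rewrite /cubic rmorphB rmorph_sum; congr (_ - _); last first.
  by rewrite !mxE !rmorphM rmorph_nat.
apply: eq_bigr => i _; rewrite rmorph_sum; apply: eq_bigr => j _.
by rewrite !mxE !(rmorphXn, rmorphM).
Qed.

End FormsMap.

Section Generic.
Variables (k : numClosedFieldType) (w : k) (a : 'rV[k]_3).
Hypothesis w2 : w ^+ 2 = - w - 1.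
Local Notation unf := (unfour w).

Lemma ray_map (x v : 'rV[k]_3) t : map_mx (horner_eval t) (ray x v) = x + t *: v.
Proof. by apply/rowP => i; rewrite !mxE /horner_eval !hornerE. Qed.

Lemma horner_cubic_ray (x v : 'rV[k]_3) t : (cubic (ray x v)).[t] = cubic (x + t *: v).
Proof. by rewrite -horner_evalE -cubic_map ray_map. Qed.

Lemma horner_conic_ray (x v : 'rV[k]_3) t :
  (conic (map_mx polyC a) (ray x v)).[t] = conic a (x + t *: v).
Proof.
rewrite -horner_evalE -conic_map ray_map; congr (conic _ _).
by apply/rowP => i; rewrite !mxE /= /horner_eval hornerC.
Qed.

Lemma poly_eqP (P Q : {poly k}) : (forall t, P.[t] = Q.[t]) -> P = Q.
Proof.
move=> PQ; apply/eqP; rewrite -subr_eq0; apply/eqP/poly_fun_eq0 => t.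
by rewrite hornerD hornerN PQ subrr.
Qed.

(** The excluded conics are (e x1 - s x2)(2 s e x0 - s^2 x1 - e^2 x2) = 0 in Fourier
    coordinates. They are singular at the point (s^3 + e^3, 2 s^2 e, 2 s e^2) of R. *)
Lemma generic_net (s e m : k) : kulikov_generic a -> (s != 0) || (e != 0) ->
  line_form a (unf 1 0 0) = m * (s ^+ 3 - e ^+ 3) ->
  line_form a (unf 0 1 0) = 3 * m * s * e ^+ 2 ->
  line_form a (unf 0 0 1) = - (3 * m * s ^+ 2 * e) -> False.
Proof.
move=> gen se l0 l1 l2; have n2 : 2 != 0 :> k by rewrite pnatr_eq0.
have n3 : 3 != 0 :> k by rewrite pnatr_eq0.
have conicF u y z : conic a (unf u y z) =
    9 * m * ((e * y - s * z) * (2 * u * s * e - s ^+ 2 * y - e ^+ 2 * z)).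
  by rewrite conicE netQ_four // line_form_unfour l0 l1 l2; ring.
pose u := s ^+ 3 + e ^+ 3; pose y := 2 * s ^+ 2 * e; pose z := 2 * s * e ^+ 2.
have x0 : unf u y z != 0.
  rewrite unfour_eq0 // !negb_and /u /y /z; have [s0|s0] := eqVneq s 0.
    by move: se; rewrite s0 eqxx expr0n add0r expf_eq0 /= => ->.
  have [->|e0] := eqVneq e 0; first by rewrite expr0n addr0 expf_neq0.
  by rewrite !mulf_neq0 ?orbT ?expf_neq0.
have [x [c c0 xE]] := hc_exists x0.
have rayE v0 v1 v2 t : hc x + t *: unf v0 v1 v2 =
    unf (c * u + t * v0) (c * y + t * v1) (c * z + t * v2).
  by rewrite xE !unfourZ unfourD.
have conic1 v0 v1 v2 : (conic (map_mx polyC a) (ray (hc x) (unf v0 v1 v2)))`_1 = 0.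
  rewrite [conic _ _](_ : _ = (conic a (unf v0 v1 v2)) *: 'X^2) ?coefZ ?coefXn ?mulr0 //.
  apply: poly_eqP => t; rewrite horner_conic_ray rayE !conicF hornerZ hornerXn.
  by rewrite /u /y /z; ring.
have [Cx Rx] : conic a (hc x) = 0 /\ cubic (hc x) = 0.
  rewrite xE unfourZ conicF cubic_four // /u /y /z; split; ring.
have tr v0 v1 v2 := gen x Cx Rx (unf v0 v1 v2) (conic1 v0 v1 v2).
have memx v0 v1 v2 : unf v0 v1 v2 \in val x ->
    exists d, [/\ v0 = d * u, v1 = d * y & v2 = d * z].
  rewrite hc_span => /vlineP[d]; rewrite xE scalerA unfourZ => E; exists (d * c).
  have := congr1 (@four0 k) E; have := congr1 (four1 w) E; have := congr1 (four2 w) E.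
  by rewrite !fourK // => /(mulfI n3) -> /(mulfI n3) -> /(mulfI n3) ->.
have cubicF v0 v1 v2 t : (cubic (ray (hc x) (unf v0 v1 v2))).[t] =
    9 * (2 * (c * u + t * v0) * (c * y + t * v1) * (c * z + t * v2)
      - (c * y + t * v1) ^+ 3 - (c * z + t * v2) ^+ 3).
  by rewrite horner_cubic_ray rayE cubic_four.
have [se0|se0] := eqVneq (s * e) 0.
  have [y0 z0] : y = 0 /\ z = 0.
    have yE : y = 2 * (s * e) * s by rewrite /y; ring.
    have zE : z = 2 * (s * e) * e by rewrite /z; ring.
    by rewrite yE zE se0 mulr0 !mul0r.
  have [|d [_ d1 _]] := memx 0 1 0.
    apply: tr; rewrite [cubic _](_ : _ = -9 *: 'X^3).
      by rewrite coefZ coefXn; case: ifP; rewrite mulr0.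
    apply: poly_eqP => t; rewrite cubicF y0 z0 hornerZ hornerXn; ring.
  by move/eqP: d1; rewrite y0 mulr0 oner_eq0.
have [s0 e0] : s != 0 /\ e != 0 by move: se0; rewrite mulf_eq0 negb_or => /andP[].
have y0 : y != 0 by rewrite /y !mulf_neq0 ?expf_neq0.
have z0 : z != 0 by rewrite /z !mulf_neq0 ?expf_neq0.
have [|d [_ d1 d2]] := memx (2 * s ^+ 3 - e ^+ 3) (2 * s ^+ 2 * e) 0.
  apply: tr; rewrite ifN.
    pose v0 := 2 * s ^+ 3 - e ^+ 3; pose v1 := 2 * s ^+ 2 * e.
    rewrite [cubic _](_ : _ = (9 * (2 * v0 * v1 * c * z - 3 * c * y * v1 ^+ 2)) *: 'X^2
        - (9 * v1 ^+ 3) *: 'X^3).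
      by rewrite coefB !coefZ !coefXn !mulr0 subr0.
    apply: poly_eqP => t; rewrite cubicF hornerD hornerN !hornerZ !hornerXn.
    by rewrite /v0 /v1 /u /y /z; ring.
  apply: contra y0 => /eqP xP.
  have P1 : P111 k = <[unf 1 0 0]>%VS.
    by congr <[_]>%VS; apply: row3P; rewrite unfourE mxE; ring.
  move: xP; rewrite P1 => /hc_line[d _]; rewrite xE !unfourZ !mulr0.
  move=> /(congr1 (four1 w)); rewrite !fourK // !mulr0 => /eqP.
  by rewrite mulf_eq0 (negPf n3) mulf_eq0 (negPf c0).
have d0 : d = 0 by apply/eqP; move/esym/eqP: d2; rewrite mulf_eq0 (negPf z0) orbF.
by move/eqP: d1; rewrite d0 mul0r; apply/negP.
Qed.

Lemma generic_nondegenerate (F : kulikov_surface a -> affine_space k 2) (K : cubic_cover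
  F) :
    kulikov_generic a -> L0 K = line_form a (unf 1 0 0) ->
    L1 K = line_form a (unf 0 1 0) -> L2 K = line_form a (unf 0 0 1) ->
  (L1 K / 3 != 0) || (L2 K / 3 != 0) /\
  forall s, s != 0 -> (lead K s != 0) ||
    (L0 K * s ^+ 2 + L1 K / 3 + L2 K / 3 * s ^+ 4 != 0).
Proof.
move=> gen l0 l1 l2; have n3 : 3 != 0 :> k by rewrite pnatr_eq0.
split.
  apply: contraT; rewrite negb_or !negbK !mulf_eq0 invr_eq0 (negPf n3) !orbF.
  move=> /andP[/eqP h1 /eqP h2]; exfalso.
  apply: (generic_net (s := 1) (e := 0) (m := L0 K) gen); first by rewrite oner_neq0.
  - by rewrite -l0; ring.
  - by rewrite -l1 h1; ring.
  - by rewrite -l2 h2; ring.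
move=> s s0; apply: contraT; rewrite negb_or !negbK => /andP[/eqP A0 /eqP B0]; exfalso.
have h2 : L2 K = - L1 K * s ^+ 2.
  have : s * (L1 K * s ^+ 2 + L2 K) = 0.
    by transitivity (3 * lead K s); [rewrite /lead; field|rewrite A0 mulr0].
  by move=> /eqP; rewrite mulf_eq0 (negPf s0) addrC addr_eq0 mulNr => /eqP.
have h0 : L0 K = L1 K / 3 / s ^+ 2 * (s ^+ 6 - 1).
  rewrite h2 in B0; apply/eqP; rewrite -subr_eq0; apply/eqP.
  transitivity ((L0 K * s ^+ 2 + L1 K / 3 + - L1 K * s ^+ 2 / 3 * s ^+ 4) / s ^+ 2).
    by field; rewrite s0.
  by rewrite B0 mul0r.
apply: (generic_net (s := s ^+ 2) (e := 1) (m := L1 K / 3 / s ^+ 2) gen).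
- by rewrite oner_neq0 orbT.
- by rewrite -l0 h0; ring.
- by rewrite -l1; field.
- by rewrite -l2 h2; field.
Qed.

End Generic.

(** * The suspension *)

Lemma cube_root_unity (k : numClosedFieldType) : exists w : k, w ^+ 2 = - w - 1.
Proof.
have /closed_rootP[w] : size ('X^2 + 'X + 1%:P : {poly k}) != 1%N.
  apply/eqP => /eqP/size_poly1P[c _ /polyP/(_ 2)].
  by rewrite !coefE /= !addr0 => /eqP; rewrite oner_eq0.
rewrite rootE !(hornerD, hornerXn, hornerX, hornerC) => /eqP w0; exists w.
by apply/eqP; rewrite -subr_eq0 opprD !opprK addrA w0.
Qed.

Theorem kulikov_suspension (k : numClosedFieldType) (a : 'rV[k]_3)
    (F : kulikov_surface a -> affine_space k 2) (p : kulikov_surface a -> k) :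
  kulikov_generic a -> kulikov_morphism F -> is_regular p -> primitive_element F p ->
  let S0 : set (prod_space (affine_line k) (kulikov_surface a)) :=
    [set z | z.1 = 0] in
  let Fbar := suspension p F in
  let Z := zclosure (Fbar @` S0) in
  etale Fbar /\
  exists Fbar0 : sub_space S0 -> sub_space Z,
    [/\ forall z, sval (Fbar0 z) = Fbar (sval z), is_morphism Fbar0
      & ~ etale Fbar0].
Proof.
move=> gen Fm p_regular prim S0 Fbar Z.
have [w w2] := cube_root_unity k.
have [K [l0 l1 l2]] := kulikov_cubic_cover w2 Fm.
have FbarE : etale Fbar := susp_etale K p_regular; split=> //.
have inZ (z : sub_space S0) : Z (Fbar (sval z)).
  by move=> N /znbhs_self nN; exists (Fbar (sval z)); split=> //;
    exists (sval z) => //; case: z {nN}.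
pose Fbar0 (z : sub_space S0) : sub_space Z := exist _ _ (inZ z).
exists Fbar0; split=> //.
  apply/morph_at_morphism => z; apply: morph_at_sub.
  apply: (@morph_at_comp _ _ _ _ (fun z : sub_space S0 => sval z) Fbar).
    exact: morph_at_sval.
  exact: FbarE.1.
move=> et; have [a12 dl0] := generic_nondegenerate w2 gen l0 l1 l2.
apply: (fibre_separation_false p_regular _ a12 dl0).
exact: (etale_separates K p_regular prim (Fbar0 := Fbar0)).
Qed.

Theorem corollary1 (R : realType) (a : 'rV[R[i]]_3)
    (F : kulikov_surface a -> affine_space R[i] 2) (p : kulikov_surface a -> R[i]) :
  kulikov_generic a ->
  kulikov_morphism F ->
  is_regular p ->
  primitive_element F p ->
  let S0 : set (prod_space (affine_line R[i]) (kulikov_surface a)) :=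
    [set z | z.1 = 0] in
  let Fbar := suspension p F in
  let Z := zclosure (Fbar @` S0) in
  etale Fbar /\
  exists Fbar0 : sub_space S0 -> sub_space Z,
    [/\ forall z, sval (Fbar0 z) = Fbar (sval z),
        is_morphism Fbar0
      & ~ etale Fbar0].
Proof. exact: kulikov_suspension. Qed.
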